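(* Let $V$ be a vertex superalgebra with a Hamiltonian operator $H$ whose eigenvalues are real, and let $g$ be a diagonalizable automorphism of $V$ commuting with $H$ all of whose eigenvalues have modulus $1$. Suppose that $V$ is freely generated by free generators $\{e_\alpha\}_{\alpha\in I}$ homogeneous for $g$, $H$ and the parity, with an ordered index set $I$, and is pregraded by $\Gamma_{\ge0}$ with respect to a $\Gamma_{>0}$-grading of $\{e_\alpha\}_{\alpha\in I}$. Let $\tau\colon V_{g,H}\twoheadrightarrow \operatorname{Zhu}_{g,H}V$ be the canonical projection, and put $$\mathfrak v_{g,H}=\operatorname{Span}_{\mathbb C}\{e_\alpha\mid\alpha\in I,\ (g\circ\theta_H^{-1})(e_\alpha)=e_\alpha\},\quad R_{g,H}=\mathbb C[\partial]\otimes\mathfrak v_{g,H}=\sum_{k\ge0}\partial^k\mathfrak v_{g,H}\subset V_{g,H},\quad \operatorname{Zhu}_{g,H}R:=\tau(R_{g,H}).$$ Then $\operatorname{Zhu}_{g,H}R$ has a structure of a non-linear Lie superalgebra such that $\operatorname{Zhu}_{g,H}V\simeq U(\operatorname{Zhu}_{g,H}R)$. In particular, $\operatorname{Zhu}_{g,H}V$ is an associative superalgebra generated by $\tau(\mathfrak v_{g,H})\simeq\mathfrak v_{g,H}$ with the defining relations $$[\tau(a),\tau(b)]=\sum_{j=0}^\infty\binom{\Delta_a-1}{j}\tau(a_{(j)}b),\qquad a,b\in\mathfrak v_{g,H}.$$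
   Context: **Vertex superalgebras.** Over $\mathbb C$; vacuum $|0\rangle$, translation operator $\partial$, parity $p(a)$, fields $a(z)=\sum_{n\in\mathbb Z}a_{(n)}z^{-n-1}$, $\lambda$-bracket $[a_\lambda b]=\sum_{n\ge0}\frac{\lambda^n}{n!}a_{(n)}b$, normally ordered product $:\!ab\!:\,=a_{(-1)}b$ (several factors nested from the right), $\partial^{(k)}=\partial^k/k!$. A Hamiltonian operator $H$ on $V$ is a semisimple operator with $[H,a(z)]=z\partial_za(z)+(Ha)(z)$; $\Delta_a$ is the $H$-eigenvalue of $a$; $\theta_H=e^{2\pi iH}$. **Twisted Zhu algebra.** $V=\bigoplus V(\bar\gamma,\Delta)$ over $\bar\gamma\in\mathbb R/\mathbb Z$, $\Delta\in\mathbb R$, with $V(\bar\gamma,\Delta)=\{a: g(a)=e^{2\pi i\gamma}a,\ Ha=\Delta a\}$. For homogeneous $a\in V(\bar\gamma,\Delta)$ let $\epsilon_a$ be the unique real number with $-1<\epsilon_a\le0$ and $\epsilon_a+\Delta_a\in\bar\gamma$, and $\gamma_a=\epsilon_a+\Delta_a$. For homogeneous $a,b$ put $\chi_{a,b}=1$ if $\epsilon_a+\epsilon_b\le-1$ and $0$ otherwise. Define (bilinearly) $a*_nb=\sum_{j\ge0}\binom{\gamma_a}{j}a_{(n+j)}b$ and $a*b=a*_{-1}b$. Put $V_{g,H}=\operatorname{Span}\{a:\epsilon_a=0\}=\{a: (g\circ\theta_H^{-1})(a)=a\}$ and $J_{g,H}=\operatorname{Span}\{a*_{-2+\chi_{a,b}}b: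 a,b\text{ homogeneous},\ \epsilon_a+\epsilon_b\in\mathbb Z\}$. Then $\operatorname{Zhu}_{g,H}V=V_{g,H}/J_{g,H}$ is a unital associative superalgebra with product induced by $*$. **Free generation and pregrading.** $\Gamma$ is a discrete additive subgroup of $\mathbb R$, $\Gamma_{\ge0}=\Gamma\cap\mathbb R_{\ge0}$, $\Gamma_{>0}=\Gamma\cap\mathbb R_{>0}$; for $\zeta\in\Gamma_{>0}$, $\zeta_-$ is the largest element of $\Gamma_{\ge0}$ strictly smaller than $\zeta$. For a totally ordered set $I$ put $\mathbb I=\mathbb Z_{\ge0}\times I$, ordered by $(k,\alpha)<(l,\beta)$ iff $\alpha<\beta$, or $\alpha=\beta$ and $k<l$; $e_i=\partial^{(k)}e_\alpha$ for $i=(k,\alpha)$. $V$ is freely generated by $\{e_\alpha\}_{\alpha\in I}$ if the $:\!e_{i_1}\cdots e_{i_s}\!:$ with $s\ge0$, $i_j\le i_{j+1}$, and $i_j<i_{j+1}$ if $p(e_{i_j})=\bar1$, form a basis of $V$. Given a $\Gamma_{>0}$-grading $\alpha\mapsto\zeta_\alpha$, put $\mathfrak v_\zeta=\operatorname{Span}\{e_\alpha:\zeta_\alpha=\zeta\}$ and $V_\zeta=\sum_{\zeta_1+\cdots+\zeta_s\le\zeta}:\!(\partial^{k_1}\mathfrak v_{\zeta_1})\cdots(\partial^{k_s}\mathfrak v_{\zeta_s})\!:$ (sum over $s\ge0$, $k_j\ge0$; $s=0$ contributes $\mathbb C|0\rangle$). $V$ is pregraded by $\Gamma_{\ge0}$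 if $[\mathfrak v_{\zeta_1\,\lambda}\mathfrak v_{\zeta_2}]\subset\mathbb C[\lambda]\otimes V_{(\zeta_1+\zeta_2)_-}$ for all $\zeta_1,\zeta_2\in\Gamma_{>0}$. **Non-linear Lie superalgebras.** For a $\Gamma_{>0}$-graded superspace $\mathfrak a=\bigoplus\mathfrak a_\zeta$, filter the tensor superalgebra by $T(\mathfrak a)_\zeta=\sum_{\zeta_1+\cdots+\zeta_s\le\zeta}\mathfrak a_{\zeta_1}\otimes\cdots\otimes\mathfrak a_{\zeta_s}$. $\mathfrak a$ is a non-linear Lie superalgebra if it has a parity-preserving linear map $[\,,]\colon\mathfrak a\otimes\mathfrak a\to T(\mathfrak a)$ (extended to $T(\mathfrak a)$ by the Leibniz rule) with (1) $[\mathfrak a_{\zeta_1},\mathfrak a_{\zeta_2}]\subset T(\mathfrak a)_{(\zeta_1+\zeta_2)_-}$; (2) $[a,b]=-(-1)^{p(a)p(b)}[b,a]$; (3) $[a,[b,c]]-[[a,b],c]-(-1)^{p(a)p(b)}[b,[a,c]]\in M(\mathfrak a)_{(\zeta_1+\zeta_2+\zeta_3)_-}$ for $a\in\mathfrak a_{\zeta_1},b\in\mathfrak a_{\zeta_2},c\in\mathfrak a_{\zeta_3}$, where $M(\mathfrak a)_\zeta$ is the span of all $A\otimes(a\otimes b-(-1)^{p(a)p(b)}b\otimes a-[a,b])\otimes B$ with $a\in\mathfrak a_{\zeta_1},b\in\mathfrak a_{\zeta_2},A\in T(\mathfrak a)_{\zeta_3},B\in T(\mathfrak a)_{\zeta_4}$,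 $\sum\zeta_i\le\zeta$. Put $M(\mathfrak a)=\sum_\zeta M(\mathfrak a)_\zeta$ (a two-sided ideal) and $U(\mathfrak a)=T(\mathfrak a)/M(\mathfrak a)$. The space $\operatorname{Zhu}_{g,H}R=\tau(\mathfrak v_{g,H})$ carries the $\Gamma_{>0}$-grading induced from $\mathfrak v_{g,H}$. In the defining relations $[\tau(a),\tau(b)]=\tau(a)\tau(b)-(-1)^{p(a)p(b)}\tau(b)\tau(a)$, and the right-hand side is understood as written as a linear combination of ordered monomials in the $\tau(e_\alpha)$, $e_\alpha\in\mathfrak v_{g,H}$. *)

(* Defs.v *)
From HB Require Import structures.
From mathcomp Require Import all_boot all_order all_algebra.
From mathcomp Require Import complex ring.
From mathcomp Require Import all_classical all_reals all_analysis.
From mathcomp Require finmap.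
From mathcomp.multinomials Require monalg.
(* The notations of [monalg] clash with those of MathComp-Analysis. *)
Import -(notations) monalg.

Set Implicit Arguments.
Unset Strict Implicit.
Unset Printing Implicit Defensive.

Import Order.TTheory GRing.Theory Num.Theory.
Import numFieldNormedType.Exports.

Local Open Scope classical_set_scope.
Local Open Scope ring_scope.
Local Open Scope quotient_scope.

Section LinearAlgebra.
Context {K : fieldType} {W : lmodType K}.
Implicit Types (A : set W) (f : W -> W).

Definition lspan A : {pred W} := fun v => `[< exists s : seq (K * W),
  (forall x, x \in s -> A x.2) /\ v = \sum_(x <- s) x.1 *: x.2 >].

Lemma lspanP A v : reflect (exists s : seq (K * W),
  (forall x, x \in s -> A x.2) /\ v = \sum_(x <- s) x.1 *: x.2) (v \in lspan A).
Proof. exact: asboolP. Qed.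

Lemma mem_lspan A v : A v -> v \in lspan A.
Proof.
move=> Av; apply/lspanP; exists [:: (1, v)]; split.
  by move=> x; rewrite inE => /eqP ->.
by rewrite big_seq1 scale1r.
Qed.

Lemma lspan_submod A : submod_closed (lspan A).
Proof.
split; first by apply/lspanP; exists [::]; split=> //; rewrite big_nil.
move=> c u v /lspanP[s [As ->]] /lspanP[t [At ->]]; apply/lspanP.
exists ([seq (c * x.1, x.2) | x <- s] ++ t); split.
  by move=> x; rewrite mem_cat => /orP[/mapP[y /As Ay ->]|/At].
rewrite big_cat big_map /= scaler_sumr; congr (_ + _).
by apply: eq_bigr => x _; rewrite scalerA.
Qed.

HB.instance Definition _ A :=
  GRing.isSubmodClosed.Build K W (lspan A) (lspan_submod A).

Lemma lspan_sub A (S : submodClosed W) :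
  (forall v, A v -> v \in S) -> forall v, v \in lspan A -> v \in S.
Proof.
move=> AS v /lspanP[s [As ->]]; rewrite big_seq; apply: rpred_sum => x xs.
by apply: rpredZ; apply/AS/As.
Qed.

Definition is_subspace A := A 0 /\ forall c u v, A u -> A v -> A (c *: u + v).

Definition is_direct_sum {T : choiceType} (P : set T) (F : T -> set W) :=
  [/\ forall k, P k -> is_subspace (F k),
      forall v, v \in lspan (\bigcup_(k in P) F k)
    & forall (s : seq T) (f : T -> W), uniq s ->
        (forall k, k \in s -> P k /\ F k (f k)) ->
        \sum_(k <- s) f k = 0 -> forall k, k \in s -> f k = 0].

Definition is_basis {T : choiceType} (P : set T) (f : T -> W) :=
  (forall v, v \in lspan (f @` P)) /\
  (forall (s : seq T) (c : T -> K), uniq s -> (forall k, k \in s -> P k) ->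
     \sum_(k <- s) c k *: f k = 0 -> forall k, k \in s -> c k = 0).

Definition is_diagonalizable f := forall v, v \in lspan [set u | exists c, f u = c *: u].

Definition bilinear_map {W1 W2 : lmodType K} (m : W1 -> W2 -> W) :=
  (forall y, linear (m ^~ y)) /\ (forall x, linear (m x)).

End LinearAlgebra.

Section SubSpace.
Context {K : fieldType} {W : lmodType K} (A : set W).
Definition lsub : Type := {x : W | x \in lspan A}.
HB.instance Definition _ := SubChoice.on lsub.
HB.instance Definition _ := [SubChoice_isSubLmodule of lsub by <:].
End SubSpace.

Section QuotientSpace.
Context {K : fieldType} {W : lmodType K} (A : set W).

Definition lquot : Type := {ideal_quot (lspan A)}.
HB.instance Definition _ := GRing.Zmodule.on lquot.
HB.instance Definition _ := EqQuotient.on lquot.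

Definition lproj (x : W) : lquot := \pi_lquot x.

Lemma lproj_eq x y : (lproj x = lproj y) <-> (x - y \in lspan A).
Proof.
rewrite [x - y \in _]Quotient.idealrBE /lproj.
by split=> [xy|/eqP //]; apply/eqP.
Qed.

Lemma lprojD x y : lproj (x + y) = lproj x + lproj y.
Proof. by rewrite /lproj !piE. Qed.

Lemma lprojK (x : lquot) : lproj (repr x) = x. Proof. exact: reprK. Qed.

Definition lquot_scale (c : K) (x : lquot) : lquot := lproj (c *: repr x).

Lemma lprojZ c x : lproj (c *: x) = lquot_scale c (lproj x).
Proof.
by apply/lproj_eq; rewrite -scalerBr rpredZ //; apply/lproj_eq; rewrite lprojK.
Qed.

Fact lquot_scaleA a b v : lquot_scale a (lquot_scale b v) = lquot_scale (a * b) v.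
Proof. by rewrite -[v]lprojK -!lprojZ scalerA. Qed.
Fact lquot_scale1 : left_id 1 lquot_scale.
Proof. by move=> v; rewrite -[v]lprojK -!lprojZ scale1r. Qed.
Fact lquot_scaleDr : right_distributive lquot_scale +%R.
Proof.
by move=> a u v; rewrite -[u]lprojK -[v]lprojK -lprojD -!lprojZ -lprojD scalerDr.
Qed.
Fact lquot_scaleDl v : {morph lquot_scale^~ v : a b / a + b}.
Proof. by move=> a b; rewrite -[v]lprojK -!lprojZ -lprojD scalerDl. Qed.

HB.instance Definition _ := GRing.Zmodule_isLmodule.Build K lquot
  lquot_scaleA lquot_scale1 lquot_scaleDr lquot_scaleDl.

Fact lproj_linear : linear lproj.
Proof. by move=> c u v; rewrite lprojD lprojZ. Qed.
HB.instance Definition _ := GRing.isLinear.Build K W lquot _ lproj lproj_linear.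

End QuotientSpace.

(* The quotient of the algebra A by the two-sided ideal generated by S.  It may
   be zero, hence it is only declared as a [pzRingType] and an [lmodType]. *)
Section QuotientAlgebra.
Context {K : fieldType} {A : algType K} (S : set A).

Definition ideal_gen : set A := [set x | exists u r v, S r /\ x = u * r * v].

Definition aquot : Type := lquot ideal_gen.
HB.instance Definition _ := GRing.Lmodule.on aquot.

Definition aproj : A -> aquot := @lproj K A ideal_gen.
HB.instance Definition _ := GRing.Linear.on aproj.

Lemma aproj_eq x y : (aproj x = aproj y) <-> (x - y \in lspan ideal_gen).
Proof. exact: lproj_eq. Qed.
Lemma aprojK (x : aquot) : aproj (repr (x : lquot ideal_gen)) = x.
Proof. exact: lprojK. Qed.

Lemma ideal_genMl a x : x \in lspan ideal_gen -> a * x \in lspan ideal_gen.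
Proof.
move=> /lspanP[s [Ss ->]]; rewrite mulr_sumr big_seq; apply: rpred_sum => y ys.
rewrite -scalerAr rpredZ //; apply: mem_lspan.
have [u [r [v [Sr ->]]]] := Ss _ ys.
by exists (a * u), r, v; rewrite !mulrA.
Qed.
Lemma ideal_genMr a x : x \in lspan ideal_gen -> x * a \in lspan ideal_gen.
Proof.
move=> /lspanP[s [Ss ->]]; rewrite mulr_suml big_seq; apply: rpred_sum => y ys.
rewrite -scalerAl rpredZ //; apply: mem_lspan.
have [u [r [v [Sr ->]]]] := Ss _ ys.
by exists u, r, (v * a); rewrite !mulrA.
Qed.

Definition aquot_mul (x y : aquot) : aquot :=
  aproj (repr (x : lquot ideal_gen) * repr (y : lquot ideal_gen)).

Lemma aprojM x y : aproj (x * y) = aquot_mul (aproj x) (aproj y).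
Proof.
apply/aproj_eq; set x' := repr _; set y' := repr _.
have -> : x * y - x' * y' = (x - x') * y + x' * (y - y').
  by rewrite mulrBl mulrBr addrA subrK.
apply: rpredD; [apply: ideal_genMr|apply: ideal_genMl];
  by apply/aproj_eq; rewrite aprojK.
Qed.

Fact aquot_mulA : associative aquot_mul.
Proof.
by move=> x y z; rewrite -[x]aprojK -[y]aprojK -[z]aprojK -!aprojM mulrA.
Qed.
Fact aquot_mul1 : left_id (aproj 1) aquot_mul.
Proof. by move=> x; rewrite -[x]aprojK -!aprojM mul1r. Qed.
Fact aquot_mulr1 : right_id (aproj 1) aquot_mul.
Proof. by move=> x; rewrite -[x]aprojK -!aprojM mulr1. Qed.
Fact aquot_mulDl : left_distributive aquot_mul +%R.
Proof.
move=> x y z; rewrite -[x]aprojK -[y]aprojK -[z]aprojK.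
by rewrite -raddfD -!aprojM mulrDl raddfD.
Qed.
Fact aquot_mulDr : right_distributive aquot_mul +%R.
Proof.
move=> x y z; rewrite -[x]aprojK -[y]aprojK -[z]aprojK.
by rewrite -raddfD -!aprojM mulrDr raddfD.
Qed.

HB.instance Definition _ := GRing.Zmodule_isPzRing.Build aquot
  aquot_mulA aquot_mul1 aquot_mulr1 aquot_mulDl aquot_mulDr.

Fact aproj_monoid : monoid_morphism aproj.
Proof. by split=> // x y; rewrite aprojM. Qed.
HB.instance Definition _ := GRing.isMonoidMorphism.Build A aquot aproj aproj_monoid.

Lemma aquot_scalerAl c (x y : aquot) : c *: (x * y) = (c *: x) * y.
Proof. by rewrite -[x]aprojK -[y]aprojK -rmorphM -!linearZ -rmorphM scalerAl. Qed.
Lemma aquot_scalerAr c (x y : aquot) : c *: (x * y) = x * (c *: y).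
Proof. by rewrite -[x]aprojK -[y]aprojK -rmorphM -!linearZ -rmorphM scalerAr. Qed.

End QuotientAlgebra.

Section TensorAlgebra.
Context {K : fieldType} (W : lmodType K).

(* The free associative algebra on the underlying set of W. *)
Definition freealg : Type := malg (fmonom W) K.
HB.instance Definition _ := GRing.Lalgebra.on freealg.

Fact freealg_scalerAr (c : K) (x y : malg (fmonom W) K) :
  c *: (x * y) = x * (c *: y).
Proof.
apply/malgP => k; rewrite mcoeffZ mcoeffMl.
rewrite (mcoeffMlw k (finmap.fsubset_refl (msupp x)) (msuppZ_le c y)).
rewrite mulr_sumr; apply: eq_bigr => k1 _.
rewrite mulr_sumr; apply: eq_bigr => k2 _.
by rewrite mcoeffZ mulrnAr mulrCA.
Qed.
HB.instance Definition _ :=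
  GRing.Lalgebra_isAlgebra.Build K freealg freealg_scalerAr.

Definition fvar (w : W) : freealg := mkmalgU (fmu w) 1.

Definition multilinear_rel : set freealg :=
  [set x | exists c u v, x = fvar (c *: u + v) - c *: fvar u - fvar v].

Definition tens : Type := aquot multilinear_rel.
HB.instance Definition _ := GRing.Lmodule.on tens.
HB.instance Definition _ := GRing.PzRing.on tens.

Definition augment : freealg -> K := mcoeff (mone : fmonom W).
HB.instance Definition _ := GRing.Linear.on augment.
HB.instance Definition _ := GRing.RMorphism.on augment.

Fact augmentZ c x : augment (c *: x) = c * augment x.
Proof. exact: mcoeffZ. Qed.
Fact augmentM x y : augment (x * y) = augment x * augment y.
Proof. exact: (rmorphM augment). Qed.
Fact augmentB x y : augment (x - y) = augment x - augment y.
Proof. exact: (raddfB augment). Qed.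
Fact fvar0 w : augment (fvar w) = 0.
Proof.
rewrite /augment /fvar mcoeffU.
by case: eqP => // /(congr1 (fun m : fmonom W => size m)); rewrite fmuE fm1.
Qed.

Fact tens_neq0 : (1 : tens) != 0.
Proof.
apply/eqP => h.
have : aproj multilinear_rel 1 = aproj multilinear_rel 0 by rewrite rmorph1 raddf0.
move/aproj_eq; rewrite subr0 => /lspanP[s [Ss /(congr1 augment)]].
rewrite rmorph1 raddf_sum big_seq big1 => [/eqP|y ys]; first by rewrite oner_eq0.
have [u [r [v [[c [a [b ->]]] ->]]]] := Ss _ ys.
apply: etrans (augmentZ _ _) _.
by rewrite !augmentM !augmentB augmentZ !fvar0 !(mulr0, subr0, mul0r, oppr0, addr0).
Qed.
HB.instance Definition _ := GRing.PzSemiRing_isNonZero.Build tens tens_neq0.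
HB.instance Definition _ := GRing.Lmodule_isLalgebra.Build K tens
  (@aquot_scalerAl _ _ multilinear_rel).
HB.instance Definition _ := GRing.Lalgebra_isAlgebra.Build K tens
  (@aquot_scalerAr _ _ multilinear_rel).

Definition tin (w : W) : tens := aproj multilinear_rel (fvar w).

Fact tin_linear : linear tin.
Proof.
move=> c u v; rewrite /tin -linearZ -raddfD; apply/aproj_eq/mem_lspan.
exists 1, (fvar (c *: u + v) - c *: fvar u - fvar v), 1; split.
  by exists c, u, v.
by rewrite mul1r mulr1 opprD addrA.
Qed.
HB.instance Definition _ := GRing.isLinear.Build K W tens _ tin tin_linear.

End TensorAlgebra.

Section Scalars.
Context {R : realType}.

Definition expi (t : R) : R[i] := (cos (pi *+ 2 * t) +i* sin (pi *+ 2 * t))%C.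

Definition gbinom (x : R) (j : nat) : R[i] :=
  ((\prod_(i < j) (x - i%:R) / j`!%:R)%:C)%C.

Lemma expiD s t : expi (s + t) = expi s * expi t.
Proof.
by rewrite /expi mulrDr cosD sinD; apply/eqP; rewrite eq_complex /= eqxx addrC eqxx.
Qed.

Lemma expi0 : expi 0 = 1.
Proof. by rewrite /expi mulr0 cos0 sin0. Qed.

Lemma expi_int (n : int) : expi n%:~R = 1.
Proof.
have expi1 : expi 1 = 1.
  by rewrite /expi mulr1 cos2pi -[pi *+ 2]add0r sinD2pi sin0.
have expin (m : nat) : expi m%:R = 1.
  by elim: m => [|m IH]; rewrite ?expi0// -natr1 expiD IH expi1 mulr1.
case: n => n; first by rewrite -[RHS](expin n).
by rewrite NegzE mulrNz -[LHS]mulr1 -[in LHS](expin n.+1) -expiD addNr expi0.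
Qed.

End Scalars.

Record vertexSuperalgebra (R : realType) (V : lmodType R[i]) := VertexSuperalgebra {
  vpar : bool -> set V; (* true is odd *)
  vac : V;
  der : V -> V;
  nprod : int -> V -> V -> V;
  vpar_direct : is_direct_sum [set: bool] vpar;
  der_linear : linear der;
  nprod_bilinear : forall n, bilinear_map (nprod n);
  vpar_vac : vpar false vac;
  vpar_der : forall p a, vpar p a -> vpar p (der a);
  vpar_nprod : forall n p q a b,
    vpar p a -> vpar q b -> vpar (p (+) q) (nprod n a b);
  nprod_field : forall a b, exists N : int, forall n, N <= n -> nprod n a b = 0;
  der_vac : der vac = 0;
  vac_nprod : forall n a, nprod n vac a = if n == -1 then a else 0;
  nprod_vac : forall a, nprod (-1) a vac = a;
  nprod_vac0 : forall (n : nat) a, nprod n a vac = 0;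
  (* [der, a(z)] = d/dz a(z) *)
  translation : forall n a b,
    der (nprod n a b) - nprod n a (der b) = - (n%:~R *: nprod (n - 1) a b);
  (* (z - w)^N [a(z), b(w)] = 0 *)
  locality : forall p q a b, vpar p a -> vpar q b -> exists N : nat,
    forall (m n : int) c,
    \sum_(j < N.+1) ((-1) ^+ j * 'C(N, j)%:R) *:
      (nprod (m + (N - j)%N) a (nprod (n + j) b c)
       - (-1) ^+ (p && q) *: nprod (n + j) b (nprod (m + (N - j)%N) a c)) = 0
}.

Section VertexNotions.
Context {R : realType} {V : lmodType R[i]} (VA : vertexSuperalgebra V).
Local Notation "a _( n ) b" := (nprod VA n a b) (at level 35, n at level 200, b at level 35).

(* The last clause is [H, a(z)] = z d/dz a(z) + (H a)(z). *)
Definition is_hamiltonian (H : V -> V) :=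
  [/\ linear H, is_diagonalizable H & forall n a b,
    H (a _(n) b) - a _(n) (H b) = (- n - 1)%:~R *: (a _(n) b) + (H a) _(n) b].

Definition is_automorphism (g : V -> V) :=
  [/\ linear g, bijective g, g (vac VA) = vac VA,
      forall p a, vpar VA p a -> vpar VA p (g a)
    & forall n a b, g (a _(n) b) = (g a) _(n) (g b)].

Definition normal_product (s : seq V) : V := foldr (nprod VA (-1)) (vac VA) s.

Definition dpder (k : nat) (a : V) : V := (k`!%:R)^-1 *: iter k (der VA) a.

Section FreeGeneration.
Context {d : Order.disp_t} {I : orderType d} (p : I -> bool) (e : I -> V).

Definition index_lt (i j : nat * I) :=
  (i.2 < j.2)%O || (i.2 == j.2) && (i.1 < j.1)%N.

Definition admissible : set (seq (nat * I)) :=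
  [set s | sorted (fun i j => index_lt i j || (i == j) && ~~ p i.2) s].

(* p is the parity of the e_alpha *)
Definition freely_generated :=
  is_basis admissible
    (fun s => normal_product [seq dpder i.1 (e i.2) | i <- s]).

End FreeGeneration.

End VertexNotions.

Section Gamma.
Context {R : realType} (G : set R).

Definition is_discrete_subgroup :=
  [/\ G 0, forall x y, G x -> G y -> G (x - y)
    & forall x, G x -> \forall y \near x, G y -> y = x].

Definition Gpos : set R := [set z | G z /\ 0 < z].
Definition Gge0 : set R := [set z | G z /\ 0 <= z].

Definition Gprev (z : R) : R := xget 0 [set y | [/\ Gge0 y, y < z
  & forall x, Gge0 x -> x < z -> x <= y]].

End Gamma.

Section Pregrading.
Context {R : realType} {V : lmodType R[i]} (VA : vertexSuperalgebra V).
Context (G : set R) {I : Type} (e : I -> V) (zeta : I -> R).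

Definition gen_deg (z : R) : {pred V} := lspan [set e i | i in [set i | zeta i = z]].

Definition vfil (z : R) : {pred V} := lspan [set x |
  exists s : seq (nat * V * R),
    [/\ forall t, t \in s -> Gpos G t.2 /\ t.1.2 \in gen_deg t.2,
        \sum_(t <- s) t.2 <= z
      & x = normal_product VA [seq iter t.1.1 (der VA) t.1.2 | t <- s]]].

Definition pregraded := forall z1 z2 a b, Gpos G z1 -> Gpos G z2 ->
  a \in gen_deg z1 -> b \in gen_deg z2 ->
  forall n : nat, nprod VA n a b \in vfil (Gprev G (z1 + z2)).

End Pregrading.

Record is_superalgebra (K : fieldType) (A : lmodType K) (par : bool -> set A)
    (one : A) (mul : A -> A -> A) : Prop := IsSuperalgebra {
  superalg_direct : is_direct_sum [set: bool] par;
  superalg_bilinear : bilinear_map mul;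
  superalgA : associative mul;
  superalg1l : left_id one mul;
  superalg1r : right_id one mul;
  superalg_par1 : par false one;
  superalg_parM : forall p q x y, par p x -> par q y -> par (p (+) q) (mul x y)
}.

Definition superalgebra_iso (K : fieldType) (A B : lmodType K)
    (parA : bool -> set A) (oneA : A) (mulA : A -> A -> A)
    (parB : bool -> set B) (oneB : B) (mulB : B -> B -> B) (f : A -> B) :=
  [/\ linear f, bijective f, f oneA = oneB, {morph f : x y / mulA x y >-> mulB x y}
    & forall p x, parA p x -> parB p (f x)].

Section NonLinearLie.
Context {R : realType} (G : set R) {W : lmodType R[i]}.
Context (par : bool -> set W) (gr : R -> set W).

Definition graded_superspace :=
  [/\ is_direct_sum [set: bool] par, is_direct_sum (Gpos G) gr
    & forall z w, Gpos G z -> gr z w ->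
        w \in lspan (\bigcup_(p in [set: bool]) (gr z `&` par p))].

Definition tpar (p : bool) : set (tens W) := [set x | x \in lspan
  [set x | exists s : seq (bool * W),
    [/\ forall t, t \in s -> par t.1 t.2,
        \big[addb/false]_(t <- s) t.1 = p & x = \prod_(t <- s) tin t.2]]].

Definition tfil (z : R) : {pred tens W} := lspan [set x |
  exists s : seq (R * W),
    [/\ forall t, t \in s -> Gpos G t.1 /\ gr t.1 t.2,
        \sum_(t <- s) t.1 <= z & x = \prod_(t <- s) tin t.2]].

(* Only brackets with one argument in W are extended: on T(W) * T(W) the left
   and the right Leibniz rules are not compatible. *)
Definition leibniz_extension (br : W -> W -> tens W)
    (brl : W -> tens W -> tens W) (brr : tens W -> W -> tens W) :=
  [/\ bilinear_map brl, bilinear_map brr,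
      (forall a b, brl a (tin b) = br a b) /\ (forall a b, brr (tin a) b = br a b),
      (forall a, brl a 1 = 0) /\ (forall a p q B C, par p a -> tpar q B ->
        brl a (B * C) = brl a B * C + (-1) ^+ (p && q) *: (B * brl a C))
    & (forall c, brr 1 c = 0) /\ (forall A q r B c, tpar q B -> par r c ->
        brr (A * B) c = A * brr B c + (-1) ^+ (q && r) *: (brr A c * B))].

Section Bracket.
Context (br : W -> W -> tens W).

Definition mrel_fil (z : R) : {pred tens W} := lspan [set x |
  exists z1 z2 z3 z4 p q a b A B,
    [/\ [/\ Gpos G z1, Gpos G z2, Gge0 G z3 & Gge0 G z4],
        z1 + z2 + z3 + z4 <= z,
        [/\ gr z1 a, par p a, gr z2 b & par q b],
        A \in tfil z3 /\ B \in tfil z4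
      & x = A * (tin a * tin b - (-1) ^+ (p && q) *: (tin b * tin a) - br a b) * B]].

Record is_nonlinear_lie : Prop := IsNonlinearLie {
  nll_graded : graded_superspace;
  nll_bilinear : bilinear_map br;
  nll_par : forall p q a b, par p a -> par q b -> tpar (p (+) q) (br a b);
  nll_fil : forall z1 z2 a b, Gpos G z1 -> Gpos G z2 -> gr z1 a -> gr z2 b ->
    br a b \in tfil (Gprev G (z1 + z2));
  nll_skew : forall p q a b, par p a -> par q b ->
    br a b = - ((-1) ^+ (p && q) *: br b a);
  nll_jacobi : exists brl brr, leibniz_extension br brl brr /\
    forall z1 z2 z3 p q r a b c,
      Gpos G z1 -> Gpos G z2 -> Gpos G z3 -> gr z1 a -> gr z2 b -> gr z3 c ->
      par p a -> par q b -> par r c ->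
      brl a (br b c) - brr (br a b) c - (-1) ^+ (p && q) *: brl b (br a c)
        \in mrel_fil (Gprev G (z1 + z2 + z3))
}.

(* When br is a non-linear Lie superalgebra structure, the union of the
   M(W)_z is the two-sided ideal M(W). *)
Definition mrel : set (tens W) := [set x | exists2 z, Gge0 G z & x \in mrel_fil z].

Definition uenv : Type := aquot mrel.
HB.instance Definition _ := GRing.Lmodule.on uenv.
HB.instance Definition _ := GRing.PzRing.on uenv.

Definition uproj : tens W -> uenv := aproj mrel.
Definition uin (w : W) : uenv := uproj (tin w).
Definition upar (p : bool) : set uenv := uproj @` tpar p.

End Bracket.
End NonLinearLie.
Arguments uproj {R G W par gr br}.
Arguments uin {R G W par gr br}.
Arguments upar {R G W par gr} br.

Section Zhu.
Context {R : realType} {V : lmodType R[i]} (VA : vertexSuperalgebra V).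
Context (H g : V -> V).

(* V(c + Z, D); the class of c modulo Z is represented by c. *)
Definition bihom (c D : R) : set V :=
  [set a | g a = expi c *: a /\ H a = (D%:C)%C *: a].

(* c = gamma_a and D = Delta_a, that is, c - D = epsilon_a is in ]-1, 0]. *)
Definition hom_norm (c D : R) : set V := [set a | bihom c D a /\ -1 < c - D <= 0].

(* a *_n b, where c = gamma_a; the sum is finite. *)
Definition starn (n : int) (c : R) (a b : V) : V :=
  \sum_(j \in [set: nat]) gbinom c j *: nprod VA (n + j%:Z) a b.

(* Homogeneous elements with epsilon_a = 0, that is, fixed by
   g \o theta_H^-1: here theta_H a = expi D *: a. *)
Definition untwisted : set V := [set a | exists D, bihom D D a].

Definition VgH : {pred V} := lspan untwisted.

Definition JgH : {pred V} := lspan [set x | exists ca Da cb Db a b,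
  [/\ hom_norm ca Da a, hom_norm cb Db b,
      exists m : int, (ca - Da) + (cb - Db) = m%:~R
    & x = starn (if (ca - Da) + (cb - Db) <= -1 then -1 else -2) ca a b]].

Definition zhu : Type := lquot [set x : lsub untwisted | val x \in JgH].
HB.instance Definition _ := GRing.Lmodule.on zhu.

(* The canonical projection of V_{g,H}; it is set to 0 outside V_{g,H}. *)
Definition tau (a : V) : zhu := lproj _ (insubd (0 : lsub untwisted) a).

Definition zhu_par (p : bool) : set zhu := tau @` [set a | a \in VgH /\ vpar VA p a].

(* The product induced by *: it is enough to prescribe it for a homogeneous,
   and then gamma_a = Delta_a since a is in V_{g,H}. *)
Definition is_zhu_product (mul : zhu -> zhu -> zhu) :=
  bilinear_map mul /\
  forall D a b, bihom D D a -> b \in VgH ->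
    mul (tau a) (tau b) = tau (starn (-1) D a b).

Section Generators.
Context (G : set R) {I : Type} (e : I -> V) (zeta : I -> R).

Definition vgH_deg (z : R) : {pred V} :=
  lspan [set e i | i in [set i | untwisted (e i) /\ zeta i = z]].
Definition vgH : {pred V} := lspan [set e i | i in [set i | untwisted (e i)]].
Definition RgH : {pred V} :=
  lspan [set x | exists k, exists2 a, a \in vgH & x = iter k (der VA) a].

Definition zhuR : Type := lsub (tau @` [set a | a \in RgH]).
HB.instance Definition _ := SubChoice.on zhuR.
HB.instance Definition _ := GRing.Lmodule.on zhuR.

Definition zhuR_par (p : bool) : set zhuR := [set x | zhu_par p (val x)].
Definition zhuR_gr (z : R) : set zhuR :=
  [set x | exists2 a, a \in vgH_deg z & val x = tau a].

End Generators.

Definition ordered_monomial {d : Order.disp_t} {I : orderType d}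
    (p : I -> bool) (e : I -> V) : set (tens (zhuR e)) :=
  [set x | exists (s : seq I) (w : seq (zhuR e)),
    [/\ forall i, i \in s -> untwisted (e i),
        sorted (fun i j => (i < j)%O || (i == j) && ~~ p i) s,
        [seq val y | y <- w] = [seq tau (e i) | i <- s]
      & x = \prod_(y <- w) tin y]].

End Zhu.
Arguments zhu_par {R V} VA H g.
Arguments tau {R V} VA H g.
Arguments ordered_monomial {R V} VA H g {d I} p e.
Arguments zhuR_par {R V} VA H g {I} e.
Arguments zhuR_gr {R V} VA H g {I} e zeta.

(* V_{g,H} is closed under the products, and contains J_{g,H} and R_{g,H}. *)
Section ZhuFacts.
Context {R : realType} {V : lmodType R[i]} (VA : vertexSuperalgebra V).
Context (H g : V -> V) (hH : is_hamiltonian VA H) (hg : is_automorphism VA g).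

Lemma hom_nprod c D c' D' n a b : bihom H g c D a -> bihom H g c' D' b ->
  bihom H g (c + c') (D + D' - n%:~R - 1) (nprod VA n a b).
Proof.
move=> [ga Ha] [gb Hb]; have [_ _ Hn] := hH; have [_ _ _ _ gn] := hg.
have nZl k x y : nprod VA n (k *: x) y = k *: nprod VA n x y.
  exact: (scalable_linear ((nprod_bilinear VA n).1 y)).
have nZr k x y : nprod VA n x (k *: y) = k *: nprod VA n x y.
  exact: (scalable_linear ((nprod_bilinear VA n).2 x)).
split; first by rewrite gn ga gb nZl nZr scalerA expiD.
move/eqP: (Hn n a b); rewrite subr_eq => /eqP ->.
rewrite Ha Hb nZl nZr -!scalerDl; congr (_ *: _).
rewrite !(rmorphB, rmorphD) /= rmorph_int rmorphN rmorph1 /=; ring.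
Qed.

Lemma hom_untwisted c D (m : int) a : bihom H g c D a -> c - D = m%:~R ->
  untwisted H g a.
Proof.
move=> [ga Ha] cD; exists D; split=> //.
by rewrite ga -[c](subrK D) cD expiD expi_int mul1r.
Qed.

Lemma fsum_lspan (A : set V) (F : nat -> V) : (forall j, F j \in lspan A) ->
  \sum_(j \in [set: nat]) F j \in lspan A.
Proof. by move=> FA; apply: rpred_sum. Qed.

Lemma lspan_linear (A B : set V) (f : V -> V) : linear f ->
  (forall x, A x -> f x \in lspan B) -> forall v, v \in lspan A -> f v \in lspan B.
Proof.
move=> lf fB v /lspanP[s [As ->]].
have f0 : f 0 = 0 by have := lf (-1) 0 0; rewrite scaler0 addr0 scaleN1r addNr.
elim: s As => [|x s IH] As; first by rewrite big_nil f0 rpred0.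
rewrite big_cons lf; apply: rpredD; last first.
  by apply: IH => y ys; apply: As; rewrite inE ys orbT.
by apply/rpredZ/fB/As; rewrite inE eqxx.
Qed.

Lemma VgH_nprod n a b :
  a \in VgH H g -> b \in VgH H g -> nprod VA n a b \in VgH H g.
Proof.
have [hl hr] := nprod_bilinear VA n.
move=> aV; apply: (lspan_linear (hr a)) => {}b [D' hb].
move: a aV; apply: (lspan_linear (hl b)) => a [D ha]; apply: mem_lspan.
apply: (hom_untwisted (m := n + 1) (hom_nprod n ha hb)).
by rewrite rmorphD /= rmorph1; ring.
Qed.

Lemma starn_VgH n c a b :
  a \in VgH H g -> b \in VgH H g -> starn VA n c a b \in VgH H g.
Proof. by move=> aV bV; apply: fsum_lspan => j; rewrite rpredZ// VgH_nprod. Qed.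

Lemma JgH_VgH a : a \in JgH VA H g -> a \in VgH H g.
Proof.
apply: lspan_sub => x [ca [Da [cb [Db [a' [b [[ha _] [hb _] [m hm] ->]]]]]]].
apply: fsum_lspan => j; rewrite rpredZ// mem_lspan//.
set n := (X in nprod _ X).
apply: (hom_untwisted (m := m + n + 1) (hom_nprod n ha hb)).
by rewrite !rmorphD /= rmorph1 -hm; ring.
Qed.

Lemma RgH_VgH {I : Type} (e : I -> V) a : a \in RgH VA H g e -> a \in VgH H g.
Proof.
have vacV : vac VA \in VgH H g.
  apply: mem_lspan; exists 0; have [_ _ Hn] := hH; have [_ _ gv _ _] := hg.
  split; first by rewrite gv expi0 scale1r.
  have := Hn (-1) (vac VA) (vac VA); rewrite !nprod_vac !vac_nprod eqxx.
  by rewrite subrr opprK subrr mulr0z scale0r add0r => <-.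
apply: lspan_sub => _ [k [b bv ->]]; elim: k => [|k IH] /=.
  by move: b bv; apply: lspan_sub => _ [i ei <-]; apply: mem_lspan.
move: (iter k _ _) IH => c cV.
have := translation VA (-1) c (vac VA).
rewrite nprod_vac der_vac; have [_ hr] := nprod_bilinear VA (-1).
have -> : nprod VA (-1) c 0 = 0.
  by have := hr c (-1) 0 0; rewrite scaler0 addr0 scaleN1r addNr.
by rewrite subr0 => ->; rewrite rpredN rpredZ// VgH_nprod.
Qed.

End ZhuFacts.

(* Main.v *)
Require Import Defs.
From HB Require Import structures.
From mathcomp Require Import all_boot all_order all_algebra.
From mathcomp Require Import complex ring lra zify.
From mathcomp Require Import all_classical all_reals all_analysis.
From mathcomp.multinomials Require monalg.
Import -(notations) monalg.
Import Order.TTheory GRing.Theory Num.Theory.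
Local Open Scope classical_set_scope.
Local Open Scope ring_scope.

(** Why the theorem holds.  The product a *_n b is the residue of
    z^n (1+z)^gamma_a a(z)b, so multiplying the Borcherds identity by powers of
    1+z and 1+w gives a Borcherds identity for the products *_n
    ([twisted_borcherds]).  The Borcherds identity itself comes from locality and
    translation covariance, which give it on the vacuum, and from the fact that a
    series of operators which is local with respect to all fields and kills the
    vacuum is zero ([borcherds]).

    As the group of degrees is discrete it lies in eta Z for some eta > 0, so
    degrees may be counted by natural numbers.  The pregrading says that the
    products a_(n)b with n >= 0 of generators drop the degree; by the Borcherds
    identity this extends to all elements, and swapping two neighbours in a
    product of generators changes it by terms of lower degree ([Fil_np_ge0]).

    Write the elements of V as words in the operators x -> e_alpha *_{-k-1} x
    applied to the vacuum.  A letter is bad if k > 0 or if e_alpha is twisted,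
    that is, if it maps everything into the space J spanned by the products
    a *_n b with n small.  Such words triangulate the given basis, so the
    admissible ones form a basis ([eword_free]); by rewriting, J is spanned by
    the admissible words with a bad letter ([Jt_adm]).  As J_{g,H} is the part of
    J in V_{g,H} ([JgH_Jh], [Jh_JgH]), the ordered monomials in tau(e_alpha),
    e_alpha untwisted, form a basis of the Zhu algebra ([zmon_basis]).  The same
    twisted identity, read modulo J, gives associativity and the commutator
    formula ([zhu_superalgebra], [zhu_commutator]).

    What remains concerns any superalgebra Z with a basis of ordered monomials in
    generators x_i, where supercommutators of generators have lower degree.
    Rewriting a supercommutator in the monomial basis gives the bracket.  Its
    Jacobi defect has low degree and lies in the kernel of T(W) -> Z, since the
    supercommutator of Z satisfies the Jacobi identity; and a tensor of degree
    less than n in this kernel is a combination of relations of degree less than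
    n, because rewriting it to ordered monomials uses only such relations and the
    ordered monomials are independent in Z ([Tf_ker]).  The same fact shows that
    U(W) -> Z is injective ([enveloping_nonlinear_lie], [enveloping_iso]). *)

Set Implicit Arguments.
Unset Strict Implicit.
Unset Printing Implicit Defensive.

(** * Sums of finite support and binomial coefficients *)

(** The sums over all naturals of a finitely supported family, as they occur in
    the products a *_n b.  Each such sum is a finite sum as soon as a bound for
    the support is known ([S_trunc]); [evz] asserts that there is one. *)
Notation "\S_ j F" := (\sum_(j \in [set: nat]) F)
  (at level 41, j name, F at level 41, right associativity,
   format "'[' \S_ j '/  ' F ']'") : ring_scope.

Section FiniteSupportSums.
Context {K : fieldType} {W W' : lmodType K}.
Implicit Types F G : nat -> W.

Definition evz {U : lmodType K} (F : nat -> U) :=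
  exists M, forall j, (M <= j)%N -> F j = 0.

Lemma S_trunc M F : (forall j, (M <= j)%N -> F j = 0) ->
  \S_ j F j = \sum_(j < M) F j.
Proof.
move=> FM; rewrite (fsbigE (iota 0 M)) ?iota_uniq//.
  rewrite -(big_mkord xpredT F) /index_iota subn0.
  by apply: eq_bigl => i; rewrite in_setT.
by move=> i _; rewrite mem_iota /= add0n -leqNgt; apply: FM.
Qed.

Lemma S_eq F G : F =1 G -> \S_ j F j = \S_ j G j.
Proof. by move=> FG; apply: eq_fsbigr => j _; apply: FG. Qed.

Lemma S_eq0 F : (forall j, F j = 0) -> \S_ j F j = 0.
Proof. by move=> F0; apply: fsbig1 => j _. Qed.

Lemma S_mem (N : addrClosed W) F : (forall j, F j \in N) -> \S_ j F j \in N.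
Proof. by move=> FN; apply: rpred_sum => j _; apply: FN. Qed.

Lemma evzD F G : evz F -> evz G -> evz (fun j => F j + G j).
Proof.
move=> [M FM] [N GN]; exists (maxn M N) => j.
by rewrite geq_max => /andP[/FM-> /GN->]; rewrite addr0.
Qed.

Lemma evz_comp (f : nat -> W -> W') F :
  (forall j, f j 0 = 0) -> evz F -> evz (fun j => f j (F j)).
Proof. by move=> f0 [M FM]; exists M => j /FM ->. Qed.

Lemma evz_lin (f : W -> W') F : linear f -> evz F -> evz (fun j => f (F j)).
Proof.
move=> lf [M FM]; exists M => j /FM ->.
by have := lf (-1) 0 0; rewrite scaler0 addr0 scaleN1r addNr.
Qed.

Lemma evzZ (c : nat -> K) F : evz F -> evz (fun j => c j *: F j).
Proof. by move=> [M FM]; exists M => j /FM ->; rewrite scaler0. Qed.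

Lemma evzS F : evz F -> evz (fun j => F j.+1).
Proof. by move=> [M FM]; exists M => j Mj; apply: FM; apply: leqW. Qed.

Lemma SD F G : evz F -> evz G -> \S_ j (F j + G j) = \S_ j F j + \S_ j G j.
Proof.
move=> [M FM] [N GN]; rewrite !(@S_trunc (maxn M N)) ?big_split// => j;
  rewrite geq_max => /andP[Mj Nj]; rewrite ?FM ?GN ?addr0 //.
Qed.

Lemma SZ c F : evz F -> \S_ j (c *: F j) = c *: \S_ j F j.
Proof.
move=> [M FM]; rewrite !(@S_trunc M) ?scaler_sumr// => j /FM -> //.
by rewrite scaler0.
Qed.

Lemma S_recl F : evz F -> \S_ j F j = F 0%N + \S_ j F j.+1.
Proof.
move=> [M FM]; rewrite (@S_trunc M.+1); last by move=> j /ltnW; apply: FM.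
by rewrite (@S_trunc M) ?big_ord_recl// => j Mj; apply: FM; apply: leqW.
Qed.

Lemma S_split n F : evz F ->
  \S_ j F j = \sum_(j < n) F j + \S_ j F (n + j)%N.
Proof.
elim: n F => [|n IH] F eF; first by rewrite big_ord0 add0r.
rewrite S_recl// (IH _ (evzS eF)) big_ord_recl addrA.
by congr (_ + _ + _); apply: S_eq => j; rewrite addSn.
Qed.

Lemma S_exch (F : nat -> nat -> W) :
  (exists J, forall j, (J <= j)%N -> forall p, F p j = 0) ->
  (forall j, evz (F^~ j)) ->
  \S_ p \S_ j F p j = \S_ j \S_ p F p j.
Proof.
move=> [J FJ] eF.
rewrite [RHS](@S_trunc J) => [|j /FJ Fj]; last exact: S_eq0.
rewrite (@S_eq _ (fun p => \sum_(j < J) F p j)) => [|p]; last first.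
  by rewrite (@S_trunc J)// => j /FJ.
elim: {FJ} J => [|J IH].
  by rewrite big_ord0; apply: S_eq0 => p; rewrite big_ord0.
rewrite (@S_eq _ (fun p => \sum_(j < J) F p j + F p J)) => [|p]; last first.
  by rewrite big_ord_recr.
rewrite SD//; first by rewrite IH big_ord_recr.
elim: {IH} J => [|J IHJ]; first by exists 0%N => p _; rewrite big_ord0.
have [M eM] := evzD IHJ (eF J).
by exists M => p /eM; rewrite big_ord_recr.
Qed.

Lemma evz_S (F : nat -> nat -> W) :
  (exists J, forall j, (J <= j)%N -> forall p, F p j = 0) ->
  (forall j, evz (F^~ j)) -> evz (fun p => \S_ j F p j).
Proof.
move=> [J FJ] eF.
have [M eM] : evz (fun p => \sum_(j < J) F p j).
  elim: {FJ} J => [|J [M IHJ]]; first by exists 0%N => p _; rewrite big_ord0.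
  have [M' eM] := eF J; exists (maxn M M') => p; rewrite geq_max => /andP[h1 h2].
  by rewrite big_ord_recr /= IHJ// add0r eM.
by exists M => p /eM; rewrite (@S_trunc J)// => j /FJ.
Qed.

End FiniteSupportSums.

Lemma lin0 (K : fieldType) (W W' : lmodType K) (f : W -> W') : linear f -> f 0 = 0.
Proof. by move=> lf; have := lf (-1) 0 0; rewrite scaler0 addr0 scaleN1r addNr. Qed.

Lemma linD (K : fieldType) (W W' : lmodType K) (f : W -> W') : linear f ->
  {morph f : x y / x + y}.
Proof. by move=> lf x y; have := lf 1 x y; rewrite !scale1r. Qed.

Lemma linZ (K : fieldType) (W W' : lmodType K) (f : W -> W') : linear f ->
  forall c, {morph f : x / c *: x}.
Proof. by move=> lf c x; have := lf c x 0; rewrite (lin0 lf) !addr0. Qed.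

Lemma linN (K : fieldType) (W W' : lmodType K) (f : W -> W') : linear f ->
  {morph f : x / - x}.
Proof. by move=> lf x; rewrite -scaleN1r (linZ lf) scaleN1r. Qed.

Lemma linB (K : fieldType) (W W' : lmodType K) (f : W -> W') : linear f ->
  {morph f : x y / x - y}.
Proof. by move=> lf x y; rewrite (linD lf) (linN lf). Qed.

Lemma lin_sum (K : fieldType) (W W' : lmodType K) (f : W -> W') : linear f ->
  forall T (s : seq T) (P : pred T) F,
  f (\sum_(i <- s | P i) F i) = \sum_(i <- s | P i) f (F i).
Proof.
by move=> lf T s P F; apply: (big_morph f); [apply: (linD lf)|apply: (lin0 lf)].
Qed.

Lemma S_lin (K : fieldType) (W W' : lmodType K) (f : W -> W') F :
  linear f -> evz F -> f (\S_ j F j) = \S_ j f (F j).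
Proof.
move=> lf [M FM]; rewrite (S_trunc FM) (@S_trunc _ _ M) ?(lin_sum lf)// => j /FM ->.
exact: lin0.
Qed.

Section Binomials.
Context {R : realType}.
Implicit Types (x y : R) (j p k n : nat).
Local Notation C z := (real_complex R z).

Definition rbinom x j : R := \prod_(i < j) (x - i%:R) / j`!%:R.

Lemma gbinomE x j : gbinom x j = C (rbinom x j). Proof. by []. Qed.

Lemma CD : {morph (real_complex R) : x y / x + y}. Proof. exact: rmorphD. Qed.
Lemma CB : {morph (real_complex R) : x y / x - y}. Proof. exact: rmorphB. Qed.
Lemma CM : {morph (real_complex R) : x y / x * y}. Proof. exact: rmorphM. Qed.
Lemma Cnat n : C n%:R = n%:R. Proof. exact: (rmorph_nat (real_complex R)). Qed.
Lemma Cint (n : int) : C n%:~R = n%:~R.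
Proof. exact: (rmorph_int (real_complex R)). Qed.

Let fact_neq0 j : j`!%:R != 0 :> R.
Proof. by rewrite pnatr_eq0 -lt0n fact_gt0. Qed.

Let S_neq0 j : j.+1%:R != 0 :> R.
Proof. by rewrite pnatr_eq0. Qed.

Lemma gb0 x : gbinom x 0 = 1.
Proof. by rewrite gbinomE /rbinom big_ord0 fact0 divr1 rmorph1. Qed.

Lemma rbS x j : j.+1%:R * rbinom x j.+1 = (x - j%:R) * rbinom x j.
Proof.
rewrite /rbinom big_ord_recr /= factS natrM; field.
by rewrite fact_neq0 addrC natr1 S_neq0.
Qed.

Lemma rb_absorb x j : j.+1%:R * rbinom (x + 1) j.+1 = (x + 1) * rbinom x j.
Proof.
rewrite /rbinom big_ord_recl /= subr0 factS natrM.
under eq_bigr => i _ do rewrite /bump /= add1n -natr1 opprD addrACA subrr addr0.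
field.
by rewrite fact_neq0 addrC natr1 S_neq0.
Qed.

Lemma rb_pascal x j : rbinom (x + 1) j.+1 = rbinom x j.+1 + rbinom x j.
Proof.
apply: (mulfI (S_neq0 j)); rewrite rb_absorb mulrDr rbS -mulrDl -natr1.
by congr (_ * _); ring.
Qed.

Lemma gbS x j : j.+1%:R * gbinom x j.+1 = C (x - j%:R) * gbinom x j.
Proof. by rewrite !gbinomE -CM -rbS [RHS]CM Cnat. Qed.

Lemma gb_absorb x j : j.+1%:R * gbinom (x + 1) j.+1 = C (x + 1) * gbinom x j.
Proof. by rewrite !gbinomE -CM -rb_absorb [RHS]CM Cnat. Qed.

Lemma gb_pascal x j : gbinom (x + 1) j.+1 = gbinom x j.+1 + gbinom x j.
Proof. by rewrite !gbinomE -CD rb_pascal. Qed.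

Lemma rb_vander x y k :
  rbinom (x + y) k = \sum_(i < k.+1) rbinom x i * rbinom y (k - i).
Proof.
elim: k => [|k IH].
  by rewrite big_ord1 subnn /rbinom !big_ord0 fact0; field.
apply: (mulfI (S_neq0 k)); rewrite rbS IH !mulr_sumr.
pose f i := i%:R * rbinom x i * rbinom y (k.+1 - i).
pose g i := (k.+1 - i)%:R * rbinom x i * rbinom y (k.+1 - i).
transitivity (\sum_(i < k.+2) f i + \sum_(i < k.+2) g i); last first.
  rewrite -big_split /=; apply: eq_bigr => i _; rewrite /f /g.
  have h : (i <= k.+1)%N by rewrite -ltnS.
  by rewrite -!mulrDl -natrD subnKC ?mulrA.
rewrite [\sum_(i < k.+2) f i]big_ord_recl [\sum_(i < k.+2) g i]big_ord_recr /=.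
have -> : f 0%N = 0 by rewrite /f !mul0r.
have -> : g k.+1 = 0 by rewrite /g subnn !mul0r.
rewrite add0r addr0 -big_split /=; apply: eq_bigr => i _.
have ik : (i <= k)%N by rewrite -ltnS.
rewrite /f /g /bump /= add1n subSS rbS subSn//.
have := rbS y (k - i); rewrite natrB// => e.
have -> : (k - i).+1%:R * rbinom x i * rbinom y (k - i).+1 =
    rbinom x i * ((y - (k%:R - i%:R)) * rbinom y (k - i)).
  by rewrite -e [RHS]mulrCA mulrA.
ring.
Qed.

(** Vandermonde's identity; it makes a *_n b additive in the exponent gamma_a. *)
Lemma gb_vander x y k :
  gbinom (x + y) k = \sum_(i < k.+1) gbinom x i * gbinom y (k - i).
Proof.
rewrite gbinomE rb_vander rmorph_sum; apply: eq_bigr => i _.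
by rewrite !gbinomE -CM.
Qed.

Lemma gb_nat n j : gbinom (n%:R : R) j = 'C(n, j)%:R.
Proof.
suff e : rbinom n%:R j = 'C(n, j)%:R by rewrite gbinomE e Cnat.
apply: (mulIf (fact_neq0 j)); rewrite /rbinom divfK// -natrM bin_ffact.
elim: j => [|j IH]; rewrite ?big_ord0 ?ffactn0// big_ord_recr /= IH ffactnSr natrM.
have [jn|jn] := leqP j n; first by rewrite natrB.
by rewrite ffact_small ?mul0r.
Qed.

Lemma gb00 j : gbinom (0 : R) j = (j == 0%N)%:R.
Proof. by rewrite (gb_nat 0) bin0n. Qed.

(** Both sides count, for natural x, the ways to choose j and then p further
    elements among x. *)
Lemma gb_trin x j p :
  gbinom x (j + p) * 'C(j + p, j)%:R = gbinom x j * gbinom (x - j%:R) p.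
Proof.
suff e : rbinom x (j + p) * 'C(j + p, j)%:R = rbinom x j * rbinom (x - j%:R) p.
  by rewrite !gbinomE -CM -e [RHS]CM Cnat.
elim: p => [|p IH].
  by rewrite addn0 binn mulr1 {3}/rbinom big_ord0 fact0 divr1 mulr1.
apply: (mulfI (S_neq0 p)); rewrite addnS.
rewrite [RHS]mulrCA rbS mulrCA -natrM.
have -> : (p.+1 * 'C((j + p).+1, j) = (j + p).+1 * 'C(j + p, j))%N.
  by have := mul_bin_down (j + p).+1 j; rewrite /= subSn ?leq_addr// addKn => ->.
transitivity ((j + p).+1%:R * rbinom x (j + p).+1 * 'C(j + p, j)%:R).
  by rewrite natrM mulrCA mulrA.
rewrite rbS -mulrA IH natrD; ring.
Qed.

Lemma gb_addn x p i :
  gbinom (x + p%:R) i = \sum_(j < i.+1) gbinom x (i - j) * 'C(p, j)%:R.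
Proof.
rewrite addrC gb_vander; apply: eq_bigr => j _.
by rewrite gb_nat mulrC.
Qed.

End Binomials.

(** * Eigenvectors, bases and sorting *)

Section LinearTools.
Context {K : fieldType} {W : lmodType K}.
Implicit Types (N : submodClosed W).

Lemma lspan_mono (A B : set W) : A `<=` B -> forall v, v \in lspan A -> v \in lspan B.
Proof. by move=> AB; apply: lspan_sub => v /AB; apply: mem_lspan. Qed.

Lemma lspan_ind (A : set W) (P : W -> Prop) : P 0 ->
  (forall c u v, A u -> P v -> P (c *: u + v)) -> forall v, v \in lspan A -> P v.
Proof.
move=> P0 PS v /lspanP[s [As ->]].
elim: s As => [|x s IH] As; first by rewrite big_nil.
rewrite big_cons; apply: PS; first by apply: As; rewrite inE eqxx.
by apply: IH => y ys; apply: As; rewrite inE ys orbT.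
Qed.

Lemma lspan_lin {W' : lmodType K} (A : set W) (N : submodClosed W') (f : W -> W') :
  linear f -> (forall v, A v -> f v \in N) -> forall v, v \in lspan A -> f v \in N.
Proof.
move=> lf fN; apply: lspan_ind; first by rewrite (lin0 lf) rpred0.
by move=> c u v /fN ? ?; rewrite lf rpredD ?rpredZ.
Qed.

Section Eigen.
Context (T : W -> W) (lT : linear T).

(** Apply the Lagrange polynomial in T with value 1 at l and 0 at the other
    eigenvalues, which keeps the terms of eigenvalue l. *)
Lemma eig_sum0 (s : seq (K * W)) : (forall x, x \in s -> T x.2 = x.1 *: x.2) ->
  \sum_(x <- s) x.2 = 0 -> forall l, \sum_(x <- s | x.1 == l) x.2 = 0.
Proof.
move=> sT s0 l.
pose Q L : W -> W := foldr (fun m f => fun v => (l - m)^-1 *: (T (f v) - m *: f v)) id L.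
have lQ L : linear (Q L).
  elim: L => [|m L IH] c u v //=.
  rewrite IH lT !scalerDr !scalerN !scalerDr !scalerA opprD addrACA.
  by congr (_ - _ + _); congr (_ *: _); ring.
have QE L w m : T w = m *: w -> Q L w = (\prod_(k <- L) ((m - k) / (l - k))) *: w.
  move=> Tw; elim: L => [|k L IH] /=; first by rewrite big_nil scale1r.
  rewrite IH big_cons (linZ lT) Tw !scalerA -scalerBl scalerA; congr (_ *: _).
  by rewrite [k * _]mulrC -mulrBr mulrCA mulrC [(m - k) / _]mulrC.
pose L := [seq x.1 | x <- s & x.1 != l].
have := congr1 (Q L) s0; rewrite (lin0 (lQ L)) (lin_sum (lQ L)) => s0'; rewrite -[RHS]s0'.
rewrite big_mkcond /= [LHS]big_seq [RHS]big_seq; apply: eq_bigr => x xs.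
rewrite (QE _ _ x.1) ?sT//; case: eqP => [->|/eqP xl].
  rewrite big_seq big1 ?scale1r// => k /mapP[y]; rewrite mem_filter => /andP[yl _] ->.
  by rewrite divff// subr_eq0 eq_sym.
have xL : x.1 \in L by apply/mapP; exists x => //; rewrite mem_filter xl.
by rewrite (big_rem _ xL) /= subrr mul0r mul0r scale0r.
Qed.

(** The projection to an eigenspace sends each eigenvector of A to itself or to
    0, so the terms of another eigenvalue can be dropped. *)
Lemma eig_span (A : set W) l v : (forall w, A w -> exists m, T w = m *: w) ->
  v \in lspan A -> T v = l *: v -> v \in lspan [set w | A w /\ T w = l *: w].
Proof.
move=> AT /lspanP[s [As vs]] Tv.
pose mu w := xget 0 [set m | T w = m *: w].
have muP w : A w -> T w = mu w *: w.
  by move=> /AT [m Tm]; apply: (@xgetPex _ 0 [set m | T w = m *: w]); exists m.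
pose t := (l, - v) :: [seq (mu x.2, x.1 *: x.2) | x <- s].
have /eig_sum0 : forall x, x \in t -> T x.2 = x.1 *: x.2.
  move=> x; rewrite inE => /orP[/eqP ->|/mapP[y ys ->]] /=.
    by rewrite (linN lT) Tv scalerN.
  by rewrite (linZ lT) muP ?scalerA; [rewrite mulrC|apply: As].
rewrite big_cons big_map /= -vs addNr => /(_ erefl l).
rewrite big_cons eqxx big_map /= => /eqP; rewrite addrC subr_eq0 => /eqP <-.
rewrite big_seq_cond; apply: rpred_sum => x /andP[xs /eqP xl].
apply: rpredZ; apply: mem_lspan; split; first exact: As.
by rewrite -xl; apply/muP/As.
Qed.

(** The decompositions into eigenvectors cannot be chosen linearly, but the value
    of the sum does not depend on the choice when [phi c] is linear.  This turns
    formulas in which an eigenvalue occurs, such as the product a * b, into total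
    linear maps. *)
Lemma spectral_calculus : is_diagonalizable T ->
  exists dec : W -> seq (K * W), forall (W' : lmodType K) (phi : K -> W -> W'),
    (forall c, linear (phi c)) ->
    linear (fun w => \sum_(x <- dec w) phi x.1 x.2) /\
    forall w c, T w = c *: w -> \sum_(x <- dec w) phi x.1 x.2 = phi c w.
Proof.
move=> dT.
have decP w : exists t : seq (K * W),
    (forall x, x \in t -> T x.2 = x.1 *: x.2) /\ w = \sum_(x <- t) x.2.
  have /lspanP[s [sE ->]] := dT w.
  pose mu w := xget 0 [set m | T w = m *: w].
  exists [seq (mu x.2, x.1 *: x.2) | x <- s]; split; last by rewrite big_map.
  move=> x /mapP[y ys ->] /=; rewrite (linZ lT).
  have -> : T y.2 = mu y.2 *: y.2.
    by have [m Tm] := sE _ ys; apply: (@xgetPex _ 0 [set m | T y.2 = m *: y.2]); exists m.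
  by rewrite !scalerA mulrC.
have [dec decE] := choice decP.
exists dec => W' phi lphi.
have key (t : seq (K * W)) : (forall x, x \in t -> T x.2 = x.1 *: x.2) ->
    \sum_(x <- t) x.2 = 0 -> \sum_(x <- t) phi x.1 x.2 = 0.
  move=> tT /(eig_sum0 tT) t0.
  pose U := undup [seq x.1 | x <- t].
  transitivity (\sum_(x <- t) \sum_(l <- U | x.1 == l) phi l x.2).
    rewrite big_seq [RHS]big_seq; apply: eq_bigr => x xt.
    rewrite -big_filter.
    have -> : [seq l <- U | x.1 == l] = [:: x.1].
      rewrite (eq_filter (a2 := pred1 x.1)); last by move=> l; rewrite /= eq_sym.
      by rewrite filter_pred1_uniq ?undup_uniq// mem_undup; apply/mapP; exists x.
    by rewrite big_seq1.
  rewrite (exchange_big_dep xpredT)//= big1// => l _.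
  by rewrite -(lin_sum (lphi l)) t0 (lin0 (lphi l)).
have eqL (t u : seq (K * W)) : (forall x, x \in t -> T x.2 = x.1 *: x.2) ->
    (forall x, x \in u -> T x.2 = x.1 *: x.2) ->
    \sum_(x <- t) x.2 = \sum_(x <- u) x.2 ->
    \sum_(x <- t) phi x.1 x.2 = \sum_(x <- u) phi x.1 x.2.
  move=> tT uT tu; apply/eqP; rewrite -subr_eq0; apply/eqP.
  have -> : \sum_(x <- t) phi x.1 x.2 - \sum_(x <- u) phi x.1 x.2 =
      \sum_(x <- t ++ [seq (x.1, - x.2) | x <- u]) phi x.1 x.2.
    rewrite big_cat big_map /= -sumrN; congr (_ + _); apply: eq_bigr => x _.
    by rewrite (linN (lphi _)).
  apply: key; last by rewrite big_cat big_map /= tu sumrN subrr.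
  move=> x; rewrite mem_cat => /orP[/tT//|/mapP[y /uT yT ->]] /=.
  by rewrite (linN lT) yT scalerN.
split; last first.
  move=> w c Tw; have [dT1 dE] := decE w.
  rewrite (eqL _ [:: (c, w)]) ?big_seq1//.
  by move=> x; rewrite inE => /eqP ->.
move=> c u v; have [uT uE] := decE u; have [vT vE] := decE v.
have [wT wE] := decE (c *: u + v).
rewrite (eqL _ ([seq (x.1, c *: x.2) | x <- dec u] ++ dec v)) //.
- rewrite big_cat big_map /= scaler_sumr; congr (_ + _).
  by apply: eq_bigr => x _; rewrite (linZ (lphi _)).
- move=> x; rewrite mem_cat => /orP[/mapP[y /uT yT ->]|/vT//] /=.
  by rewrite (linZ lT) yT !scalerA mulrC.
- by rewrite -wE big_cat big_map /= -scaler_sumr -uE -vE.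
Qed.

End Eigen.

Section Basis.
Context {T : choiceType} (P : set T) (f : T -> W).

(** The bases of the theory are indexed by words and may be listed with
    repetitions; collecting equal indices reduces to the distinct ones. *)
Lemma basis_relation {X : lmodType K} (h : T -> X) (s : seq (K * T)) :
  is_basis P f ->
  (forall x, x \in s -> P x.2) -> \sum_(x <- s) x.1 *: f x.2 = 0 ->
  \sum_(x <- s) x.1 *: h x.2 = 0.
Proof.
move=> hf sP s0; pose U := undup [seq x.2 | x <- s].
have collect (Y : lmodType K) (y : T -> Y) : \sum_(x <- s) x.1 *: y x.2 =
    \sum_(t <- U) (\sum_(x <- s | x.2 == t) x.1) *: y t.
  under [RHS]eq_bigr => t _ do rewrite scaler_suml.
  rewrite (exchange_big_dep predT)//= big_seq [RHS]big_seq; apply: eq_bigr => x xs.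
  rewrite big_mkcond (bigD1_seq x.2) ?undup_uniq//=; last first.
    by rewrite mem_undup; apply/mapP; exists x.
  by rewrite eqxx big1 ?addr0// => t; rewrite eq_sym => /negbTE ->.
rewrite collect big_seq big1// => t tU.
rewrite (hf.2 U (fun t => \sum_(x <- s | x.2 == t) x.1)) ?scale0r ?undup_uniq//.
  by move=> k; rewrite mem_undup => /mapP[x /sP + ->].
by rewrite -collect.
Qed.

Lemma basis_ext (hf : is_basis P f) {X : lmodType K} (h : T -> X) :
  exists L : W -> X, linear L /\ forall t, P t -> L (f t) = h t.
Proof.
have ex w : exists s : seq (K * T), (forall x, x \in s -> P x.2) /\
    w = \sum_(x <- s) x.1 *: f x.2.
  move: w (hf.1 w); apply: lspan_ind; first by exists [::]; rewrite big_nil.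
  move=> c _ w [t Pt <-] [s [sP ->]]; exists ((c, t) :: s); rewrite big_cons; split=> // x.
  by rewrite inE => /orP[/eqP ->|/sP].
have [r rE] := choice ex.
have LE w (s : seq (K * T)) : (forall x, x \in s -> P x.2) ->
    w = \sum_(x <- s) x.1 *: f x.2 ->
    \sum_(x <- r w) x.1 *: h x.2 = \sum_(x <- s) x.1 *: h x.2.
  move=> sP wE; apply/eqP; rewrite -subr_eq0; apply/eqP.
  have catE (Y : lmodType K) (y : T -> Y) :
      \sum_(x <- r w ++ [seq (- x.1, x.2) | x <- s]) x.1 *: y x.2 =
      \sum_(x <- r w) x.1 *: y x.2 - \sum_(x <- s) x.1 *: y x.2.
    rewrite big_cat big_map /= -sumrN; congr (_ + _).
    by apply: eq_bigr => x _; rewrite scaleNr.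
  rewrite -catE; apply: (basis_relation _ hf); last first.
    by rewrite catE -(rE w).2 -wE subrr.
  by move=> x; rewrite mem_cat => /orP[/(rE w).1|/mapP[y /sP + ->]].
exists (fun w => \sum_(x <- r w) x.1 *: h x.2); split=> [c u v|t Pt].
  rewrite (LE _ ([seq (c * x.1, x.2) | x <- r u] ++ r v)).
  - rewrite big_cat big_map /= scaler_sumr; congr (_ + _).
    by apply: eq_bigr => x _; rewrite scalerA.
  - by move=> x; rewrite mem_cat => /orP[/mapP[y /(rE u).1 + ->]|/(rE v).1].
  rewrite big_cat big_map /= {1}(rE u).2 {1}(rE v).2 scaler_sumr; congr (_ + _).
  by apply: eq_bigr => x _; rewrite scalerA.
rewrite (LE _ [:: (1, t)]) ?big_seq1 ?scale1r//.
by move=> x; rewrite inE => /eqP ->.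
Qed.

Lemma basis_neq0 t : is_basis P f -> P t -> f t != 0.
Proof.
move=> [_ h] Pt; apply/eqP => f0; have : (1 : K) = 0.
  apply: (h [:: t] (fun=> 1)) => //; rewrite ?big_seq1 ?f0 ?scaler0 ?inE//.
  by move=> k; rewrite inE => /eqP ->.
by move/eqP; rewrite oner_eq0.
Qed.

Lemma basis_coord s : is_basis P f -> P s -> exists phi : W -> K,
  [/\ forall c u v, phi (c *: u + v) = c * phi u + phi v, phi (f s) = 1
    & forall t, P t -> t != s -> phi (f t) = 0].
Proof.
move=> hf Ps; have [phi [lphi phiE]] := basis_ext hf (fun t => (t == s)%:R : K^o).
exists phi; split=> [c u v||t Pt /negbTE ts]; first exact: lphi.
  by rewrite phiE// eqxx.
by rewrite phiE// ts.
Qed.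

Lemma max_seq {d} {O : orderType d} (r : T -> O) (l : seq T) : l != [::] ->
  exists2 m, m \in l & forall k, k \in l -> (r k <= r m)%O.
Proof.
elim: l => [//|x l IH] _; have [->|/IH[m ml mM]] := eqVneq l [::].
  by exists x; rewrite ?inE// => k; rewrite inE => /eqP ->.
have [xm|mx] := leP (r x) (r m).
  by exists m; rewrite ?inE ?ml ?orbT// => k; rewrite inE => /orP[/eqP ->//|/mM].
exists x; rewrite ?inE ?eqxx// => k; rewrite inE => /orP[/eqP ->//|/mM km].
by apply: (le_trans km); apply: ltW.
Qed.

(** Look at the term of highest rank in a relation: only its leading part
    contributes to the corresponding coordinate. *)
Lemma triangular_free {d} {O : orderType d} (r : T -> O) (f' : T -> W) :
  is_basis P f ->
  (forall s, P s ->
    f' s - f s \in lspan (f @` [set t | P t /\ (r t < r s)%O])) ->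
  forall (s : seq T) (c : T -> K), uniq s -> (forall k, k \in s -> P k) ->
     \sum_(k <- s) c k *: f' k = 0 -> forall k, k \in s -> c k = 0.
Proof.
move=> bf tri s c us sP s0.
suff e : [seq k <- s | c k != 0] == [::].
  move=> k ks; apply/eqP/negPn/negP => ck.
  by have : k \in [seq k <- s | c k != 0]; [rewrite mem_filter ck|rewrite (eqP e)].
apply/negPn/negP => /(max_seq r)[m]; rewrite mem_filter => /andP[cm ms] mM.
have Pm := sP _ ms.
have [phi [lphi phim phi0]] := basis_coord bf Pm.
have phi_0 : phi 0 = 0.
  by have := lphi (-1) 0 0; rewrite scaler0 addr0 mulN1r addNr.
have low u x : (r x <= r m)%O -> u \in lspan (f @` [set t | P t /\ (r t < r x)%O]) ->
    phi u = 0.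
  move=> xm; move: u; apply: lspan_ind => // a _ v [t [Pt tx] <-] v0.
  rewrite lphi v0 phi0 ?mulr0 ?addr0//; apply/eqP => tm.
  by have := lt_le_trans tx xm; rewrite tm ltxx.
have phiF x : x \in s -> c x != 0 -> phi (f' x) = (x == m)%:R.
  move=> xs cx; have xm : (r x <= r m)%O by apply: mM; rewrite mem_filter cx.
  have := lphi 1 (f' x - f x) (f x); rewrite scale1r subrK mul1r => ->.
  rewrite (low _ _ xm) ?add0r; last by apply/tri/sP.
  by case: eqVneq => [->//|xm']; rewrite phi0//; apply: sP.
have : phi (\sum_(k <- s) c k *: f' k) = c m.
  have -> : phi (\sum_(k <- s) c k *: f' k) = \sum_(k <- s) c k * phi (f' k).
    elim: (s) => [|y t IH]; first by rewrite !big_nil.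
    by rewrite !big_cons lphi IH.
  rewrite (bigD1_seq m) //= phiF// eqxx mulr1 big_seq_cond big1 ?addr0//.
  move=> k /andP[ks km]; have [->|ck] := eqVneq (c k) 0; first by rewrite mul0r.
  by rewrite phiF// (negbTE km) mulr0.
by rewrite s0 phi_0 => /esym/eqP; rewrite (negbTE cm).
Qed.

End Basis.

Section Sorting.
Context {T : eqType} (lt : rel T) (od : pred T) (w : seq T -> W) (s0 : seq T).

Lemma perm_swap (P : seq T -> Prop) :
  (forall A i j B, P (A ++ i :: j :: B) -> P (A ++ j :: i :: B)) ->
  forall s t A, perm_eq s t -> P (A ++ s) -> P (A ++ t).
Proof.
move=> sw; elim=> [|x s IH] t A; first by rewrite perm_sym => /perm_nilP ->.
move=> xst; have xt : x \in t by rewrite -(perm_mem xst) inE eqxx.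
case/splitPr: xt xst => t1 t2 xst.
have st : perm_eq s (t1 ++ t2).
  by rewrite -(perm_cons x) (permPl xst) perm_sym -cat1s perm_catCA.
move=> PA; have {IH} : P (A ++ x :: t1 ++ t2).
  by rewrite -cat_rcons; apply: IH => //; rewrite cat_rcons.
elim: t1 A {xst st PA} => [//|y t1 IH] A /= /sw.
by rewrite -cat_rcons => /IH; rewrite cat_rcons.
Qed.

(** Bubble sort modulo N.  The sorted rearrangements that the last hypothesis does
    not cover repeat an odd letter; swapping the two copies then shows that twice
    the word is in N. *)
Lemma sorting_mem N :
  (2%:R : K) != 0 ->
  transitive lt -> (forall i j, [|| lt i j, i == j | lt j i]) ->
  (forall A i j B, perm_eq (A ++ i :: j :: B) s0 ->
    w (A ++ i :: j :: B) - (-1) ^+ (od i && od j) *: w (A ++ j :: i :: B) \in N) ->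
  (forall t, perm_eq t s0 -> sorted (fun i j => lt i j || (i == j) && ~~ od i) t ->
    w t \in N) ->
  w s0 \in N.
Proof.
move=> K2 ltr ltot sw so.
pose le i j := lt i j || (i == j).
have letot : total le.
  by move=> i j; rewrite /le [j == i]eq_sym; case/or3P: (ltot i j) => ->; rewrite ?orbT.
have letr : transitive le.
  move=> y x z /orP[xy|/eqP ->//] /orP[yz|/eqP <-]; rewrite /le ?xy//.
  by rewrite (ltr _ _ _ xy yz).
pose P t := perm_eq t s0 -> w t \in N.
have step A i j B : P (A ++ i :: j :: B) -> P (A ++ j :: i :: B).
  move=> PA pe.
  have pe' : perm_eq (A ++ i :: j :: B) s0.
    apply: perm_trans pe; rewrite perm_cat2l.
    by rewrite -[i :: j :: B]/([:: i] ++ [:: j] ++ B) perm_catCA.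
  rewrite -(subrK ((-1) ^+ (od j && od i) *: w (A ++ i :: j :: B)) (w _)).
  by rewrite rpredD ?rpredZ ?PA//; apply: sw.
suff h : P (sort le s0).
  by apply: (perm_swap step (s := sort le s0) (A := [::]) _ h) => //; rewrite perm_sort.
move=> pe; have := sort_sorted letot s0; move: (sort le s0) pe => t pe st.
have [str|nstr] := boolP (sorted (fun i j => lt i j || (i == j) && ~~ od i) t).
  exact: so.
have [A [i [B [e oi]]]] : exists A i B, t = A ++ i :: i :: B /\ od i.
  case: t st nstr {pe} => [//|x t] /=.
  elim: t x => [//|y t IH] x /= /andP[xy yt].
  have [/orP[lxy|/andP[exy oxy]]|nxy] := boolP (lt x y || (x == y) && ~~ od x).
  - by rewrite /= => /(IH _ yt)[A [i [B [-> oi]]]]; exists (x :: A), i, B.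
  - by rewrite /= => /(IH _ yt)[A [i [B [-> oi]]]]; exists (x :: A), i, B.
  move: xy nxy; rewrite /le; case: (lt x y) => //= /eqP ->.
  rewrite eqxx negbK => oy _.
  by exists [::], y, t.
have := sw A i i B; rewrite -e => /(_ pe).
rewrite oi /= expr1 scaleN1r opprK -mulr2n -scaler_nat => /(rpredZ 2%:R^-1).
by rewrite scalerA mulVf// scale1r.
Qed.

End Sorting.
End LinearTools.

(** * The Borcherds identity *)

Section ModuleIdentities.
Context {K : fieldType} {W : lmodType K}.

(** Linear combinations of atoms, for a reflexive decision of equalities in a
    module: [leval_eq] compares the coefficients of each atom. *)
Inductive lexp := Lvar of nat | Lzero | Ladd of lexp & lexp | Lopp of lexp
  | Lscale of K & lexp.

Fixpoint leval (env : seq W) (e : lexp) : W :=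
  match e with
  | Lvar n => env`_n
  | Lzero => 0
  | Ladd a b => leval env a + leval env b
  | Lopp a => - leval env a
  | Lscale c a => c *: leval env a
  end.

Fixpoint lcoef (i : nat) (e : lexp) : K :=
  match e with
  | Lvar n => if eqn n i then 1 else 0
  | Lzero => 0
  | Ladd a b => lcoef i a + lcoef i b
  | Lopp a => - lcoef i a
  | Lscale c a => c * lcoef i a
  end.

Lemma levalE env e : leval env e = \sum_(i < size env) lcoef i e *: env`_i.
Proof.
elim: e => [n||a IHa b IHb|a IHa|c a IHa] /=; rewrite ?IHa ?IHb.
- have [ns|ns] := ltnP n (size env).
    rewrite (bigD1 (Ordinal ns)) //= eqnE eqxx scale1r big1 ?addr0// => i.
    by rewrite -val_eqE /= eq_sym => /negbTE ->; rewrite scale0r.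
  rewrite nth_default// big1// => i _; rewrite eqnE.
  by have := ltn_ord i; case: eqP => [<-|_ _]; rewrite ?scale0r// ltnNge ns.
- by rewrite big1// => i _; rewrite scale0r.
- by rewrite -big_split; apply: eq_bigr => i _; rewrite scalerDl.
- by rewrite -sumrN; apply: eq_bigr => i _; rewrite scaleNr.
- by rewrite scaler_sumr; apply: eq_bigr => i _; rewrite scalerA.
Qed.

Fixpoint lcheck e1 e2 n : Prop :=
  if n is n'.+1 then lcheck e1 e2 n' /\ lcoef n' e1 = lcoef n' e2 else True.

Lemma leval_eq env e1 e2 : lcheck e1 e2 (size env) -> leval env e1 = leval env e2.
Proof.
move=> h; rewrite !levalE; apply: eq_bigr => -[i /= ie] _; congr (_ *: _).
elim: (size env) ie h => [//|n IH]; rewrite ltnS leq_eqVlt => /orP[/eqP ->|ie].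
  by case.
by move=> [/(IH ie)].
Qed.

End ModuleIdentities.

Ltac lfind x l :=
  match l with
  | cons x _ => constr:(0%N)
  | cons _ ?l' => let n := lfind x l' in constr:(n.+1)
  end.
Ltac ladd x l :=
  match l with
  | _ => let _ := lfind x l in l
  | _ => constr:(cons x l)
  end.
Ltac latoms t l :=
  match t with
  | (?a + ?b)%R => let l1 := latoms a l in latoms b l1
  | (- ?a)%R => latoms a l
  | (_ *: ?a)%R => latoms a l
  | 0%R => l
  | ?x => ladd x l
  end.
Ltac lreify K t l :=
  match t with
  | (?a + ?b)%R => let x := lreify K a l in let y := lreify K b l in
      constr:(@Ladd K x y)
  | (- ?a)%R => let x := lreify K a l in constr:(@Lopp K x)
  | (?c *: ?a)%R => let x := lreify K a l in constr:(@Lscale K c x)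
  | 0%R => constr:(@Lzero K)
  | ?x => let n := lfind x l in constr:(@Lvar K n)
  end.
Ltac lmod_core K :=
  match goal with |- @eq ?W ?a ?b =>
    let l0 := latoms a (@nil W) in
    let l := latoms b l0 in
    let x := lreify K a l in
    let y := lreify K b l in
    refine (@leval_eq K _ l x y _); cbn [lcheck lcoef eqn size]
  end.
(* Proves equalities between linear combinations, up to ring identities
   between the coefficients. *)
Ltac lmod K := lmod_core K; repeat split; try ring.

Lemma S_bigsum (K : fieldType) (W : lmodType K) n (F : nat -> nat -> W) :
  (forall i, evz (F i)) ->
  \S_ j (\sum_(i < n) F i j) = \sum_(i < n) \S_ j F i j.
Proof.
move=> eF.
suff : evz (fun j => \sum_(i < n) F i j) /\
    \S_ j (\sum_(i < n) F i j) = \sum_(i < n) \S_ j F i j by case.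
elim: n => [|n [e IH]].
  split; first by exists 0%N => j _; rewrite big_ord0.
  by rewrite big_ord0; apply: S_eq0 => j; rewrite big_ord0.
have E j : \sum_(i < n.+1) F i j = \sum_(i < n) F i j + F n j by rewrite big_ord_recr.
split; last by rewrite (S_eq E) SD// IH big_ord_recr.
by have [M h] := evzD e (eF n); exists M => j /h; rewrite -E.
Qed.

Lemma evz_bigsum (K : fieldType) (W : lmodType K) n (F : nat -> nat -> W) :
  (forall i, evz (F i)) -> evz (fun j => \sum_(i < n) F i j).
Proof.
move=> eF; elim: n => [|n e]; first by exists 0%N => j _; rewrite big_ord0.
by have [M h] := evzD e (eF n); exists M => j /h; rewrite big_ord_recr.
Qed.

Lemma evzN (K : fieldType) (W : lmodType K) (F : nat -> W) :
  evz F -> evz (fun j => - F j).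
Proof. by move=> [M h]; exists M => j /h ->; rewrite oppr0. Qed.

Lemma SN (K : fieldType) (W : lmodType K) (F : nat -> W) :
  evz F -> \S_ j - F j = - \S_ j F j.
Proof.
move=> eF; rewrite -scaleN1r -SZ//; apply: S_eq => j.
by rewrite scaleN1r.
Qed.

Lemma SB (K : fieldType) (W : lmodType K) (F G : nat -> W) :
  evz F -> evz G -> \S_ j (F j - G j) = \S_ j F j - \S_ j G j.
Proof. by move=> eF eG; rewrite SD ?SN//; apply: evzN. Qed.

Lemma S_linear (K : fieldType) (W W' : lmodType K) (f : nat -> W -> W') :
  (forall j, linear (f j)) -> (forall x, evz (fun j => f j x)) ->
  linear (fun x => \S_ j f j x).
Proof.
move=> lf ef c u v.
rewrite (S_eq (G := fun j => c *: f j u + f j v)); last by move=> j; exact: lf.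
by rewrite SD ?SZ//; apply: evzZ.
Qed.

Definition sgn {K : fieldType} (p q : bool) : K := (-1) ^+ (p && q).

Section Borcherds.
Context {R : realType} {V : lmodType R[i]} (VA : vertexSuperalgebra V).
Local Notation "a _( n ) b" := (nprod VA n a b)
  (at level 35, n at level 200, b at level 35).
Local Notation K := (R[i]).
Implicit Types (a b c d : V) (k m n l : int).

Lemma npl n b : linear (nprod VA n ^~ b). Proof. exact: (nprod_bilinear VA n).1. Qed.
Lemma npr n a : linear (nprod VA n a). Proof. exact: (nprod_bilinear VA n).2. Qed.
Lemma np0l n b : 0 _(n) b = 0. Proof. exact: (lin0 (npl n b)). Qed.
Lemma np0r n a : a _(n) 0 = 0. Proof. exact: (lin0 (npr n a)). Qed.

Lemma npE n n' a b : n = n' -> a _(n) b = a _(n') b. Proof. by move=> ->. Qed.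

Lemma evz_np n a b : evz (fun j : nat => a _(n + j%:Z) b).
Proof.
have [N h] := nprod_field VA a b; exists `|N - n|%N => j Nj; apply: h; lia.
Qed.

Lemma lin_comp (W W' W'' : lmodType K) (f : W' -> W'') (g : W -> W') :
  linear f -> linear g -> linear (fun x => f (g x)).
Proof. by move=> lf lg c u v; rewrite lg lf. Qed.

(** The coefficient of (z - w)^k a(z) b(w), expanded for |z| > |w|. *)
Definition tprod k a b m n c : V :=
  \S_ j (((-1) ^+ j * gbinom k%:~R j) *: (a _(m + k - j%:Z) (b _(n + j%:Z) c))).

Lemma evz_tprod (f : nat -> K) (g : nat -> int) a b n c :
  evz (fun j => f j *: (a _(g j) (b _(n + j%:Z) c))).
Proof.
apply: evzZ; apply: (evz_comp (f := fun j x => a _(g j) x)); last exact: evz_np.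
by move=> j; exact: np0r.
Qed.

(** Multiplication by z - w. *)
Lemma tprod_pascal k a b m n c :
  tprod (k + 1) a b m n c = tprod k a b (m + 1) n c - tprod k a b m (n + 1) c.
Proof.
rewrite /tprod.
have e1 := evz_tprod (fun j => (-1) ^+ j * gbinom (k + 1)%:~R j)
  (fun j => m + (k + 1) - j%:Z) a b n c.
have e2 := evz_tprod (fun j => (-1) ^+ j * gbinom k%:~R j)
  (fun j => m + 1 + k - j%:Z) a b n c.
have e3 := evz_tprod (fun j => (-1) ^+ j * gbinom k%:~R j)
  (fun j => m + k - j%:Z) a b (n + 1) c.
rewrite (S_recl e1) (S_recl e2) -[RHS]addrA; rewrite -[X in _ = _ + X](SB (evzS e2) e3).
congr (_ + _); first by rewrite !gb0 (@npE _ (m + 1 + k - 0)) //; lia.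
apply: S_eq => j; rewrite rmorphD /= gb_pascal.
rewrite (@npE _ (m + k - j%:Z)) ?[b _(n + 1 + _) c](@npE _ (n + j.+1%:Z));
  [|lia|lia].
rewrite [a _(m + 1 + _ - _) _](@npE _ (m + k - j%:Z)); last by lia.
by rewrite -scalerBl; congr (_ *: _); rewrite exprS; ring.
Qed.

Lemma tprod_nat (N : nat) a b m n c :
  tprod N%:Z a b m n c = \sum_(j < N.+1) ((-1) ^+ j * 'C(N, j)%:R) *:
      (a _(m + (N - j)%N) (b _(n + j%:Z) c)).
Proof.
rewrite /tprod (@S_trunc _ _ N.+1) => [|j Nj]; last first.
  by rewrite -[N%:~R]/(N%:R) gb_nat bin_small// mulr0 scale0r.
apply: eq_bigr => j _; rewrite -[N%:~R]/(N%:R) gb_nat; congr (_ *: _).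
have jN : (j <= N)%N by rewrite -ltnS.
by apply: npE; lia.
Qed.

Lemma tprod_nat_rev (N : nat) a b m n c :
  tprod N%:Z b a n m c = (-1) ^+ N *: \sum_(j < N.+1) ((-1) ^+ j * 'C(N, j)%:R) *:
      (b _(n + j%:Z) (a _(m + (N - j)%N) c)).
Proof.
rewrite tprod_nat (reindex_inj rev_ord_inj) /= scaler_sumr; apply: eq_bigr => j _.
have jN : (j <= N)%N by rewrite -ltnS.
rewrite subSS subKn// bin_sub// scalerA mulrA; congr (_ * _ *: _).
by rewrite -signr_odd oddB// signr_addb !signr_odd.
Qed.

(** For k large the two expansions of (z - w)^k a(z) b(w) and (z - w)^k b(w) a(z)
    agree, by locality. *)
Lemma loc_tprod p q a b : vpar VA p a -> vpar VA q b -> exists N : nat,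
  forall N', (N <= N')%N -> forall m n c,
  tprod N'%:Z a b m n c = ((-1) ^+ N' * sgn p q) *: tprod N'%:Z b a n m c.
Proof.
move=> pa qb; have [N hN] := locality pa qb; exists N => N' /subnK <-.
elim: (N' - N)%N => [|t IH] m n c.
  rewrite add0n tprod_nat tprod_nat_rev scalerA mulrAC -expr2 sqrr_sign mul1r.
  apply/eqP; rewrite -subr_eq0 scaler_sumr -sumrB -[X in _ == X](hN m n c).
  apply/eqP; apply: eq_bigr => j _.
  by rewrite scalerBr !scalerA [sgn _ _ * _]mulrC.
rewrite addSn -[(t + N).+1]addn1 PoszD !tprod_pascal !IH addn1 exprS.
lmod (R[i]).
Qed.

Lemma loc_np p q a b : vpar VA p a -> vpar VA q b -> exists N : nat,
  forall N', (N <= N')%N -> forall m n c,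
  \sum_(j < N'.+1) ((-1) ^+ j * 'C(N', j)%:R) *:
      (a _(m + (N' - j)%N) (b _(n + j%:Z) c)
       - sgn p q *: (b _(n + j%:Z) (a _(m + (N' - j)%N) c))) = 0.
Proof.
move=> pa qb; have [N hN] := loc_tprod pa qb; exists N => N' /hN h m n c.
have := h m n c; rewrite tprod_nat tprod_nat_rev scalerA mulrAC -expr2 sqrr_sign mul1r.
move=> /eqP; rewrite -subr_eq0 scaler_sumr -sumrB => /eqP h'; rewrite -[RHS]h'.
by apply: eq_bigr => j _; rewrite scalerBr !scalerA [sgn _ _ * _]mulrC.
Qed.

Section Fixed.
Context (p q : bool) (a b : V) (pa : vpar VA p a) (qb : vpar VA q b).

(** The coefficient of (z - w)^k Y(Y(a, z - w)b, w), expanded for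
    |w| > |z - w|. *)
Definition iprod k m n c : V :=
  \S_ j (gbinom m%:~R j *: ((a _(k + j%:Z) b) _(m + n - j%:Z) c)).

Lemma evz_iprod (f : nat -> K) (g : nat -> int) k c :
  evz (fun j => f j *: ((a _(k + j%:Z) b) _(g j) c)).
Proof.
apply: evzZ; apply: (evz_comp (f := fun j x => x _(g j) c)); last exact: evz_np.
by move=> j; exact: np0l.
Qed.

(** The difference of the two sides of the Borcherds identity.  It is treated as
    the operator series X_k(z, w) = (z - w)^k X_0(z, w). *)
Definition bdefect k m n c : V :=
  iprod k m n c - (tprod k a b m n c - ((-1) ^+ absz k * sgn p q) *: tprod k b a n m c).

Lemma signS k : (-1) ^+ absz (k + 1) = - (-1) ^+ absz k :> K.
Proof.
have [k0|k0] := leP 0 k.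
  have -> : absz (k + 1) = (absz k).+1 by lia.
  by rewrite exprS mulN1r.
have -> : absz k = (absz (k + 1)).+1 by lia.
by rewrite exprS mulN1r opprK.
Qed.

Lemma iprod_pascal k m n c : iprod (k + 1) m n c = iprod k (m + 1) n c - iprod k m (n + 1) c.
Proof.
rewrite /iprod.
have e1 := evz_iprod (gbinom (m + 1)%:~R) (fun j => m + 1 + n - j%:Z) k c.
have e2 := evz_iprod (gbinom m%:~R) (fun j => m + (n + 1) - j%:Z) k c.
rewrite -SB// S_recl; last by apply: evzD => //; apply: evzN.
rewrite !gb0 [X in X - _](_ : _ = 1 *: ((a _( k + 0) b) _( m + (n + 1) - 0) c)); last first.
  by congr (_ *: _); apply: npE; lia.
rewrite subrr add0r; apply: S_eq => j.
rewrite [(m + 1)%:~R]rmorphD /= gb_pascal.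
rewrite [X in _ = X - _](_ : _ = (gbinom m%:~R j.+1 + gbinom m%:~R j) *:
  ((a _( k + j.+1%:Z) b) _( m + (n + 1) - j.+1%:Z) c)); last first.
  by congr (_ *: _); apply: npE; lia.
rewrite -scalerBl (_ : _ + _ - _ = gbinom m%:~R j); last by ring.
congr (_ *: _).
rewrite (@npE (k + j.+1%:Z) (k + 1 + j%:Z)); last by lia.
by apply: npE; lia.
Qed.

Lemma bdefect_pascal k m n c :
  bdefect (k + 1) m n c = bdefect k (m + 1) n c - bdefect k m (n + 1) c.
Proof.
rewrite /bdefect iprod_pascal !tprod_pascal signS.
move: (iprod _ _ _ _) (iprod _ _ _ _) => x1 x2.
move: (tprod k a b _ _ _) (tprod k a b _ _ _) => x3 x4.
move: (tprod k b a _ _ _) (tprod k b a _ _ _) => x5 x6.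
set s := (-1) ^+ _; lmod (R[i]).
Qed.

(** For k large the iterates a_(k+j)b vanish and the remaining terms cancel by
    locality. *)
Lemma bdefect_large : exists N, forall k, N <= k -> forall m n c, bdefect k m n c = 0.
Proof.
have [N1 h1] := loc_tprod pa qb; have [N2 h2] := nprod_field VA a b.
exists (Num.max N1%:Z N2) => k; rewrite ge_max => /andP[k1 k2] m n c.
have [N kN] : exists N : nat, k = N%:Z by exists (absz k); lia.
subst k.
rewrite /bdefect (h1 N) ?absz_nat//.
rewrite subrr subr0; apply: S_eq0 => j; rewrite h2 ?np0l ?scaler0//; lia.
Qed.

Lemma der_np n x y : der VA (x _(n) y) = x _(n) (der VA y) - n%:~R *: (x _(n - 1) y).
Proof. by have /eqP := translation VA n x y; rewrite subr_eq addrC => /eqP. Qed.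

Lemma vac_nat n x : 0 <= n -> x _(n) vac VA = 0.
Proof. by case: n => // n _; exact: nprod_vac0. Qed.

Lemma iprod0 k n c : iprod k 0 n c = (a _(k) b) _(n) c.
Proof.
rewrite /iprod (@S_trunc _ _ 1) => [|[//|j] _].
  by rewrite big_ord1 gb0 scale1r /= addr0 add0r subr0.
by rewrite mulr0z gb00 scale0r.
Qed.

Lemma tprod_vac0 k s : tprod k b a s 0 (vac VA) = 0.
Proof. by apply: S_eq0 => j; rewrite vac_nat ?np0r ?scaler0//; lia. Qed.

(** Translation covariance of each of the three terms; as the vacuum is killed by
    the translation operator only the indices of the products are shifted. *)
Lemma bdefect_vac_der k s :
  der VA (bdefect k 0 s (vac VA)) = - (s%:~R *: bdefect k 0 (s - 1) (vac VA)).
Proof.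
have ld := der_linear VA.
have C := fun (f : nat -> K) g t => evz_tprod f g a b t (vac VA).
rewrite /bdefect !tprod_vac0 !iprod0 !scaler0 !subr0 (linB ld) scalerBr opprB.
rewrite der_np der_vac np0r sub0r addrC; congr (_ + _).
apply/eqP; rewrite eq_sym -subr_eq0 opprK; apply/eqP.
rewrite /tprod (S_lin ld) -?SZ//.
have e1 := evz_lin ld (C (fun j => (-1) ^+ j * gbinom k%:~R j) (fun j => 0 + k - j%:Z) s).
have e2 := evzZ (fun=> s%:~R)
  (C (fun j => (-1) ^+ j * gbinom k%:~R j) (fun j => 0 + k - j%:Z) (s - 1)).
rewrite -(SD e2 e1).
pose G j := - ((-1) ^+ j * gbinom k%:~R j * j%:R) *: (a _(k - j%:Z) (b _(s - 1 + j%:Z) vac VA)).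
have eG : evz G by apply: C.
rewrite (S_eq (G := fun j => G j - G j.+1)).
  rewrite SB//; last exact: evzS.
  by rewrite (S_recl eG) addrK /G mulr0 oppr0 scale0r.
move=> j; rewrite (linZ ld) !der_np der_vac np0r sub0r (linN (npr _ _)) (linZ (npr _ _)) /G.
rewrite add0r (@npE (s + j%:Z - 1) (s - 1 + j%:Z)) ?(@npE (s - 1 + j.+1%:Z) (s + j%:Z));
  [|lia|lia].
rewrite (@npE (k - j.+1%:Z) (k - j%:Z - 1)); last by lia.
have gS := gbS (k%:~R : R) j.
move: (a _( _) _) (a _( _) _) => x y.
rewrite exprS [_ * _ * _.+1%:R]mulrAC -[(-1 * _) * _ * _]mulrA gS CB Cint Cnat.
by rewrite !rmorphD /= !rmorphN /= -!pmulrn; lmod (R[i]).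
Qed.

(** For the coefficients of a series in z and w the hypothesis says that z - w
    kills it. *)
Lemma shift_fun (F : int -> int -> V) : (forall m n, F (m + 1) n = F m (n + 1)) ->
  forall m n, F m n = F 0 (m + n).
Proof.
move=> sh; case=> u.
  elim: u => [|u IHu] n; first by rewrite add0r.
  by rewrite -addn1 PoszD sh IHu -addrA [1 + n]addrC.
rewrite NegzE; elim: u => [|u IHu] n.
  by rewrite -{1}[n](subrK 1) -sh addNr [- 1 + n]addrC.
rewrite -{1}[n](subrK 1) -sh (_ : - (u.+2)%:Z + 1 = - u.+1%:Z); last by lia.
by rewrite IHu; congr F; lia.
Qed.

(** Downward induction on k.  If X_{k+1} kills the vacuum then the coefficients
    of X_k vac depend on m + n only.  Those with m + n >= -1 are computed
    directly, and applying the translation operator relates the coefficient of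
    index s - 1 to s times the one of index s. *)
Lemma bdefect_vac k m n : bdefect k m n (vac VA) = 0.
Proof.
have [N hN] := bdefect_large.
suff H (t : nat) : forall k, N - t%:Z <= k -> forall m n, bdefect k m n (vac VA) = 0.
  by apply: (H (absz (N - k))); lia.
elim: t => {k m n} [|t IH] k Nk m n; first by apply: hN; lia.
have sh m' n' : bdefect k (m' + 1) n' (vac VA) = bdefect k m' (n' + 1) (vac VA).
  apply/eqP; rewrite -subr_eq0 -bdefect_pascal IH//; lia.
have {}sh : bdefect k m n (vac VA) = bdefect k 0 (m + n) (vac VA).
  exact: (shift_fun (F := fun m n => bdefect k m n (vac VA)) sh).
rewrite sh; move: (m + n) => {sh m n} s.
have f0 s' : -1 <= s' -> bdefect k 0 s' (vac VA) = 0.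
  move=> s1; rewrite /bdefect tprod_vac0 scaler0 subr0 iprod0.
  rewrite /tprod (@S_trunc _ _ 1) => [|[//|j] _]; last first.
    by rewrite (@vac_nat (s' + _)) ?np0r ?scaler0//; lia.
  rewrite big_ord1 gb0 expr0 mulr1 scale1r.
  have [->|s0] := eqVneq s' (-1).
    by rewrite /= !addr0 !add0r ?subr0 !nprod_vac subrr.
  by rewrite !vac_nat ?np0r ?subrr//; lia.
have [/f0 //|s1] := leP (-1) s.
have {s1} [u ->] : exists u : nat, s = -1 - u%:Z by exists (absz (s + 1)); lia.
elim: u => [|u IHu]; first by apply: f0; lia.
(* The coefficient is multiplied by the nonzero integer -1 - u. *)
have := bdefect_vac_der k (-1 - u%:Z); rewrite IHu (lin0 (der_linear VA)).
move=> /esym/eqP; rewrite oppr_eq0 scaler_eq0 intr_eq0 => /orP[/eqP|/eqP].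
  by lia.
by rewrite (_ : -1 - u%:Z - 1 = -1 - u.+1%:Z)//; lia.
Qed.

Lemma bdefect_linear k m n : linear (bdefect k m n).
Proof.
have l1 : linear (iprod k m n).
  apply: S_linear => [j|x]; last exact: evz_iprod.
  by move=> z u v; rewrite npr; lmod (R[i]).
have l2 a' b' m' n' : linear (tprod k a' b' m' n').
  apply: S_linear => [j|x]; last exact: evz_tprod.
  by move=> z u v; rewrite !npr; lmod (R[i]).
by move=> z u v; rewrite /bdefect l1 !l2; lmod (R[i]).
Qed.

End Fixed.

Lemma sgn_addb (p q r : bool) : sgn (p (+) q) r = sgn p r * sgn q r :> K.
Proof. by rewrite /sgn -signr_addb; case: p; case: q; case: r. Qed.

Section Kills.
Context (N : nat) (r s : bool) (c : V).

(** Locality of a series phi(z, w) of operators, with coefficients phi m n, and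
    a field c(u): (z - u)^N (w - u)^N [phi(z, w), c(u)] = 0. *)
Definition kills (phi : int -> int -> V -> V) := forall m n l d,
  \sum_(i < N.+1) \sum_(j < N.+1)
    (((-1) ^+ i * 'C(N, i)%:R) * ((-1) ^+ j * 'C(N, j)%:R)) *:
    (phi (m + (N - i)%N) (n + (N - j)%N) (c _(l + i%:Z + j%:Z) d)
     - sgn s r *: (c _(l + i%:Z + j%:Z) (phi (m + (N - i)%N) (n + (N - j)%N) d))) = 0.

Lemma kills_ext phi psi : (forall m n d, phi m n d = psi m n d) -> kills phi -> kills psi.
Proof.
move=> e h m n l d; rewrite -[RHS](h m n l d).
by apply: eq_bigr => i _; apply: eq_bigr => j _; rewrite !e.
Qed.

Lemma kills_shift t u phi : kills phi -> kills (fun m n => phi (m + t) (n + u)).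
Proof.
move=> h m n l d; rewrite -[RHS](h (m + t) (n + u) l d).
apply: eq_bigr => i _; apply: eq_bigr => j _.
by rewrite (addrAC m) (addrAC n).
Qed.

Lemma kills_swap phi : kills phi -> kills (fun m n => phi n m).
Proof.
move=> h m n l d; rewrite -[RHS](h n m l d) exchange_big /=.
apply: eq_bigr => i _; apply: eq_bigr => j _.
by rewrite [l + _ + _]addrAC mulrC.
Qed.

Lemma killsB phi psi : kills phi -> kills psi -> kills (fun m n d => phi m n d - psi m n d).
Proof.
move=> h1 h2 m n l d; rewrite -[RHS]subr0 -[X in X - _](h1 m n l d).
rewrite -[X in _ - X](h2 m n l d) -sumrB; apply: eq_bigr => i _.
rewrite -sumrB; apply: eq_bigr => j _; rewrite (linB (npr _ _)).
lmod (R[i]).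
Qed.

Lemma killsZ e phi : kills phi -> kills (fun m n d => e *: phi m n d).
Proof.
move=> h m n l d; have := congr1 (fun x => e *: x) (h m n l d).
rewrite /= scaler0 => h'; rewrite -[RHS]h' scaler_sumr.
apply: eq_bigr => i _; rewrite scaler_sumr; apply: eq_bigr => j _.
by rewrite (linZ (npr _ _)); lmod (R[i]).
Qed.

Lemma killsS (phi : nat -> int -> int -> V -> V) : (forall j, kills (phi j)) ->
  (forall m n d, evz (fun j => phi j m n d)) -> kills (fun m n d => \S_ j phi j m n d).
Proof.
move=> h e m n l d.
pose F i j t := (((-1) ^+ i * 'C(N, i)%:R) * ((-1) ^+ j * 'C(N, j)%:R)) *:
    (phi t (m + (N - i)%N) (n + (N - j)%N) (c _(l + i%:Z + j%:Z) d)
     - sgn s r *: (c _(l + i%:Z + j%:Z) (phi t (m + (N - i)%N) (n + (N - j)%N) d))).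
have eF i j : evz (F i j).
  apply: evzZ; apply: evzD; first exact: e.
  by apply: evzN; apply: evzZ; apply: (evz_lin (npr _ _)); apply: e.
transitivity (\sum_(i < N.+1) \sum_(j < N.+1) \S_ t F i j t).
  apply: eq_bigr => i _; apply: eq_bigr => j _; rewrite /F.
  have e1 := e (m + (N - i)%N) (n + (N - j)%N) (c _(l + i%:Z + j%:Z) d).
  have e2 := evz_lin (npr (l + i%:Z + j%:Z) c) (e (m + (N - i)%N) (n + (N - j)%N) d).
  have e3 := evzZ (fun=> sgn s r) e2.
  have e4 : evz (fun t => phi t (m + (N - i)%N) (n + (N - j)%N) (c _(l + i%:Z + j%:Z) d)
    - sgn s r *: (c _(l + i%:Z + j%:Z) (phi t (m + (N - i)%N) (n + (N - j)%N) d))).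
    exact: (evzD e1 (evzN e3)).
  symmetry; apply: (etrans (SZ _ e4)); congr (_ *: _).
  apply: (etrans (SB e1 e3)); congr (_ - _).
  apply: (etrans (SZ _ e2)); congr (_ *: _); symmetry.
  by apply: S_lin; [exact: npr|exact: e].
under eq_bigr => i _ do rewrite -(S_bigsum _ (eF i)).
rewrite -(@S_bigsum _ _ _ (fun i t => \sum_(j < N.+1) F i j t)); last first.
  by move=> i; apply: evz_bigsum.
by apply: S_eq0 => t; apply: h.
Qed.

End Kills.

Section Fixed2.
Context (p q r : bool) (a b c : V).
Context (rc : vpar VA r c).

(** Commute c(u) past b(w), using the factor (w - u)^N, and then past a(z), using
    (z - u)^N. *)
Lemma kills_tens : vpar VA p a -> vpar VA q b -> exists N0, forall N, (N0 <= N)%N ->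
  kills N r (p (+) q) c (fun m n d => a _(m) (b _(n) d)).
Proof.
move=> pa qb; have [N1 h1] := loc_np pa rc; have [N2 h2] := loc_np qb rc.
exists (maxn N1 N2) => N; rewrite geq_max => /andP[/h1{}h1 /h2{}h2] m n l d.
pose e i : K := (-1) ^+ i * 'C(N, i)%:R.
transitivity (\sum_(i < N.+1) e i *: (a _(m + (N - i)%N)
    \sum_(j < N.+1) e j *: (b _(n + (N - j)%N) (c _(l + i%:Z + j%:Z) d)
       - sgn q r *: (c _(l + i%:Z + j%:Z) (b _(n + (N - j)%N) d))))
  + sgn q r *: \sum_(j < N.+1) e j *: \sum_(i < N.+1) e i *:
      (a _(m + (N - i)%N) (c _(l + j%:Z + i%:Z) (b _(n + (N - j)%N) d))
       - sgn p r *: (c _(l + j%:Z + i%:Z) (a _(m + (N - i)%N) (b _(n + (N - j)%N) d))))).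
  under [X in _ + _ *: X]eq_bigr => j _ do rewrite scaler_sumr.
  rewrite [X in _ + _ *: X]exchange_big scaler_sumr -big_split; apply: eq_bigr => i _ /=.
  rewrite (lin_sum (npr _ _)) !scaler_sumr -big_split; apply: eq_bigr => j _ /=.
  rewrite (linZ (npr _ _)) (linB (npr _ _)) (linZ (npr _ _)).
  have -> : l + i%:Z + j%:Z = l + j%:Z + i%:Z by rewrite addrAC.
  by rewrite sgn_addb /e; lmod (R[i]).
rewrite big1 ?add0r => [|i _]; last by rewrite h2 np0r scaler0.
by rewrite big1 ?scaler0// => j _; rewrite h1 scaler0.
Qed.

(** Here y = a_(k)b is local with c(u) by the axioms, and (w - u)^N alone
    suffices; f and t are the binomial coefficient and the index shift of the
    terms of [iprod]. *)
Lemma kills_iter (f : int -> K) (t : int) y : vpar VA (p (+) q) y ->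
  exists N0, forall N, (N0 <= N)%N ->
  kills N r (p (+) q) c (fun m n d => f m *: (y _(m + n + t) d)).
Proof.
move=> py; have [N1 h1] := loc_np py rc.
exists N1 => N /h1{}h1 m n l d; rewrite big1// => i _.
pose e j : K := (-1) ^+ j * 'C(N, j)%:R.
transitivity ((e i * f (m + (N - i)%N)) *: \sum_(j < N.+1) e j *:
   (y _(m + (N - i)%N + n + t + (N - j)%N) (c _(l + i%:Z + j%:Z) d) -
    sgn (p (+) q) r *: (c _(l + i%:Z + j%:Z) (y _(m + (N - i)%N + n + t + (N - j)%N) d)))).
  rewrite scaler_sumr; apply: eq_bigr => j _.
  rewrite (linZ (npr _ _)) /e.
  have -> : m + (N - i)%N + (n + (N - j)%N) + t = m + (N - i)%N + n + t + (N - j)%N.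
    by rewrite !addrA [RHS]addrAC.
  lmod (R[i]).
by rewrite h1 scaler0.
Qed.

End Fixed2.

Lemma vpar_span v : v \in lspan (\bigcup_(p in [set: bool]) vpar VA p).
Proof. by have [_ h _] := vpar_direct VA; apply: h. Qed.

(** The series X is local with c(u) for each c, so X c(u) vac can be computed up
    to a factor as c(u) X vac = 0.  Taking the constant term in u gives X c = 0. *)
Lemma bdefect0 p q a b k m n c : vpar VA p a -> vpar VA q b ->
  bdefect p q a b k m n c = 0.
Proof.
move=> pa qb; have lb := bdefect_linear p q a b k m n.
move: c (vpar_span c); apply: lspan_ind; first exact: lin0 lb.
move=> z c v [r _ rc] hv; rewrite lb hv addr0; apply/eqP; rewrite scaler_eq0; apply/orP; right.
have [N1 h1] := kills_tens rc pa qb.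
have [N2 h2] := kills_tens rc qb pa.
have [J hJ] : exists J : nat, forall j : nat, (J <= j)%N -> a _(k + j%:Z) b = 0.
  by have [J] := evz_np k a b; exists J.
have [N3 h3] : exists N0, forall N, (N0 <= N)%N -> forall j : nat,
   kills N r (p (+) q) c (fun m n d => gbinom m%:~R j *: ((a _(k + j%:Z) b) _(m + n - j%:Z) d)).
  elim: J hJ => [|J IH] hJ.
    exists 0%N => N _ j m' n' l d; rewrite big1// => i _; rewrite big1// => j' _.
    by rewrite hJ// !np0l !scaler0 np0r !scaler0 subrr scaler0.
  have py : vpar VA (p (+) q) (a _(k + J%:Z) b) by apply: vpar_nprod.
  have [N0 hN0] := kills_iter rc (fun m => gbinom m%:~R J) (- J%:Z) py.
  have [N4 hN4] : exists N4, forall N, (N4 <= N)%N -> forall j : nat, (j < J)%N ->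
      kills N r (p (+) q) c
        (fun m n d => gbinom m%:~R j *: ((a _(k + j%:Z) b) _(m + n - j%:Z) d)).
    elim: (J) => [|J' [N5 h5]]; first by exists 0%N.
    have py' : vpar VA (p (+) q) (a _(k + J'%:Z) b) by apply: vpar_nprod.
    have [N6 h6] := kills_iter rc (fun m => gbinom m%:~R J') (- J'%:Z) py'.
    exists (maxn N5 N6) => N; rewrite geq_max => /andP[n5 n6] j.
    by rewrite ltnS leq_eqVlt => /orP[/eqP ->|]; [exact: h6|exact: h5].
  exists (maxn N0 N4) => N; rewrite geq_max => /andP[n0 n4] j.
  have [/hN4 h|Jj] := ltnP j J; first exact: h.
  move: Jj; rewrite leq_eqVlt => /orP[/eqP <-|Jj]; first exact: hN0.
  move=> m' n' l d; rewrite big1// => i _; rewrite big1// => j' _.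
  by rewrite hJ// !np0l !scaler0 np0r !scaler0 subrr scaler0.
pose N := maxn N1 (maxn N2 N3).
have {}h1 := h1 N (leq_maxl _ _).
have {}h2 : kills N r (p (+) q) c (fun m n d => b _(n) (a _(m) d)).
  rewrite [p (+) q]addbC; apply: (kills_swap (phi := fun m n d => b _(m) (a _(n) d))).
  by apply: h2; rewrite leq_max leq_maxl orbT.
have {}h3 := h3 N; rewrite /N !leq_max leqnn !orbT in h3; move: h3 => /(_ isT) h3.
have hk : kills N r (p (+) q) c (fun m n d => bdefect p q a b k m n d).
  apply: killsB; last apply: killsB.
  - by apply: killsS => // m' n' d; exact: evz_iprod.
  - apply: killsS => [j|m' n' d]; last exact: evz_tprod.
    apply: killsZ; have := kills_shift (k - j%:Z) j%:Z h1.
    by apply: kills_ext => m' n' d; rewrite addrA.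
  - apply: killsZ; apply: killsS => [j|m' n' d]; last exact: evz_tprod.
    apply: killsZ; have := kills_shift j%:Z (k - j%:Z) h2.
    by apply: kills_ext => m' n' d; rewrite addrA.
have lb' m' n' := lin0 (bdefect_linear p q a b k m' n').
(* In this coefficient only i = j = 0 contributes, where c_(-1)vac = c: the other
   terms contain c_(n)vac with n >= 0. *)
have := hk (m - N%:Z) (n - N%:Z) (-1) (vac VA).
rewrite big_ord_recl big_ord_recl !bin0 expr0 mulr1 mul1r scale1r /=.
rewrite bdefect_vac// np0r scaler0 subr0 !addr0 nprod_vac subn0 !subrK.
rewrite [X in _ + X + _]big1 ?[X in _ + X]big1 ?addr0 => [->//|i _|j _].
- rewrite big1// => j _.
  by rewrite bdefect_vac// np0r scaler0 subr0 (@vac_nat (_ + _)) ?lb' ?scaler0//; lia.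
- by rewrite bdefect_vac// np0r scaler0 subr0 (@vac_nat (_ + _)) ?lb' ?scaler0//; lia.
Qed.

Theorem borcherds p q a b k m n c : vpar VA p a -> vpar VA q b ->
  \S_ j (gbinom m%:~R j *: ((a _(k + j%:Z) b) _(m + n - j%:Z) c)) =
  tprod k a b m n c - ((-1) ^+ absz k * sgn p q) *: tprod k b a n m c.
Proof.
by move=> pa qb; apply/eqP; rewrite -subr_eq0; apply/eqP/bdefect0.
Qed.

End Borcherds.

(** * The products a *_n b and the twisted Borcherds identity *)

Lemma S_cauchy (K : fieldType) (W : lmodType K) M (F : nat -> nat -> W) :
  (forall t i, (M <= t + i)%N -> F t i = 0) ->
  \S_ t \S_ i F t i = \S_ k \sum_(t < k.+1) F t (k - t)%N.
Proof.
elim: M F => [|M IH] F FM.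
  by rewrite !S_eq0// => k; rewrite ?S_eq0 ?big1// => *; apply: FM.
have e1 : evz (fun t => \S_ i F t i).
  by exists M.+1 => t Mt; apply: S_eq0 => i; rewrite FM// (leq_trans Mt)// leq_addr.
rewrite (S_recl e1) (IH (fun t i => F t.+1 i)); last first.
  by move=> t i Mt; apply: FM; rewrite addSn.
have e2 : evz (F 0%N) by exists M.+1 => i Mi; apply: FM.
pose G k := \sum_(t < k) F t.+1 (k - t.+1)%N.
have e3 : evz G.
  exists M.+1 => k Mk; apply: big1 => t _; apply: FM.
  by rewrite subnKC// ltn_ord.
rewrite (S_eq (F := fun k => \sum_(t < k.+1) F t (k - t)%N) (G := fun k => F 0%N k + G k)).
  by rewrite (SD e2 e3); congr (_ + _); rewrite (S_recl e3) /G big_ord0 add0r.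
by move=> k; rewrite big_ord_recl subn0.
Qed.

Lemma SZ_exch (K : fieldType) (W : lmodType K) (c : nat -> K) (F : nat -> nat -> W) :
  (exists J, forall j, (J <= j)%N -> forall p, F p j = 0) ->
  (forall j, evz (fun p => c p *: F p j)) ->
  \S_ p (c p *: \S_ j F p j) = \S_ j \S_ p (c p *: F p j).
Proof.
move=> [J FJ] eF; rewrite -S_exch//; last first.
  by exists J => j /FJ Fj p; rewrite Fj scaler0.
by apply: S_eq => p; rewrite SZ//; exists J => j /FJ.
Qed.

Lemma evz_exch (K : fieldType) (W : lmodType K) (c : nat -> K) (F : nat -> nat -> W) :
  (exists J, forall j, (J <= j)%N -> forall p, F p j = 0) ->
  (forall j, evz (fun p => c p *: F p j)) ->
  evz (fun p => c p *: \S_ j F p j).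
Proof.
move=> [J FJ] eF.
have e1 : exists J, forall j, (J <= j)%N -> forall p, c p *: F p j = 0.
  by exists J => j /FJ Fj p; rewrite Fj scaler0.
have [M h] := evz_S e1 eF; exists M => p /h; rewrite SZ//.
by exists J => j /FJ.
Qed.

Lemma S_single (K : fieldType) (W : lmodType K) j0 (F : nat -> W) :
  (forall j, j != j0 -> F j = 0) -> \S_ j F j = F j0.
Proof.
move=> h; rewrite (@S_trunc _ _ j0.+1) => [|j jj]; last first.
  by apply: h; rewrite gtn_eqF.
rewrite big_ord_recr /= big1 ?add0r// => i _; apply: h.
by rewrite ltn_eqF.
Qed.

Section StarProducts.
Context {R : realType} {V : lmodType R[i]} (VA : vertexSuperalgebra V).
Local Notation "a _( n ) b" := (nprod VA n a b)
  (at level 35, n at level 200, b at level 35).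
Local Notation K := (R[i]).
Local Notation star := (starn VA).
Implicit Types (a b c d : V) (k m n l : int) (x y : R).

Lemma evz_gb (f : nat -> K) n a b : evz (fun j => f j *: (a _(n + j%:Z) b)).
Proof. exact/evzZ/evz_np. Qed.

Lemma star_l n x b : linear (star n x ^~ b).
Proof.
apply: S_linear => [j|a]; last exact: evz_gb.
by move=> z u v; rewrite npl; lmod (R[i]).
Qed.

Lemma star_r n x a : linear (star n x a).
Proof.
apply: S_linear => [j|b]; last exact: evz_gb.
by move=> z u v; rewrite npr; lmod (R[i]).
Qed.

Lemma star_large a b : exists N, forall n, N <= n -> forall x, star n x a b = 0.
Proof.
have [N h] := nprod_field VA a b; exists N => n Nn x; apply: S_eq0 => j.
by rewrite h ?scaler0//; lia.
Qed.

Lemma evz_star (f : nat -> K) (y : nat -> R) n a b :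
  evz (fun j => f j *: star (n + j%:Z) (y j) a b).
Proof.
by have [N h] := star_large a b; exists (absz (N - n)%R) => j Nj; rewrite h ?scaler0//; lia.
Qed.

(** This is (1+z)^(x+y) = (1+z)^x (1+z)^y.  The exponent of a product can thus be
    raised at the cost of products with larger indices. *)
Lemma star_shift n x y a b :
  star n (x + y) a b = \S_ t (gbinom y t *: star (n + t%:Z) x a b).
Proof.
have [N hN] := nprod_field VA a b.
pose F t i := (gbinom y t * gbinom x i) *: (a _(n + t%:Z + i%:Z) b).
rewrite (S_eq (G := fun t => \S_ i F t i)); last first.
  by move=> t; rewrite -SZ; [apply: S_eq => i; rewrite scalerA|exact: evz_gb].
rewrite (@S_cauchy _ _ (absz (N - n))); last first.
  by move=> t i h; rewrite /F hN ?scaler0//; lia.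
apply: S_eq => k; rewrite addrC gb_vander scaler_suml; apply: eq_bigr => t _.
rewrite /F; congr (_ *: _); apply: npE; have := ltn_ord t; lia.
Qed.

Lemma star0 n a b : star n 0 a b = a _(n) b.
Proof.
rewrite /starn (@S_trunc _ _ 1) => [|[//|j] _]; last by rewrite gb00 scale0r.
by rewrite big_ord1 gb0 scale1r addr0.
Qed.

Lemma star_vacr x a : star (-1) x a (vac VA) = a.
Proof.
rewrite /starn (@S_trunc _ _ 1) => [|[//|j] _].
  by rewrite big_ord1 gb0 scale1r addr0 nprod_vac.
by rewrite vac_nat ?scaler0//; lia.
Qed.

Lemma star_vacl n b : star n 0 (vac VA) b = if n == -1 then b else 0.
Proof. by rewrite star0 vac_nprod. Qed.

(** The Borcherds identity for a_(-2)vac, which is the derivative of a. *)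
Lemma der_npl n a b : (der VA a) _(n) b = - n%:~R *: (a _(n - 1) b).
Proof.
have d : der VA a = a _(-2) vac VA.
  have := translation VA (-1) a (vac VA).
  rewrite der_vac np0r subr0 nprod_vac => ->.
  by rewrite rmorphN rmorph1 scaleN1r opprK.
rewrite d; apply/eqP; rewrite -subr_eq0; apply/eqP.
pose f a := (a _(-2) vac VA) _(n) b - (- n%:~R *: (a _(n - 1) b)).
have lf : linear f by move=> z u v; rewrite /f !npl; lmod (R[i]).
move: a {d} (vpar_span VA a); apply: (lspan_ind (P := fun a => f a = 0)).
  exact: lin0 lf.
move=> z a v [p _ pa] fv; rewrite lf fv addr0 /f.
have := borcherds (-2) 0 n b pa (vpar_vac VA).
rewrite -[LHS]/(iprod VA a (vac VA) (-2) 0 n b) iprod0 => ->.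
have g2 j : (-1) ^+ j * gbinom (-2%:R : R) j = j.+1%:R :> K.
  elim: j => [|j IH]; first by rewrite gb0 expr0 mulr1.
  have j0 : j.+1%:R != 0 :> K by rewrite pnatr_eq0.
  apply: (mulfI j0); rewrite mulrCA gbS exprS CB Cnat.
  rewrite (_ : real_complex R (-2%:R) = - 2%:R); last by rewrite -Cnat rmorphN.
  transitivity (- (- 2%:R - j%:R) * ((-1) ^+ j * gbinom (- 2%:R : R) j) : K); first by ring.
  by rewrite IH -![j.+2%:R]natr1 -!natr1; ring.
rewrite /tprod.
have T1 : \S_ j ((-1) ^+ j * gbinom ((-2)%:~R : R) j) *:
    (a _( 0 + -2 - j%:Z) (vac VA _( n + j%:Z) b)) =
    if n < 0 then - n%:~R *: (a _(n - 1) b) else 0.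
  have [n0|n0] := ltP n 0; last first.
    by apply: S_eq0 => j; rewrite vac_nprod ifN ?np0r ?scaler0//; lia.
  rewrite (@S_single _ _ (absz n).-1) => [|j nj]; last first.
    by rewrite vac_nprod ifN ?np0r ?scaler0//; lia.
  rewrite vac_nprod ifT; last by lia.
  rewrite (_ : (-2)%:~R = - 2%:R :> R) ?rmorphN// g2.
  rewrite (_ : 0 + -2 - (absz n).-1%:Z = n - 1); last by lia.
  congr (_ *: _); have h : n = - (absz n).-1.+1%:Z by lia.
  by rewrite [in RHS]h mulrNz opprK.
have T2 : \S_ j ((-1) ^+ j * gbinom ((-2)%:~R : R) j) *:
    (vac VA _( n + -2 - j%:Z) (a _( 0 + j%:Z) b)) =
    if 0 < n then n%:~R *: (a _(n - 1) b) else 0.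
  have [n0|n0] := ltP 0 n; last first.
    by apply: S_eq0 => j; rewrite vac_nprod ifN ?scaler0//; lia.
  rewrite (@S_single _ _ (absz n).-1) => [|j nj]; last first.
    by rewrite vac_nprod ifN ?scaler0//; lia.
  rewrite vac_nprod ifT; last by lia.
  rewrite (_ : (-2)%:~R = - 2%:R :> R) ?rmorphN// g2.
  rewrite (_ : 0 + (absz n).-1%:Z = n - 1); last by lia.
  congr (_ *: _); have {2}-> : n = (absz n).-1.+1%:Z by lia.
  by [].
rewrite T1 T2 /sgn andbF expr0 mulr1 /= sqrrN expr1n scale1r.
case: (ltgtP n 0) => [n0|n0|->].
- by rewrite subr0 subrr scaler0.
- by rewrite sub0r scaleNr opprK addNr scaler0.
- by rewrite mulr0z !oppr0 scale0r oppr0 !addr0 scaler0.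
Qed.

(** Integration by parts in the residue of z^n (1+z)^(x+1) (da/dz). *)
Lemma star_der n x a b :
  star n (x + 1) (der VA a) b = - n%:~R *: star (n - 1) x a b
    - real_complex R (n%:~R + x + 1) *: star n x a b.
Proof.
pose L j := gbinom (x + 1) j *: ((der VA a) _(n + j%:Z) b).
pose F j := gbinom x j *: (a _(n - 1 + j%:Z) b).
pose G j := gbinom x j *: (a _(n + j%:Z) b).
have eL : evz L by apply: evz_gb.
have eF : evz (fun j => - n%:~R *: F j) by apply: evzZ; apply: evz_gb.
have eG : evz (fun j => real_complex R (n%:~R + x + 1) *: G j) by apply/evzZ/evz_gb.
rewrite /starn -(SZ _ (evz_gb _ _ _ _)) -(SZ _ (evz_gb _ _ _ _)).
rewrite -/(L _) (S_recl eL) (S_recl eF) -addrA -(SB (evzS eF) eG).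
congr (_ + _).
  by rewrite /L /F !gb0 der_npl !addr0 !scale1r.
apply: S_eq => j; rewrite /L /F /G der_npl gb_pascal.
rewrite (@npE _ _ _ (n + j.+1%:Z - 1) (n + j%:Z)); last by lia.
rewrite (@npE _ _ _ (n - 1 + j.+1%:Z) (n + j%:Z)); last by lia.
rewrite !scalerA -scalerBl; congr (_ *: _).
have := gb_absorb x j; rewrite gb_pascal !CD Cint => e1.
have -> : (n + j.+1%:Z)%:~R = n%:~R + j.+1%:R :> K by rewrite rmorphD.
transitivity (- n%:~R * (gbinom x j.+1 + gbinom x j) -
  (j.+1%:R * (gbinom x j.+1 + gbinom x j)) : K); first by ring.
rewrite e1; ring.
Qed.

Section Twisted.
Context (p q : bool) (a b : V) (pa : vpar VA p a) (qb : vpar VA q b).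
Implicit Type e : V.

(** The Borcherds identity multiplied by (1+z)^x.  On the left, where the
    expansion is in z - w, one writes 1+z = (1+w) + (z-w) and z = w + (z-w): the
    index j counts the powers of z - w taken from (1+z)^x and i - j those taken
    from z^m. *)
Lemma twist_left x k m n c :
  \S_ i \sum_(j < i.+1) (gbinom m%:~R (i - j) * gbinom x j) *:
     star (m + n - i%:Z + j%:Z) (x - j%:R) (a _(k + i%:Z) b) c =
  \S_ j (((-1) ^+ j * gbinom k%:~R j) *: star (m + k - j%:Z) x a (b _(n + j%:Z) c))
  - ((-1) ^+ absz k * sgn p q) *:
    \S_ j (((-1) ^+ j * gbinom k%:~R j) *: (b _(n + k - j%:Z) (star (m + j%:Z) x a c))).
Proof.
pose y i l := (a _(k + i%:Z) b) _(l) c.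
have E0 t : \S_ i (gbinom (m + t%:Z)%:~R i *: y i (m + t%:Z + n - i%:Z)) =
    tprod VA k a b (m + t%:Z) n c -
    ((-1) ^+ absz k * sgn p q) *: tprod VA k b a n (m + t%:Z) c.
  exact: (borcherds k (m + t%:Z) n c pa qb).
have : \S_ t (gbinom x t *: \S_ i (gbinom (m + t%:Z)%:~R i *: y i (m + t%:Z + n - i%:Z))) =
   \S_ t (gbinom x t *: (tprod VA k a b (m + t%:Z) n c -
    ((-1) ^+ absz k * sgn p q) *: tprod VA k b a n (m + t%:Z) c)).
  by apply: S_eq => t; rewrite E0.
have [N hN] := nprod_field VA a b.
rewrite SZ_exch; last 2 first.
- exists (absz (N - k)%R) => i Ni t; rewrite /y hN ?np0l ?scaler0//; lia.
- move=> i; apply: evzZ.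
  have [L hL] := nprod_field VA (a _(k + i%:Z) b) c.
  exists (absz (L - (m + n - i%:Z))%R) => t Lt; rewrite /y hL ?scaler0//; lia.
have -> : \S_ i \S_ t (gbinom x t *: (gbinom (m + t%:Z)%:~R i *: y i (m + t%:Z + n - i%:Z))) =
   \S_ i \sum_(j < i.+1) (gbinom m%:~R (i - j) * gbinom x j) *:
     star (m + n - i%:Z + j%:Z) (x - j%:R) (a _(k + i%:Z) b) c.
  apply: S_eq => i.
  pose F j t := (gbinom m%:~R (i - j) * gbinom x t * 'C(t, j)%:R) *: y i (m + n - i%:Z + t%:Z).
  have eF j : evz (F j) by apply: evz_gb.
  rewrite (S_eq (G := fun t => \sum_(j < i.+1) F j t)).
    rewrite S_bigsum//; apply: eq_bigr => j _.
    rewrite (S_split j (eF j)) big1 ?add0r; last first.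
      by move=> t _; rewrite /F bin_small ?mulr0 ?scale0r//; apply: ltn_ord.
    rewrite /starn -SZ; last exact: evz_gb.
    apply: S_eq => t; rewrite /F -mulrA gb_trin scalerA mulrA; congr (_ *: _).
    by congr nprod; rewrite PoszD addrA.
  move=> t; rewrite rmorphD /= (_ : (t%:Z)%:~R = t%:R :> R)// gb_addn scalerA mulr_sumr scaler_suml.
  apply: eq_bigr => j _; rewrite /F; congr (_ *: _); first by ring.
  by rewrite /y; congr nprod; lia.
move=> ->.
have eT1 j : evz (fun t => gbinom x t *: (((-1) ^+ j * gbinom k%:~R j) *:
     (a _(m + t%:Z + k - j%:Z) (b _(n + j%:Z) c)))).
  apply: evzZ; apply: evzZ.
  have [L hL] := nprod_field VA a (b _(n + j%:Z) c).
  by exists (absz (L - (m + k - j%:Z))%R) => t Lt; rewrite hL//; lia.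
have eT2 j : evz (fun t => gbinom x t *: (((-1) ^+ j * gbinom k%:~R j) *:
     (b _(n + k - j%:Z) (a _(m + t%:Z + j%:Z) c)))).
  apply: evzZ; apply: evzZ; apply: (evz_lin (npr _ _ _)).
  have [L hL] := nprod_field VA a c.
  by exists (absz (L - (m + j%:Z))%R) => t Lt; rewrite hL//; lia.
have b1 : exists J, forall j, (J <= j)%N -> forall t : nat, ((-1) ^+ j * gbinom k%:~R j) *:
     (a _(m + t%:Z + k - j%:Z) (b _(n + j%:Z) c)) = 0.
  have [L hL] := nprod_field VA b c.
  by exists (absz (L - n)%R) => j Lj t; rewrite hL ?np0r ?scaler0//; lia.
have b2 : exists J, forall j, (J <= j)%N -> forall t : nat, ((-1) ^+ j * gbinom k%:~R j) *:
     (b _(n + k - j%:Z) (a _(m + t%:Z + j%:Z) c)) = 0.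
  have [L hL] := nprod_field VA a c.
  by exists (absz (L - m)%R) => j Lj t; rewrite hL ?np0r ?scaler0//; lia.
rewrite (S_eq (G := fun t => gbinom x t *: tprod VA k a b (m + t%:Z) n c -
   (((-1) ^+ absz k * sgn p q) *: (gbinom x t *: tprod VA k b a n (m + t%:Z) c)))); last first.
  by move=> t; lmod (R[i]).
have e1 := evz_exch b1 eT1.
have e2 := evz_exch b2 eT2.
rewrite /tprod; apply: (etrans (SB e1 (evzZ (fun=> _) e2))).
congr (_ - _); last (apply: (etrans (SZ _ e2)); congr (_ *: _)).
  apply: (etrans (SZ_exch b1 eT1)); apply: S_eq => j; rewrite /starn -SZ; last exact: evz_gb.
  apply: S_eq => t; rewrite (@npE _ _ _ (m + t%:Z + k - j%:Z) (m + k - j%:Z + t%:Z)).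
    by lmod (R[i]).
  by lia.
apply: (etrans (SZ_exch b2 eT2)); apply: S_eq => j.
have e3 : evz (fun t => gbinom x t *: (a _(m + j%:Z + t%:Z) c)) by apply: evz_gb.
rewrite /starn (S_lin (npr _ _ _) e3) -(SZ _ (evz_lin (npr _ _ _) e3)).
apply: S_eq => t; rewrite (linZ (npr _ _ _)) (@npE _ _ _ (m + t%:Z + j%:Z) (m + j%:Z + t%:Z)).
  by lmod (R[i]).
by lia.
Qed.

(** The identity [twist_left] multiplied by (1+w)^y. *)
Theorem twisted_borcherds x y k m n c :
  \S_ i \sum_(j < i.+1) (gbinom m%:~R (i - j) * gbinom x j) *:
     star (m + n - i%:Z + j%:Z) (x + y - j%:R) (a _(k + i%:Z) b) c =
  \S_ j (((-1) ^+ j * gbinom k%:~R j) *: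
           star (m + k - j%:Z) x a (star (n + j%:Z) y b c))
  - ((-1) ^+ absz k * sgn p q) *:
    \S_ j (((-1) ^+ j * gbinom k%:~R j) *:
           star (n + k - j%:Z) y b (star (m + j%:Z) x a c)).
Proof.
have : \S_ t (gbinom y t *: \S_ i \sum_(j < i.+1) (gbinom m%:~R (i - j) * gbinom x j) *:
     star (m + (n + t%:Z) - i%:Z + j%:Z) (x - j%:R) (a _(k + i%:Z) b) c) =
  \S_ t ((gbinom y t *: \S_ j (((-1) ^+ j * gbinom k%:~R j) *:
     star (m + k - j%:Z) x a (b _(n + t%:Z + j%:Z) c)))
  - ((-1) ^+ absz k * sgn p q) *: (gbinom y t *:
    \S_ j (((-1) ^+ j * gbinom k%:~R j) *:
      (b _(n + t%:Z + k - j%:Z) (star (m + j%:Z) x a c))))).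
  by apply: S_eq => t; rewrite twist_left; lmod (R[i]).
have [N hN] := nprod_field VA a b.
have lstar i := star_l _ _ c.
rewrite SZ_exch; last 2 first.
- exists (absz (N - k)%R) => i Ni t; rewrite big1// => j _.
  by rewrite hN ?(lin0 (star_l _ _ _)) ?scaler0//; lia.
- move=> i; apply: evzZ.
  apply: (evz_bigsum i.+1 (F := fun j t => (gbinom m%:~R (i - j) * gbinom x j) *:
     star (m + (n + t%:Z) - i%:Z + j%:Z) (x - j%:R) (a _(k + i%:Z) b) c)) => j.
  apply: evzZ.
  have [L hL] := star_large (a _(k + i%:Z) b) c.
  by exists (absz (L - (m + n - i%:Z + j%:Z))%R) => t Lt; rewrite hL//; lia.
have -> : \S_ i \S_ t (gbinom y t *: \sum_(j < i.+1) (gbinom m%:~R (i - j) * gbinom x j) *: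
     star (m + (n + t%:Z) - i%:Z + j%:Z) (x - j%:R) (a _(k + i%:Z) b) c) =
  \S_ i \sum_(j < i.+1) (gbinom m%:~R (i - j) * gbinom x j) *:
     star (m + n - i%:Z + j%:Z) (x + y - j%:R) (a _(k + i%:Z) b) c.
  apply: S_eq => i.
  pose F j t := (gbinom m%:~R (i - j) * gbinom x j) *: (gbinom y t *:
    star (m + n - i%:Z + j%:Z + t%:Z) (x - j%:R) (a _(k + i%:Z) b) c).
  have eF j : evz (F j) by apply/evzZ/evz_star.
  rewrite (S_eq (G := fun t => \sum_(j < i.+1) F j t)).
    rewrite S_bigsum//; apply: eq_bigr => j _; rewrite /F.
    rewrite (SZ _ (evz_star _ _ _ _ _)); congr (_ *: _).
    by rewrite -star_shift; congr starn; rewrite addrAC.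
  move=> t; rewrite scaler_sumr; apply: eq_bigr => j _; rewrite /F.
  rewrite (_ : m + (n + t%:Z) - i%:Z + j%:Z = m + n - i%:Z + j%:Z + t%:Z); last by lia.
  by lmod (R[i]).
move=> ->.
have eT1 j : evz (fun t => gbinom y t *: (((-1) ^+ j * gbinom k%:~R j) *:
     star (m + k - j%:Z) x a (b _(n + t%:Z + j%:Z) c))).
  apply: evzZ; apply: evzZ; apply: (evz_lin (star_r _ _ _)).
  have [L hL] := nprod_field VA b c.
  by exists (absz (L - (n + j%:Z))%R) => t Lt; rewrite hL//; lia.
have eT2 j : evz (fun t => gbinom y t *: (((-1) ^+ j * gbinom k%:~R j) *:
     (b _(n + t%:Z + k - j%:Z) (star (m + j%:Z) x a c)))).
  apply: evzZ; apply: evzZ.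
  have [L hL] := nprod_field VA b (star (m + j%:Z) x a c).
  by exists (absz (L - (n + k - j%:Z))%R) => t Lt; rewrite hL//; lia.
have b1 : exists J, forall j, (J <= j)%N -> forall t : nat, ((-1) ^+ j * gbinom k%:~R j) *:
     star (m + k - j%:Z) x a (b _(n + t%:Z + j%:Z) c) = 0.
  have [L hL] := nprod_field VA b c.
  by exists (absz (L - n)%R) => j Lj t; rewrite hL ?(lin0 (star_r _ _ _)) ?scaler0//; lia.
have b2 : exists J, forall j, (J <= j)%N -> forall t : nat, ((-1) ^+ j * gbinom k%:~R j) *:
     (b _(n + t%:Z + k - j%:Z) (star (m + j%:Z) x a c)) = 0.
  have [L hL] := star_large a c.
  by exists (absz (L - m)%R) => j Lj t; rewrite hL ?np0r ?scaler0//; lia.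
have e1 := evz_exch b1 eT1.
have e2 := evz_exch b2 eT2.
apply: (etrans (SB e1 (evzZ (fun=> _) e2))).
congr (_ - _); last (apply: (etrans (SZ _ e2)); congr (_ *: _)).
  apply: (etrans (SZ_exch b1 eT1)); apply: S_eq => j.
  have e3 : evz (fun t => gbinom y t *: (b _(n + j%:Z + t%:Z) c)) by apply: evz_gb.
  rewrite {2}/starn (S_lin (star_r _ _ _) e3) -SZ; last exact: (evz_lin (star_r _ _ _) e3).
  apply: S_eq => t; rewrite (linZ (star_r _ _ _)) [n + _ + _]addrAC.
  by rewrite !scalerA mulrC.
apply: (etrans (SZ_exch b2 eT2)); apply: S_eq => j.
rewrite [star (n + k - j%:Z) y b _]/starn -SZ; last exact: evz_gb.
apply: S_eq => t; rewrite (@npE _ _ _ (n + t%:Z + k - j%:Z) (n + k - j%:Z + t%:Z)).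
  by lmod (R[i]).
by lia.
Qed.

End Twisted.

End StarProducts.

(** * Commutator and iterate formulas, and the filtration by degree *)

Section Corollaries.
Context {R : realType} {V : lmodType R[i]} (VA : vertexSuperalgebra V).
Local Notation "a _( n ) b" := (nprod VA n a b)
  (at level 35, n at level 200, b at level 35).
Local Notation K := (R[i]).
Local Notation star := (starn VA).
Implicit Types (a b c d : V) (k m n l : int) (x y : R).

Lemma tprod0 a b m n c : tprod VA 0 a b m n c = a _(m) (b _(n) c).
Proof.
rewrite /tprod (@S_single _ _ 0) => [|[//|j] _].
  by rewrite gb0 expr0 mulr1 scale1r !addr0 ?subr0.
by rewrite mulr0z gb00 mulr0 scale0r.
Qed.

(** The case k = 0. *)
Lemma np_comm p q a b m n c : vpar VA p a -> vpar VA q b ->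
  a _(m) (b _(n) c) = sgn p q *: (b _(n) (a _(m) c)) +
    \S_ i (gbinom m%:~R i *: ((a _(i%:Z) b) _(m + n - i%:Z) c)).
Proof.
move=> pa qb; have := borcherds 0 m n c pa qb.
rewrite !tprod0 expr0 mul1r => h; rewrite -[LHS](subrK (sgn p q *: (b _(n) (a _(m) c)))).
rewrite -h addrC; congr (_ + _); apply: S_eq => i; rewrite add0r //.
Qed.

(** The case m = 0. *)
Lemma np_iter p q a b k n c : vpar VA p a -> vpar VA q b ->
  (a _(k) b) _(n) c =
    \S_ j (((-1) ^+ j * gbinom k%:~R j) *: (a _(k - j%:Z) (b _(n + j%:Z) c))) -
    ((-1) ^+ absz k * sgn p q) *:
    \S_ j (((-1) ^+ j * gbinom k%:~R j) *: (b _(n + k - j%:Z) (a _(j%:Z) c))).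
Proof.
move=> pa qb; have := borcherds k 0 n c pa qb.
rewrite -[X in X = _]/(iprod VA a b k 0 n c) iprod0 => ->; rewrite /tprod.
by congr (_ - _ *: _); apply: S_eq => j; rewrite add0r.
Qed.

(** The case k = 0 of the twisted identity. *)
Lemma star_comm p q a b x y m n c : vpar VA p a -> vpar VA q b ->
  star m x a (star n y b c) = sgn p q *: star n y b (star m x a c) +
    \S_ i \sum_(j < i.+1) (gbinom m%:~R (i - j) * gbinom x j) *:
     star (m + n - i%:Z + j%:Z) (x + y - j%:R) (a _(i%:Z) b) c.
Proof.
move=> pa qb; have := twisted_borcherds pa qb x y 0 m n c.
have e0 (F : nat -> V) : \S_ j (((-1) ^+ j * gbinom (0%:~R : R) j) *: F j) = F 0%N.
  rewrite (@S_single _ _ 0) => [|[//|j] _]; first by rewrite gb0 expr0 mulr1 scale1r.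
  by rewrite mulr0z gb00 mulr0 scale0r.
rewrite !e0 expr0 mul1r !addr0 ?subr0 => h.
rewrite -[LHS](subrK (sgn p q *: star n y b (star m x a c))) -h addrC.
congr (_ + _); apply: S_eq => i; apply: eq_bigr => j _; rewrite add0r //.
Qed.

(** The case m = 0 of the twisted identity: only j = i survives on the left. *)
Lemma star_assoc p q a b x y k n c : vpar VA p a -> vpar VA q b ->
  \S_ i (gbinom x i *: star n (x + y - i%:R) (a _(k + i%:Z) b) c) =
  \S_ j (((-1) ^+ j * gbinom k%:~R j) *:
           star (k - j%:Z) x a (star (n + j%:Z) y b c))
  - ((-1) ^+ absz k * sgn p q) *:
    \S_ j (((-1) ^+ j * gbinom k%:~R j) *:
           star (n + k - j%:Z) y b (star j%:Z x a c)).
Proof.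
move=> pa qb; have := twisted_borcherds pa qb x y k 0 n c.
rewrite (S_eq (G := fun i => gbinom x i *: star n (x + y - i%:R) (a _(k + i%:Z) b) c)).
  move=> ->; congr (_ - _ *: _); apply: S_eq => j; rewrite add0r //.
move=> i; rewrite big_ord_recr /= subnn mulr0z gb0 mul1r big1 => [|j _].
  rewrite add0r; congr (_ *: _); congr (starn VA _ _ _ _).
  by rewrite add0r subrK.
by rewrite gb00 subn_eq0 leqNgt ltn_ord /= mul0r scale0r.
Qed.

Lemma iter_der_np (k : nat) n a b :
  (iter k (der VA) a) _(n) b = (\prod_(i < k) (i%:R - n%:~R)) *: (a _(n - k%:Z) b).
Proof.
elim: k n => [|k IH] n; first by rewrite big_ord0 scale1r subr0.
rewrite iterS der_npl IH scalerA big_ord_recl sub0r; congr (_ * _ *: _).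
  apply: eq_bigr => i _; rewrite lift0 rmorphB /= -natr1; ring.
by apply: npE; lia.
Qed.

Lemma dpder_np (k : nat) n a b : 
  exists2 c : K, (dpder VA k a) _(n) b = c *: (a _(n - k%:Z) b) &
   ((0 <= n) && (n < k%:Z) -> c = 0) /\ (n = -1 -> c = 1).
Proof.
exists ((k`!%:R)^-1 * (\prod_(i < k) (i%:R - n%:~R))).
  by rewrite /dpder (linZ (npl _ _ _)) iter_der_np scalerA.
split=> [/andP[n0 nk]|->].
  have nk' : (absz n < k)%N by lia.
  rewrite (bigD1 (Ordinal nk')) //= (_ : n%:~R = (absz n)%:R) ?subrr ?mul0r ?mulr0//.
  by have {1}-> : n = (absz n)%:Z by lia.
have k0 : k`!%:R != 0 :> K by rewrite pnatr_eq0 -lt0n fact_gt0.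
apply: (mulfI k0); rewrite mulrA divff// mul1r mulr1.
elim: k {k0} => [|k IH]; first by rewrite big_ord0 fact0.
rewrite big_ord_recr /= IH factS natrM mulrC; congr (_ * _).
by rewrite rmorphN1 opprK natr1.
Qed.

Lemma dpder_npN1 (k : nat) a b : (dpder VA k a) _(-1) b = a _(- k%:Z - 1) b.
Proof.
have [c -> [_ ->//]] := dpder_np k (-1) a b; rewrite scale1r.
by apply: npE; lia.
Qed.

Lemma iter_der_linear (k : nat) : linear (iter k (der VA)).
Proof.
elim: k => [//|k IH] c u v; rewrite !iterS IH; exact: der_linear.
Qed.

Lemma vpar_iter_der p (k : nat) a : vpar VA p a -> vpar VA p (iter k (der VA) a).
Proof. by move=> pa; elim: k => [//|k IH]; rewrite iterS; apply: vpar_der. Qed.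

Lemma vparZ p (c : K) a : vpar VA p a -> vpar VA p (c *: a).
Proof.
have [h _ _] := vpar_direct VA; have [h0 hl] := h p Logic.I.
by move=> pa; rewrite -[_ *: _]addr0; apply: hl.
Qed.

Lemma vpar_dpder p (k : nat) a : vpar VA p a -> vpar VA p (dpder VA k a).
Proof. by move=> pa; apply: vparZ; apply: vpar_iter_der. Qed.

End Corollaries.

Section Filtration.
Context {R : realType} {V : lmodType R[i]} (VA : vertexSuperalgebra V).
Local Notation "a _( n ) b" := (nprod VA n a b)
  (at level 35, n at level 200, b at level 35).
Local Notation K := (R[i]).
Context {I : Type} (e : I -> V) (p : I -> bool) (deg : I -> nat).
Context (hep : forall i, vpar VA (p i) (e i)).
Implicit Types (s t : seq (nat * I)) (k m n l : int).

Definition mword s : V := normal_product VA [seq dpder VA i.1 (e i.2) | i <- s].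
Definition wdeg s : nat := sumn [seq deg i.2 | i <- s].
Definition wpar s : bool := foldr (fun i b => p i.2 (+) b) false s.
(** The span of the words of degree less than n.  The strict bound makes Fil 0
    trivial, and Fil (deg i + deg j) stands for the filtration in degree
    (zeta_i + zeta_j)_- of the pregrading. *)
Definition Fil (n : nat) : {pred V} := lspan (mword @` [set s | (wdeg s < n)%N]).
HB.instance Definition _ (n : nat) := GRing.SubmodClosed.on (Fil n).

Context (hpre : forall i j (n : nat), (e i) _(n%:Z) (e j) \in Fil (deg i + deg j)).

Lemma mword_cons i s : mword (i :: s) = (e i.2) _(- i.1%:Z - 1) (mword s).
Proof. by rewrite /mword /= dpder_npN1. Qed.

Lemma mword_par s : vpar VA (wpar s) (mword s).
Proof.
elim: s => [|i s IH] /=; first exact: vpar_vac.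
by rewrite mword_cons; apply: vpar_nprod.
Qed.

Lemma Fil_mono (m n : nat) v : (m <= n)%N -> v \in Fil m -> v \in Fil n.
Proof.
move=> mn; apply: lspan_mono => _ [s sm <-]; exists s => //.
exact: leq_trans mn.
Qed.

Lemma Fil0 v : v \in Fil 0 -> v = 0.
Proof. by move: v; apply: lspan_ind => // c u v [s]. Qed.

Lemma mword_Fil s (n : nat) : (wdeg s < n)%N -> mword s \in Fil n.
Proof. by move=> sn; apply: mem_lspan; exists s. Qed.

Lemma Fil_cons i l (n : nat) v : l < 0 -> v \in Fil n -> (e i) _(l) v \in Fil (deg i + n).
Proof.
move=> l0; move: v; apply: lspan_lin; first exact: npr.
move=> _ [s sn <-]; apply: mem_lspan; exists (((absz l).-1, i) :: s).
  by rewrite /= /wdeg /= ltn_add2l.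
by rewrite mword_cons; congr nprod => /=; lia.
Qed.

Lemma Fil_der (n : nat) v : v \in Fil n -> der VA v \in Fil n.
Proof.
move: v; apply: lspan_lin; first exact: der_linear.
move=> _ [s sn <-]; move: sn.
elim: s n => [|i s IH] n /= sn; first by rewrite der_vac rpred0.
rewrite mword_cons der_np.
have ni : (deg i.2 <= n)%N by apply: ltnW; apply: leq_ltn_trans sn; apply: leq_addr.
rewrite -(subnKC ni); have sn' : (wdeg s < n - deg i.2)%N by rewrite ltn_subRL.
apply: rpredB; first by apply: Fil_cons; [lia|exact: IH].
by apply/rpredZ/Fil_cons; [lia|exact: mword_Fil].
Qed.

Lemma Fil_iter_der (k n : nat) v : v \in Fil n -> iter k (der VA) v \in Fil n.
Proof. by move=> vF; elim: k => [//|k IH]; rewrite iterS; apply: Fil_der. Qed.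

Lemma Fil_gen i : e i \in Fil (deg i).+1.
Proof.
have -> : e i = mword [:: (0%N, i)] by rewrite mword_cons /= sub0r nprod_vac.
by apply: mword_Fil; rewrite /wdeg /= addn0.
Qed.

(* As m and n are strict bounds, the degrees of a and b add up to at most
   m + n - 2, which (m + n).-1 bounds strictly; nonnegative products drop one
   degree more. *)
Let P (N : nat) := forall m n : nat, (m + n <= N.+1)%N -> forall a b, a \in Fil m -> b \in Fil n ->
  forall k, (a _(k) b \in Fil (m + n).-1) /\ (0 <= k -> a _(k) b \in Fil (m + n).-2).

(** By bilinearity the bounds need only be checked on words. *)
Lemma Fil_np_words N : (forall s t, (wdeg s + wdeg t < N)%N -> forall k,
     (mword s) _(k) (mword t) \in Fil (wdeg s + wdeg t).+1 /\
     (0 <= k -> (mword s) _(k) (mword t) \in Fil (wdeg s + wdeg t))) -> P N.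
Proof.
move=> h m n mn a b aF bF k.
case: m mn aF => [|m] mn; first by move=> /Fil0 ->; rewrite np0l !rpred0.
case: n mn bF => [|n] mn; first by move=> /Fil0 ->; rewrite np0r !rpred0.
move=> bF aF; rewrite addSn addnS /=.
have mn' : (m + n < N)%N by move: mn; rewrite addSn addnS !ltnS.
suff H M : (forall s t, (wdeg s <= m)%N -> (wdeg t <= n)%N -> (mword s) _(k) (mword t) \in Fil M) ->
    a _(k) b \in Fil M.
  split; [|move=> k0]; apply: H => s t sm tn.
    apply: (Fil_mono (m := (wdeg s + wdeg t).+1)); first by rewrite ltnS leq_add.
    by have [] := h s t (leq_ltn_trans (leq_add sm tn) mn') k.
  apply: (Fil_mono (m := wdeg s + wdeg t)); first by rewrite leq_add.
  by have [_ ->] := h s t (leq_ltn_trans (leq_add sm tn) mn') k.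
move=> {}h; move: a aF; apply: (lspan_lin (npl VA k b)) => _ [s sm <-].
move: b bF; apply: (lspan_lin (npr VA k _)) => _ [t tn <-].
by apply: h; rewrite -ltnS.
Qed.

(** Move e_i through the word with the commutator formula; by the pregrading each
    commutator with a letter has lower degree, so induction on the degree
    applies. *)
Lemma Fil_np_gen N i t : P N -> (deg i + wdeg t <= N)%N -> forall k, 0 <= k ->
  (e i) _(k) (mword t) \in Fil (deg i + wdeg t).
Proof.
move=> PN; elim: t => [|j t IH] /= iN k k0; first by rewrite vac_nat// rpred0.
rewrite mword_cons (np_comm _ _ _ (hep i) (hep j.2)).
have iN' : (deg i + wdeg t <= N)%N.
  by apply: leq_trans iN; rewrite leq_add2l /wdeg /= leq_addl.
apply: rpredD.
  rewrite rpredZ// /wdeg /= addnCA; apply: Fil_cons; first by lia.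
  exact: IH.
apply: S_mem => l; apply: rpredZ.
have -> : (deg i + wdeg (j :: t))%N = (deg i + deg j.2 + (wdeg t).+1).-1.
  by rewrite addnS /= /wdeg /= addnA.
apply: (PN _ _ _ _ _ (hpre i j.2 l) (mword_Fil _) _).1; last by [].
by rewrite addnS ltnS -addnA.
Qed.

(** Induction on the total degree and on the length of the first word: the
    iterate formula removes its first letter e_i, either by multiplying with a
    letter from the left or by a nonnegative product of e_i, which is covered by
    [Fil_np_gen]. *)
Lemma Fil_np_main N : P N.
Proof.
elim: N => [|N IH]; first exact: Fil_np_words.
apply: Fil_np_words => s t; rewrite ltnS.
elim: s => [|i s IHs] stN k.
  rewrite /= vac_nprod; split; last by move=> k0; rewrite ifN ?rpred0//; lia.
  by case: ifP => _; rewrite ?rpred0// mword_Fil.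
have stN' : (wdeg s + wdeg t <= N)%N.
  by apply: leq_trans stN; rewrite /wdeg /= -addnA leq_addl.
have {}IHs := IHs stN'.
have itN : (deg i.2 + wdeg t <= N)%N.
  by apply: leq_trans stN; rewrite leq_add2r /wdeg /= leq_addr.
rewrite mword_cons.
have key M : (forall l, k <= l -> (mword s) _(l) (mword t) \in Fil M) -> (wdeg s + wdeg t <= M)%N ->
   ((e i.2) _(- i.1%:Z - 1) (mword s)) _(k) (mword t) \in Fil (deg i.2 + M).
  move=> hM stM; rewrite (np_iter _ _ _ (hep i.2) (mword_par s)); apply: rpredB.
    apply: S_mem => j; rewrite rpredZ//; apply: Fil_cons; first by lia.
    by apply: hM; lia.
  rewrite rpredZ//; apply: S_mem => j; rewrite rpredZ//.
  have gF : (e i.2) _(j%:Z) (mword t) \in Fil (deg i.2 + wdeg t) by apply: (Fil_np_gen IH).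
  apply: Fil_mono ((IH _ _ _ _ _ (mword_Fil (ltnSn _)) gF _).1).
    by rewrite addSn /= addnCA leq_add2l.
  by rewrite addSn ltnS addnCA; move: stN; rewrite /wdeg /= addnA.
have e1 : (wdeg (i :: s) + wdeg t = deg i.2 + (wdeg s + wdeg t))%N by rewrite /wdeg /= addnA.
rewrite e1 -addnS; split; last first.
  by move=> k0; apply: key => // l kl; apply: (IHs l).2; lia.
by apply: key => // l kl; apply: (IHs l).1.
Qed.

Lemma Fil_np (m n : nat) a b k : a \in Fil m -> b \in Fil n -> a _(k) b \in Fil (m + n).-1.
Proof. by move=> aF bF; apply: (Fil_np_main (leqnSn (m + n)) aF bF k).1. Qed.

Lemma Fil_np_ge0 (m n : nat) a b k : a \in Fil m -> b \in Fil n -> 0 <= k ->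
  a _(k) b \in Fil (m + n).-2.
Proof. by move=> aF bF; apply: (Fil_np_main (leqnSn (m + n)) aF bF k).2. Qed.

Lemma Fil_star (m n : nat) a b k x : a \in Fil m -> b \in Fil n -> starn VA k x a b \in Fil (m + n).-1.
Proof. by move=> aF bF; apply: S_mem => j; rewrite rpredZ//; apply: Fil_np. Qed.

Lemma Fil_star_ge0 (m n : nat) a b k x : a \in Fil m -> b \in Fil n -> 0 <= k ->
  starn VA k x a b \in Fil (m + n).-2.
Proof.
by move=> aF bF k0; apply: S_mem => j; rewrite rpredZ//; apply: Fil_np_ge0 => //; lia.
Qed.

End Filtration.

(** * Homogeneous elements and the space J *)

(** The number chi_{a,b} as a function of epsilon_a and epsilon_b. *)
Definition chi {R : realType} (x y : R) : nat := (x + y <= -1)%R.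
(** The largest n for which a *_n b must be in J, as a function of epsilon_a.
    When epsilon_a + epsilon_b is an integer this is -2 + chi_{a,b}. *)
Definition thr {R : realType} (x : R) : int := if x == 0 then -2 else -1.

Section Homogeneous.
Context {R : realType} {V : lmodType R[i]} (VA : vertexSuperalgebra V).
Context (H g : V -> V) (hH : is_hamiltonian VA H) (hg : is_automorphism VA g).
Local Notation "a _( n ) b" := (nprod VA n a b)
  (at level 35, n at level 200, b at level 35).
Local Notation K := (R[i]).
Local Notation star := (starn VA).
Local Notation hn := (hom_norm H g).
Implicit Types (a b : V) (c D : R).

Lemma bihom_int c D (k : int) a : bihom H g c D a -> bihom H g (c + k%:~R) D a.
Proof. by move=> [ga Ha]; split; rewrite // expiD expi_int mulr1. Qed.

(** The number chi is the carry that brings epsilon back to ]-1, 0]. *)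
Lemma hn_np c D c' D' (n : int) a b : hn c D a -> hn c' D' b ->
  hn (c + c' + (chi (c - D) (c' - D'))%:R - n%:~R - 1) (D + D' - n%:~R - 1) (a _(n) b).
Proof.
move=> [ha /andP[a1 a2]] [hb /andP[b1 b2]]; split.
  have := bihom_int ((chi (c - D) (c' - D'))%:Z - n - 1) (hom_nprod hH hg n ha hb).
  by rewrite !rmorphB /= rmorph1 !addrA.
rewrite /chi; have [h|h] := leP (c - D + (c' - D')) (-1).
  by rewrite mulr1n; apply/andP; split; lra.
by rewrite mulr0n; apply/andP; split; lra.
Qed.

Lemma hn_vac : hn 0 0 (vac VA).
Proof.
split; last by rewrite subrr lexx ltrN10.
have [_ _ Hn] := hH; have [_ _ gv _ _] := hg.
split; first by rewrite gv expi0 scale1r.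
have := Hn (-1) (vac VA) (vac VA); rewrite !nprod_vac !vac_nprod eqxx.
by rewrite subrr opprK subrr mulr0z scale0r add0r => <-.
Qed.

Lemma hn_der c D a : hn c D a -> hn (c + 1) (D + 1) (der VA a).
Proof.
move=> ha; have -> : der VA a = a _(-2) vac VA.
  by have := der_npl VA (-1) a (vac VA); rewrite nprod_vac rmorphN1 opprK scale1r.
have := hn_np (-2) ha hn_vac; rewrite subrr /chi leNgt.
have -> : -1 < c - D + 0 by rewrite addr0; case: ha => _ /andP[].
rewrite mulr0n !addr0 (_ : (-2)%:~R = - 2%:R :> R) ?rmorphN//.
by congr hom_norm; ring.
Qed.

Lemma hnZ c D (z : K) a : hn c D a -> hn c D (z *: a).
Proof.
move=> [[ga Ha] h]; split=> //; have [lH _ _] := hH; have [lg _ _ _ _] := hg.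
by split; rewrite ?(linZ lg) ?(linZ lH) ?ga ?Ha !scalerA mulrC.
Qed.

Lemma hn_iter_der c D (k : nat) a : hn c D a -> hn (c + k%:R) (D + k%:R) (iter k (der VA) a).
Proof.
move=> ha; elim: k => [|k IH]; first by rewrite !addr0.
by rewrite iterS -natr1 !addrA; apply: hn_der.
Qed.

Lemma hn_dpder c D (k : nat) a : hn c D a -> hn (c + k%:R) (D + k%:R) (dpder VA k a).
Proof. by move=> ha; apply: hnZ; apply: hn_iter_der. Qed.

(** If cos (2 pi t) = 1 then sin (pi t) = 0 by the double angle formula. *)
Lemma expi_eq1 (t : R) : -1 < t < 1 -> expi t = 1 -> t = 0.
Proof.
move=> /andP[t1 t2] /eqP; rewrite /expi eq_complex /= => /andP[/eqP c1 _].
apply/eqP; apply/negPn/negP => t0.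
wlog tpos : t t1 t2 c1 t0 / 0 < t => [hw|].
  have [/hw|tn] := ltP 0 t; first exact.
  apply: (hw (- t)); rewrite ?oppr_eq0 ?mulrN ?cosN//; [lra|lra|].
  by rewrite oppr_gt0 lt_neqAle t0.
have pi0 : 0 < pi :> R := pi_gt0 R.
have u0 : 0 < sin (pi * t).
  by apply: sin_gt0_pi; rewrite mulr_gt0//= gtr_pMr.
have := cos_mulr2n (pi * t); rewrite -mulrnAl c1 => h.
have := cos2Dsin2 (pi * t).
have -> : cos (pi * t) ^+ 2 = 1 by move: h; rewrite mulr2n; lra.
move=> h2; have : sin (pi * t) ^+ 2 = 0 by lra.
by move=> /eqP; rewrite sqrf_eq0 => /eqP s0; rewrite s0 ltxx in u0.
Qed.

Lemma expi_inj (x y : R) : -1 < x - y < 1 -> expi x = expi y -> x = y.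
Proof.
move=> xy exy; apply/eqP; rewrite -subr_eq0; apply/eqP; apply: expi_eq1 => //.
by rewrite expiD exy -expiD subrr expi0.
Qed.

Lemma expi_surj (z : K) : `|z| = 1 -> exists t : R, z = expi t.
Proof.
case: z => x y; rewrite normc_def /= => /eqP.
rewrite eq_complex /= eqxx andbT => /eqP h.
have s1 : x ^+ 2 + y ^+ 2 = 1.
  by rewrite -[LHS]sqr_sqrtr ?h ?expr1n// addr_ge0 ?sqr_ge0.
have x1 : -1 <= x <= 1.
  rewrite -ler_norml -(ler_pXn2r (n := 2)) ?nnegrE// expr1n -normrX ger0_norm ?sqr_ge0//.
  by rewrite -s1 lerDl sqr_ge0.
have pi0 : pi *+ 2 != 0 :> R by rewrite mulrn_eq0 /= gt_eqF// pi_gt0.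
have y1 : 1 - x ^+ 2 = y ^+ 2 by lra.
have [y0|y0] := leP 0 y.
  exists (acos x / (pi *+ 2)); rewrite /expi mulrCA divff// mulr1 acosK ?in_itv//.
  by rewrite sin_acos// y1 sqrtr_sqr ger0_norm.
exists (- (acos x / (pi *+ 2))); rewrite /expi mulrN mulrCA divff// mulr1 cosN sinN.
by rewrite acosK ?in_itv// sin_acos// y1 sqrtr_sqr ltr0_norm// opprK.
Qed.

Lemma hn_uniq c D c' D' a : a != 0 -> hn c D a -> hn c' D' a -> c = c' /\ D = D'.
Proof.
move=> a0 [[ga Ha] h] [[ga' Ha'] h'].
have eD : D = D'.
  have /eqP : ((D%:C)%C - (D'%:C)%C) *: a = 0 by rewrite scalerBl -Ha -Ha' subrr.
  by rewrite scaler_eq0 (negbTE a0) orbF subr_eq0 => /eqP [].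
split=> //; apply: expi_inj; first by subst D'; lra.
have /eqP : (expi c - expi c') *: a = 0 by rewrite scalerBl -ga -ga' subrr.
by rewrite scaler_eq0 (negbTE a0) orbF subr_eq0 => /eqP.
Qed.

Lemma hn_exists (z : K) D a : g a = z *: a -> `|z| = 1 -> H a = (D%:C)%C *: a ->
  exists c, hn c D a.
Proof.
move=> ga /expi_surj[t zt] Ha; exists (t - (Num.ceil (t - D))%:~R); split.
  rewrite -rmorphN; apply: bihom_int; split=> //; by rewrite -zt.
have /andP[h1 h2] := ceil_itv (t - D).
rewrite intrB in h1; apply/andP; split; lra.
Qed.

Lemma chi0l (x : R) : -1 < x -> chi 0 x = 0%N.
Proof. by move=> x1; rewrite /chi add0r leNgt x1. Qed.

Lemma chiC (x y : R) : chi x y = chi y x. Proof. by rewrite /chi addrC. Qed.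

Section Filtered.
Context {I : Type} (e : I -> V) (p : I -> bool) (deg : I -> nat).
Context (hep : forall i, vpar VA (p i) (e i)).
Context (hpre : forall i j (n : nat), (e i) _(n%:Z) (e j) \in Fil VA e deg (deg i + deg j)).
Local Notation F := (Fil VA e deg).
Let npF0 := Fil_np_ge0 hep hpre.
Let stF := Fil_star hep hpre.

Definition hfil (q : bool) c D (m : nat) a := [/\ vpar VA q a, hn c D a & a \in F m].

(** A filtered version of J_{g,H}: a may be any homogeneous element, twisted or
    not, and b any element, so that inductions on words need not follow the
    eigenvalues of b.  Its part in V_{g,H} is nevertheless J_{g,H}. *)
Definition Jt (n : nat) : {pred V} := lspan [set x | exists q c D m1 m2 a b (k : int),
  [/\ hfil q c D m1 a, b \in F m2, (m1 + m2 <= n)%N, k <= thr (c - D) & x = star k c a b]].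
HB.instance Definition _ n := GRing.SubmodClosed.on (Jt n).

Lemma starE (n : int) (x y : R) a b : x = y -> star n x a b = star n y a b.
Proof. by move=> ->. Qed.

Lemma Jt_mono m n x : (m <= n)%N -> x \in Jt m -> x \in Jt n.
Proof.
move=> mn; apply: lspan_mono => _ [q [c [D [m1 [m2 [a [b [k [h1 h2 h3 h4 ->]]]]]]]]].
by exists q, c, D, m1, m2, a, b, k; split=> //; apply: leq_trans mn.
Qed.

Lemma mem_Jt q c D m1 m2 n a b (k : int) : hfil q c D m1 a -> b \in F m2 ->
  ((0 < m1)%N -> (0 < m2)%N -> (m1 + m2 <= n)%N) -> k <= thr (c - D) -> star k c a b \in Jt n.
Proof.
move=> ha bF mn kt.
case: m1 ha mn => [[_ _ /Fil0 ->]|m1 ha mn]; first by rewrite (lin0 (star_l _ _ _ _)) rpred0.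
case: m2 bF mn => [/Fil0 ->|m2 bF mn]; first by rewrite (lin0 (star_r _ _ _ _)) rpred0.
by apply: mem_lspan; exists q, c, D, m1.+1, m2.+1, a, b, k; split=> //; apply: mn.
Qed.

Lemma Jt0 x : x \in Jt 0 -> x = 0.
Proof.
move: x; apply: lspan_ind => // z u v [q [c [D [m1 [m2 [a [b [k [[_ _ aF] _ mn _ ->]]]]]]]]] ->.
move: mn aF; rewrite leqn0 addn_eq0 => /andP[/eqP -> _] /Fil0 ->.
by rewrite (lin0 (star_l _ _ _ _)) scaler0 addr0.
Qed.

Lemma hfil_np0 q1 c1 D1 m1 a q2 c2 D2 m2 b (n : nat) :
  hfil q1 c1 D1 m1 a -> hfil q2 c2 D2 m2 b ->
  hfil (q1 (+) q2) (c1 + c2 + (chi (c1 - D1) (c2 - D2))%:R - n%:R - 1) (D1 + D2 - n%:R - 1)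
    (m1 + m2).-2 (a _(n%:Z) b).
Proof.
move=> [pa ha aF] [pb hb bF].
by split; [exact: vpar_nprod|exact: (hn_np n)|exact: npF0].
Qed.

(** In the commutator formula a_(i)b occurs with exponent gamma_a + gamma_b - j
    instead of its own gamma, which is chi - i - 1 larger than gamma_a + gamma_b.
    The difference is a natural number, so raising the exponent only produces
    products with indices up to k + l + 1 - chi. *)
Lemma star_comm_mem (N : submodClosed V) q1 c1 D1 m1 a q2 c2 D2 m2 b (k l : int) d :
  hfil q1 c1 D1 m1 a -> hfil q2 c2 D2 m2 b ->
  let ch := chi (c1 - D1) (c2 - D2) in
  (forall (i : nat) (M : int), M <= k + l + 1 - ch%:Z ->
     star M (c1 + c2 + ch%:R - i%:R - 1) (a _(i%:Z) b) d \in N) ->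
  star k c1 a (star l c2 b d) - sgn q1 q2 *: star l c2 b (star k c1 a d) \in N.
Proof.
move=> [pa ha aF] [pb hb bF] ch hN; rewrite (star_comm _ _ _ _ _ pa pb) addrC addKr.
apply: S_mem => i; apply: rpred_sum => -[j /= ji] _; apply: rpredZ.
have ch1 : (ch <= 1)%N by rewrite /ch /chi leq_b1.
pose s := (i.+1 - j - ch)%N.
have -> : c1 + c2 - j%:R = (c1 + c2 + ch%:R - i%:R - 1) + s%:R.
  rewrite /s natrB; last by rewrite (leq_trans ch1)// subn_gt0.
  rewrite natrB; last by apply: ltnW.
  by rewrite -natr1; ring.
rewrite star_shift; apply: S_mem => t; rewrite gb_nat.
have [ts|ts] := leqP t s; last by rewrite bin_small// scale0r rpred0.
by apply: rpredZ; apply: hN; rewrite /s in ts; lia.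
Qed.

Lemma thr_le (x : R) : -2 <= thr x <= -1. Proof. by rewrite /thr; case: ifP. Qed.

(** If the indices are small enough then all terms of the commutator are in J, and
    their degree has dropped by one because they contain a nonnegative product. *)
Lemma comm_Jt q1 c1 D1 m1 a q2 c2 D2 m2 b m3 d (k l : int) :
  hfil q1 c1 D1 m1 a -> hfil q2 c2 D2 m2 b -> d \in F m3 ->
  k + l + 1 - (chi (c1 - D1) (c2 - D2))%:Z <=
    thr (c1 - D1 + (c2 - D2) + (chi (c1 - D1) (c2 - D2))%:R) ->
  star k c1 a (star l c2 b d) - sgn q1 q2 *: star l c2 b (star k c1 a d)
    \in Jt (m1 + m2 + m3).-2.
Proof.
move=> ha hb dF kl; apply: (star_comm_mem ha hb) => i M hM.
case: m1 ha => [[_ _ /Fil0 ->]|m1 ha].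
  by rewrite np0l (lin0 (star_l _ _ _ _)) rpred0.
case: m2 hb => [[_ _ /Fil0 ->]|m2 hb].
  by rewrite np0r (lin0 (star_l _ _ _ _)) rpred0.
apply: (mem_Jt (hfil_np0 i ha hb) dF) => [_ _|].
  by rewrite addSn addnS.
apply: (le_trans hM); apply: (le_trans kl); rewrite le_eqVlt; apply/orP; left; apply/eqP.
by congr thr; ring.
Qed.

(** Left multiplication by an untwisted a commutes with b *_k up to J, and there
    is no carry since epsilon_a = 0. *)
Lemma Jt_ideal_l q D m n a x : hfil q D D m a -> x \in Jt n ->
  star (-1) D a x \in Jt (m + n).-1.
Proof.
move=> ha; move: x; apply: (lspan_lin (star_r VA (-1) D a)).
move=> _ [q' [c' [D' [m1 [m2 [b [d [k [hb dF mn kt ->]]]]]]]]].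
rewrite -(subrK (sgn q q' *: star k c' b (star (-1) D a d)) (star _ _ _ _)).
have e1 : -1 < c' - D' by case: hb => _ [_ /andP[]].
have ch0 : chi (D - D) (c' - D') = 0%N by rewrite subrr chi0l.
have [m0|m0] := posnP m.
  by case: ha => _ _; rewrite m0 => /Fil0 ->; rewrite !(lin0 (star_l _ _ _ _)) (lin0 (star_r _ _ _ _)) scaler0 subr0 addr0 rpred0.
have [m10|m10] := posnP m1.
  by case: hb => _ _; rewrite m10 => /Fil0 ->; rewrite !(lin0 (star_l _ _ _ _)) (lin0 (star_r _ _ _ _)) scaler0 subr0 addr0 rpred0.
apply: rpredD.
  apply: (Jt_mono (m := (m + m1 + m2).-2)).
    by move: m0 m10 mn; lia.
  apply: (comm_Jt ha hb dF).
  by rewrite ch0 subr0 subrr add0r addr0 addrAC addNr add0r.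
rewrite rpredZ//; case: ha => pa ha aF.
apply: (mem_Jt hb (stF (-1) D aF dF)) => // _ _.
by move: m0 m10 mn; lia.
Qed.

(** The left side is (a *_k b) *_n d with each product taken with its own
    exponent.  The exponent of b on the right exceeds gamma_b by the natural
    number s, so the products with b can be rewritten with exponent gamma_b and
    larger indices. *)
Lemma star_assoc_hom q1 c1 D1 m1 a q2 c2 D2 m2 b (k n : int) d : k <= -1 ->
  hfil q1 c1 D1 m1 a -> hfil q2 c2 D2 m2 b ->
  let ch := chi (c1 - D1) (c2 - D2) in
  let s := ((absz k).-1 + ch)%N in
  \S_ i (gbinom c1 i *: star n (c1 + c2 + ch%:R - (k + i%:Z)%:~R - 1) (a _(k + i%:Z) b) d) =
  \S_ j (((-1) ^+ j * gbinom k%:~R j) *: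
           star (k - j%:Z) c1 a (star (n + j%:Z) (c2 + s%:R) b d))
  - ((-1) ^+ absz k * sgn q1 q2) *:
    \S_ j (((-1) ^+ j * gbinom k%:~R j) *:
           star (n + k - j%:Z) (c2 + s%:R) b (star j%:Z c1 a d)).
Proof.
move=> k1 [pa ha aF] [pb hb bF] ch s; rewrite -(star_assoc _ _ _ _ _ pa pb).
apply: S_eq => i; congr (_ *: _); apply: starE.
rewrite /s; have kE : k = - ((absz k).-1)%:Z - 1 by lia.
rewrite [in LHS]kE intrD intrB mulrNz natrD -!pmulrn; ring.
Qed.

Lemma star_nat_mem (N : submodClosed V) (s : nat) (M : int) c b x :
  (forall t, (t <= s)%N -> star (M + t%:Z) c b x \in N) -> star M (c + s%:R) b x \in N.
Proof.
move=> hN; rewrite star_shift; apply: S_mem => t; rewrite gb_nat.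
have [ts|ts] := leqP t s; last by rewrite bin_small// scale0r rpred0.
by rewrite rpredZ// hN.
Qed.

End Filtered.
End Homogeneous.

(** * A basis of V adapted to J *)

Section IndexOrder.
Context {d : Order.disp_t} {I : orderType d}.
Implicit Types i j k : nat * I.

Lemma index_lt_trans : transitive (@index_lt _ I).
Proof.
move=> j i k; rewrite /index_lt => /orP[ij|/andP[/eqP ij ij1]] /orP[jk|/andP[/eqP jk jk1]].
- by rewrite (lt_trans ij jk).
- by rewrite -jk ij.
- by rewrite ij jk.
- by rewrite ij jk eqxx (ltn_trans ij1 jk1) orbT.
Qed.

Lemma index_lt_total i j : [|| index_lt i j, i == j | index_lt j i].
Proof.
case: i j => [k a] [l b]; rewrite /index_lt /= xpair_eqE eq_sym [b == a]eq_sym.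
by case: (ltgtP a b) => //= _; case: (ltngtP k l) => //=.
Qed.

End IndexOrder.

Lemma lspan_image (K : fieldType) (W : lmodType K) (T : choiceType) (P : set T) (f : T -> W) v :
  v \in lspan (f @` P) -> exists (U : seq T) (c : T -> K),
    [/\ uniq U, forall t, t \in U -> P t & v = \sum_(t <- U) c t *: f t].
Proof.
move: v; apply: lspan_ind; first by exists [::], (fun=> 0); rewrite big_nil.
move=> z _ v [t Pt <-] [U [c [uU UP ->]]].
have [tU|tU] := boolP (t \in U).
  exists U, (fun u => if u == t then z + c t else c u); split=> //.
  rewrite (bigD1_seq t)//= [RHS](bigD1_seq t)//= eqxx scalerDl addrA.
  by congr (_ + _); apply: eq_bigr => u /negbTE ->.
exists (t :: U), (fun u => if u == t then z else c u); split=> /=.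
- by rewrite tU.
- by move=> u; rewrite inE => /orP[/eqP ->|/UP].
rewrite big_cons eqxx; congr (_ + _); rewrite big_seq [RHS]big_seq.
by apply: eq_bigr => u uU'; case: eqP tU => // <-; rewrite uU'.
Qed.

(** A part of an independent family stays independent modulo the span of the
    rest; with [Jt_adm] this gives independence modulo J. *)
Lemma free_disjoint (K : fieldType) (W : lmodType K) (T : choiceType) (P Q : set T) (f : T -> W) :
  (forall (s : seq T) (c : T -> K), uniq s -> (forall k, k \in s -> P k) ->
     \sum_(k <- s) c k *: f k = 0 -> forall k, k \in s -> c k = 0) ->
  Q `<=` P ->
  forall (s : seq T) (c : T -> K), uniq s -> (forall k, k \in s -> P k /\ ~ Q k) ->
     \sum_(k <- s) c k *: f k \in lspan (f @` Q) -> forall k, k \in s -> c k = 0.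
Proof.
move=> fr QP s c us sP /lspan_image[U [c' [uU UQ e]]] k ks.
have dis t : t \in s -> t \in U -> False by move=> /sP[_ nQ] /UQ.
pose c2 t := if t \in s then c t else - c' t.
suff : c2 k = 0 by rewrite /c2 ks.
apply: (fr (s ++ U)).
- rewrite cat_uniq us uU andbT /=; apply/hasPn => t tU; apply/negP => ts; exact: dis ts tU.
- by move=> t; rewrite mem_cat => /orP[/sP[]|/UQ/QP].
- rewrite big_cat /= [X in X + _](_ : _ = \sum_(t <- s) c t *: f t); last first.
    by rewrite big_seq [RHS]big_seq; apply: eq_bigr => t ts; rewrite /c2 ts.
  rewrite e -big_split big_seq big1// => t tU; rewrite /c2.
  by case: ifP => [ts|_]; [case: (dis t)|rewrite scaleNr /= subrr].
- by rewrite mem_cat ks.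
Qed.

Section PBW.
Context {R : realType} {V : lmodType R[i]} (VA : vertexSuperalgebra V).
Context (H g : V -> V) (hH : is_hamiltonian VA H) (hg : is_automorphism VA g).
Local Notation "a _( n ) b" := (nprod VA n a b)
  (at level 35, n at level 200, b at level 35).
Local Notation K := (R[i]).
Local Notation star := (starn VA).
Local Notation hn := (hom_norm H g).
Context {d : Order.disp_t} {I : orderType d} (e : I -> V) (p : I -> bool) (deg : I -> nat).
Context (ce De : I -> R).
Context (hep : forall i, vpar VA (p i) (e i)).
Context (heD : forall i, hn (ce i) (De i) (e i)).
Context (hdeg : forall i, (0 < deg i)%N).
Context (hpre : forall i j (n : nat), (e i) _(n%:Z) (e j) \in Fil VA e deg (deg i + deg j)).
Context (hfree : freely_generated VA p e).
Local Notation F := (Fil VA e deg).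
Local Notation mword := (mword VA e).
Local Notation wdeg := (wdeg deg).
Local Notation J := (Jt VA H g e deg).
Local Notation hfil := (hfil VA H g e deg).
Let npF := Fil_np hep hpre.
Let npF0 := Fil_np_ge0 hep hpre.
Let stF := Fil_star hep hpre.
Let stF0 := Fil_star_ge0 hep hpre.
Local Notation adm := (@admissible d I p).
Implicit Types (s t : seq (nat * I)) (i j : nat * I).

Lemma vac_neq0 : vac VA != 0.
Proof. exact: (basis_neq0 (t := [::]) hfree). Qed.

Lemma mword_hom s : exists c D, hn c D (mword s).
Proof.
elim: s => [|i s [c [D IH]]]; first by exists 0, 0; apply: hn_vac.
by have := hn_np hH hg (-1) (hn_dpder hH hg i.1 (heD i.2)) IH; eexists; eexists; eauto.
Qed.

Lemma hfil_gen a : hfil (p a) (ce a) (De a) (deg a).+1 (e a).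
Proof. by split=> //; apply: Fil_gen. Qed.

Lemma hfil_dpder a k : hfil (p a) (ce a + k%:R) (De a + k%:R) (deg a).+1 (dpder VA k (e a)).
Proof.
split; [exact: vpar_dpder|exact: hn_dpder|].
by apply: rpredZ; apply: Fil_iter_der; apply: Fil_gen.
Qed.

Lemma mword_all v : v \in lspan (mword @` adm) -> exists n, v \in F n.
Proof.
move: v; apply: lspan_ind; first by exists 0%N; apply: rpred0.
move=> c _ v [s _ <-] [m vm]; exists (maxn (wdeg s).+1 m); apply: rpredD.
  by apply: rpredZ; apply: mword_Fil; rewrite leq_max leqnn.
by apply: Fil_mono vm; apply: leq_maxr.
Qed.

Lemma Fil_all v : exists n, v \in F n.
Proof. by apply: mword_all; apply: hfree.1. Qed.

Definition J1 n : set V := [set x | exists a (k : int) b m,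
  [/\ b \in F m, ((deg a).+1 + m <= n)%N, k <= thr (ce a - De a) & x = star k (ce a) (e a) b]].

(** By [star_der] a derivative of a generator as left factor gives products of the
    generator with smaller indices. *)
Lemma J1_der a (k : nat) (l : int) b m n : b \in F m -> ((deg a).+1 + m <= n)%N ->
  l <= thr (ce a - De a) -> star l (ce a + k%:R) (dpder VA k (e a)) b \in lspan (J1 n).
Proof.
move=> bF mn; rewrite /dpder (linZ (star_l _ _ _ _)) => lt; apply: rpredZ.
elim: k l lt => [|k IH] l lt; first by apply: mem_lspan; exists a, l, b, m; rewrite addr0.
rewrite iterS -natr1 addrA star_der; apply: rpredB; apply: rpredZ; apply: IH => //.
by apply: le_trans lt; lia.
Qed.

Lemma evz_star_np (f : nat -> K) (x : nat -> R) (k n : int) a b v :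
  evz (fun u : nat => f u *: star n (x u) (a _(k + u%:Z) b) v).
Proof.
have [N hN] := nprod_field VA a b; exists (absz (N - k)%R) => j Nj.
by rewrite hN ?(lin0 (star_l _ _ _ _)) ?scaler0//; lia.
Qed.

(** Induction on the length of the word, written as f_(-1)a' with f a derivative
    of a generator.  The twisted identity expresses (f *_{-1} a') *_k b through
    products with left factor f or a', and the remaining terms contain the
    nonnegative products f_(i)a' or f *_j b and so have lower degree. *)
Lemma Jt_word s c D (k : int) m b n : hn c D (mword s) -> k <= thr (c - D) -> b \in F m ->
  ((wdeg s).+1 + m <= n.+1)%N ->
  star k c (mword s) b \in lspan (J1 n.+1 `|` [set x | x \in J n]).
Proof.
elim: s c D k m b => [|[t a] s IH] c D k m b hs kt bF mn.
  have [c0 D0] := hn_uniq vac_neq0 hs (hn_vac hH hg).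
  move: kt; rewrite c0 D0 subrr /thr eqxx => kt.
  by rewrite star_vacl ifN ?rpred0//; lia.
have [z0|nz0] := eqVneq (mword ((t, a) :: s)) 0.
  by rewrite z0 (lin0 (star_l _ _ _ _)) rpred0.
have [c' [D' ha']] := mword_hom s.
set f := dpder VA t (e a); set a' := mword s; rewrite -/a' in ha'.
have aE : mword ((t, a) :: s) = f _(-1) a' by [].
have hf := hfil_dpder a t; have [pf hf1 fF] := hf.
have ha1 : hfil (wpar p s) c' D' (wdeg s).+1 a'.
  by split=> //; [apply: mword_par|apply: mword_Fil].
pose cf := ce a + t%:R; pose Df := De a + t%:R.
pose ch := chi (cf - Df) (c' - D').
have [cE DE] := hn_uniq nz0 hs (hn_np hH hg (-1) hf1 ha').
have eps : cf - Df = ce a - De a by rewrite /cf /Df; ring.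
have epsc : c - D = ce a - De a + (c' - D') + ch%:R.
  rewrite cE DE /ch /cf /Df; ring.
have e1 : -1 < c' - D' by case: ha' => _ /andP[].
have e2 : c' - D' <= 0 by case: ha' => _ /andP[].
have [f1 f2] : -1 < ce a - De a /\ ce a - De a <= 0 by case: (heD a) => _ /andP[].
have m0 : (wdeg ((t, a) :: s) = deg a + wdeg s)%N by [].
rewrite m0 in mn.
have inN x : x \in J n -> x \in lspan (J1 n.+1 `|` [set x | x \in J n]).
  by move=> xJ; apply: mem_lspan; right.
have inJ1 x : x \in lspan (J1 n.+1) -> x \in lspan (J1 n.+1 `|` [set x | x \in J n]).
  by apply: lspan_mono => y; left.
have [b0|m_gt0] := posnP m.
  by move: bF; rewrite b0 => /Fil0 ->; rewrite (lin0 (star_r _ _ _ _)) rpred0.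
(* The first term of the left side is star k c (mword s) b; the others contain
   the nonnegative products of f and a'. *)
have := star_assoc_hom k b (lexx _) hf ha1; cbv zeta.
rewrite [X in X = _]S_recl; last exact: evz_star_np.
rewrite gb0 scale1r addr0 -/f -/a' -/cf -/Df -/ch.
have -> : cf + c' + ch%:R - (-1)%:~R - 1 = c by rewrite cE.
rewrite -aE add0n => h.
rewrite -[star k c _ b](addrK (\S_ i (gbinom cf i.+1 *: star k
   (cf + c' + ch%:R - (-1 + i.+1%:Z)%:~R - 1) (f _(-1 + i.+1%:Z) a') b))) h {h}.
apply: rpredB; last first.
  apply: inN; apply: S_mem => i; apply: rpredZ.
  have -> : -1 + i.+1%:Z = i%:Z by lia.
  apply: (mem_Jt (hfil_np0 hH hg hep hpre i hf ha1) bF).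
    by move=> _ _; move: mn; lia.
  apply: (le_trans kt); rewrite epsc le_eqVlt; apply/orP; left; apply/eqP; congr thr.
  by rewrite -/cf -/Df -/ch /cf /Df; ring.
apply: rpredB; last first.
  rewrite rpredZ//; apply: inN; apply: S_mem => j; apply: rpredZ.
  apply: star_nat_mem => u us.
  have xF : star j%:Z cf f b \in F ((deg a).+1 + m).-2 by apply: stF0.
  apply: (mem_Jt ha1 xF); first by move=> _ _; move: mn; lia.
  have chE : c' - D' = 0 -> ch = 0%N by move=> h0; rewrite /ch h0 chiC chi0l// eps.
  have ch1 : (ch <= 1)%N by rewrite /ch /chi leq_b1.
  have := thr_le (c - D); rewrite [thr (c' - D')]/thr.
  case: eqP => [h0|_]; [rewrite (chE h0) in us|]; move: kt us ch1; clear; lia.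
apply: S_mem => j; apply: rpredZ.
have xF : star (k + j%:Z) (c' + ch%:R) a' b \in F ((wdeg s).+1 + m).-1.
  by apply: stF => //; apply: mword_Fil.
(* The index -1 - j is small enough for f to be the left factor of an element of
   J, unless f is untwisted and j = 0; then f is moved past a', and induction
   applies to a'. *)
have [kj|kj] := leP (-1 - j%:Z) (thr (ce a - De a)).
  by apply: inJ1; apply: (J1_der _ xF) => //; move: mn; lia.
have [ea j0] : ce a - De a = 0 /\ j = 0%N.
  move: kj; rewrite /thr; case: eqP => [h0|_]; last by clear; lia.
  by move=> kj; split=> //; move: kj; clear; lia.
have ch0 : ch = 0%N by rewrite /ch eps ea chi0l.
rewrite j0 ch0 !addr0 ?subr0.
have kt' : k <= thr (c' - D') by move: kt; rewrite epsc ea ch0 add0r addr0.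
rewrite -(subrK (sgn (p a) (wpar p s) *: star k c' a' (star (-1) cf f b)) (star (-1) cf f _)).
apply: rpredD.
  apply: inN; apply: (Jt_mono (m := ((deg a).+1 + (wdeg s).+1 + m).-2)).
    by move: mn; lia.
  apply: (comm_Jt hH hg hep hpre hf ha1 bF).
  rewrite -/cf -/Df -/ch ch0 eps ea add0r; move: kt'; rewrite ?addr0 ?subr0; lia.
apply: rpredZ; apply: (IH _ D' _ ((deg a).+1 + m).-1) => //.
  by apply: stF.
by move: mn; lia.
Qed.

(** The left factor a of an element of J is a combination of words, which may be
    chosen homogeneous with the same eigenvalues since words are eigenvectors of
    g and H. *)
Lemma Jt_J1 n x : x \in J n.+1 -> x \in lspan (J1 n.+1 `|` [set x | x \in J n]).
Proof.
move: x; apply: lspan_sub => _ [q [c [D [m1 [m2 [a [b [k [ha bF mn kt ->]]]]]]]]].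
have [lH _ _] := hH; have [lg _ _ _ _] := hg.
have [_ [[ga Ha] nrm] aF] := ha.
have eigw T z a' : linear T -> (forall s, exists z, T (mword s) = z *: mword s) ->
    forall A : set V, A `<=` range mword -> a' \in lspan A -> T a' = z *: a' ->
    a' \in lspan (A `&` [set w | T w = z *: w]).
  move=> lT eT A Aw aA Ta; have := eig_span lT _ aA Ta; apply=> w /Aw [s _ <-].
  exact: eT.
have gw s : exists z, g (mword s) = z *: mword s.
  by have [c' [D' [[h _] _]]] := mword_hom s; exists (expi c').
have Hw s : exists z, H (mword s) = z *: mword s.
  by have [c' [D' [[_ h] _]]] := mword_hom s; exists ((D'%:C)%C).
have h1 := eigw _ _ _ lg gw (mword @` [set s | (wdeg s < m1)%N]) _ aF ga.
have {}h1 := h1 (fun w hw => let: ex_intro2 s _ e := hw in ex_intro2 _ _ s Logic.I e).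
have := eigw _ _ _ lH Hw _ _ h1 Ha.
have wr : mword @` [set s | (wdeg s < m1)%N] `&` [set w | g w = expi c *: w] `<=` range mword.
  by move=> w [[s _ <-] _]; exists s.
move=> /(_ wr).
move: a {ha aF ga Ha h1}; apply: (lspan_lin (star_l VA k c b)).
move=> _ [[[s sm <-] gs] Hs]; apply: (Jt_word (D := D) _ kt bF).
  by split.
by apply: leq_trans mn; rewrite leq_add2r.
Qed.

(** The letters of the adapted basis: an index (k, alpha) stands for the operator
    x -> e_alpha *_{-k-1} x. *)
Definition estar (i : nat * I) : V -> V := star (- i.1%:Z - 1) (ce i.2) (e i.2).
Definition eword s : V := foldr estar (vac VA) s.
(** A letter is bad if its values are in J whatever it is applied to, see [badP]:
    if it contains a derivative or if its generator is twisted. *)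
Definition bad i : bool := (0 < i.1)%N || (ce i.2 - De i.2 != 0).

Lemma estar_linear i : linear (estar i). Proof. exact: star_r. Qed.

Lemma eword_Fil s : eword s \in F (wdeg s).+1.
Proof.
elim: s => [|i s IH]; first exact: (@mword_Fil _ _ VA _ e deg [::]).
have := stF (- i.1%:Z - 1) (ce i.2) (Fil_gen VA e deg i.2) IH.
by rewrite addSn addnS /=.
Qed.

Lemma badP i : bad i = (- i.1%:Z - 1 <= thr (ce i.2 - De i.2)).
Proof. by rewrite /bad /thr; case: eqP => _; lia. Qed.

Lemma goodP i : ~~ bad i -> i.1 = 0%N /\ ce i.2 = De i.2.
Proof.
rewrite /bad negb_or negbK -leqNgt leqn0 => /andP[/eqP -> /eqP h]; split=> //; lra.
Qed.

Lemma hfil_good i : ~~ bad i -> hfil (p i.2) (De i.2) (De i.2) (deg i.2).+1 (e i.2).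
Proof. by move=> /goodP[_ cD]; have := hfil_gen i.2; rewrite cD. Qed.

Lemma estar_good i n x : ~~ bad i -> x \in J n -> estar i x \in J (deg i.2 + n).
Proof.
move=> gi xJ; have [i1 cD] := goodP gi.
have := Jt_ideal_l hH hg hep hpre (hfil_good gi) xJ.
by rewrite /estar i1 cD addSn.
Qed.

(** The letters to the left of the first bad letter are good, and J is stable
    under them. *)
Lemma eword_bad s : has bad s -> eword s \in J (wdeg s).+2.
Proof.
elim: s => [//|i s IH] /=; have [bi _|gi /= /IH] := boolP (bad i).
  apply: (mem_Jt (hfil_gen i.2) (eword_Fil s)); last by rewrite -badP.
  by rewrite addSn addnS.
by move=> /(estar_good gi); rewrite !addnS.
Qed.

Lemma wdeg_cons i s : wdeg (i :: s) = (deg i.2 + wdeg s)%N. Proof. by []. Qed.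

Lemma wdeg_perm s t : perm_eq s t -> wdeg s = wdeg t.
Proof. by move=> st; apply/perm_sumn/perm_map. Qed.

Lemma eword_swapF A i j B :
  eword (A ++ i :: j :: B) - sgn (p i.2) (p j.2) *: eword (A ++ j :: i :: B)
    \in F (wdeg (A ++ i :: j :: B)).
Proof.
elim: A => [|a A IH] /=.
  rewrite /estar; apply: (star_comm_mem (hfil_gen i.2) (hfil_gen j.2)) => l M _.
  have [_ _ xF] := hfil_np0 hH hg hep hpre l (hfil_gen i.2) (hfil_gen j.2).
  apply: Fil_mono (stF _ _ xF (eword_Fil B)).
  by rewrite !wdeg_cons; lia.
rewrite -(linZ (estar_linear a)) -(linB (estar_linear a)).
have := stF (- a.1%:Z - 1) (ce a.2) (Fil_gen VA e deg a.2) IH.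
by rewrite wdeg_cons addSn.
Qed.

(** This improves [eword_swapF] for words with a bad letter: the terms produced by
    the swap have lower degree and still are in J.  If one of the swapped letters
    is bad then this is [comm_Jt]; otherwise the commutator acts as an untwisted
    element on a word that contains a bad letter. *)
Lemma eword_swapJ A i j B : has bad (A ++ i :: j :: B) ->
  eword (A ++ i :: j :: B) - sgn (p i.2) (p j.2) *: eword (A ++ j :: i :: B)
    \in J (wdeg (A ++ i :: j :: B)).+1.
Proof.
elim: A => [|a A IH] /=; last first.
  rewrite -(linZ (estar_linear a)) -(linB (estar_linear a)).
  have [ba _|ga /= hb] := boolP (bad a).
    apply: (mem_Jt (hfil_gen a.2) (eword_swapF A i j B)); last by rewrite -badP.
    by move=> _ _; rewrite wdeg_cons; lia.
  by have := estar_good ga (IH hb); rewrite addnS.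
have e1 : -1 < ce i.2 - De i.2 <= 0 by case: (heD i.2).
have e2 : -1 < ce j.2 - De j.2 <= 0 by case: (heD j.2).
have [bij _|] := boolP (bad i || bad j).
  have := comm_Jt hH hg hep hpre (hfil_gen i.2) (hfil_gen j.2) (eword_Fil B)
    (k := - i.1%:Z - 1) (l := - j.1%:Z - 1).
  rewrite [X in J X](_ : _ = (wdeg [:: i, j & B]).+1); last by rewrite !wdeg_cons; lia.
  apply; rewrite /chi; move: bij; rewrite /bad.
  have := thr_le (ce i.2 - De i.2 + (ce j.2 - De j.2) + 1).
  case: (leP (ce i.2 - De i.2 + (ce j.2 - De j.2)) (-1)) => h.
    by rewrite mulr1n; lia.
  rewrite mulr0n !addr0 => _; rewrite /thr.
  case: (eqVneq (ce i.2 - De i.2 + (ce j.2 - De j.2)) 0) => [h0|_ _]; last by lia.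
  have -> : ce i.2 - De i.2 = 0 by lra.
  have -> : ce j.2 - De j.2 = 0 by lra.
  by rewrite eqxx /=; lia.
rewrite negb_or => /andP[gi gj]; rewrite (negbTE gi) (negbTE gj) /= => hB.
have [i1 ci] := goodP gi; have [j1 cj] := goodP gj.
rewrite /estar; apply: (star_comm_mem (hfil_gen i.2) (hfil_gen j.2)) => l M.
have := hfil_np0 hH hg hep hpre l (hfil_gen i.2) (hfil_gen j.2).
rewrite ci cj !subrr chi0l ?ltrN10// mulr0n addr0 i1 j1 => hx hM.
(* Products with M < -1 are in J anyway. *)
have [M1|M1] := eqVneq M (-1).
  rewrite M1; apply: Jt_mono (Jt_ideal_l hH hg hep hpre hx (eword_bad hB)).
  by rewrite !wdeg_cons; lia.
apply: (mem_Jt hx (eword_Fil B)).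
  by move=> _ _; rewrite !wdeg_cons; lia.
by rewrite subrr /thr eqxx; lia.
Qed.

(** Replacing a product e_alpha_(-k-1) by e_alpha *_{-k-1} changes it by products
    with larger indices, which have a smaller k or a lower degree. *)
Lemma eword_span m v : v \in F m -> v \in lspan (eword @` [set s | (wdeg s < m)%N]).
Proof.
elim/ltn_ind: m v => m IHm; apply: lspan_sub => _ [s sm <-].
case: s sm => [|[k a] s] sm; first by apply: mem_lspan; exists [::].
rewrite /= wdeg_cons /= in sm.
rewrite mword_cons /=.
have sm' : ((wdeg s).+1 < m)%N by apply: leq_ltn_trans sm; rewrite -add1n leq_add2r.
have := IHm _ sm' _ (mword_Fil VA e (ltnSn (wdeg s))).
apply: (lspan_lin (npr VA _ (e a))) => _ [t tm <-].
elim/ltn_ind: k => k IHk.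
have := evz_gb VA (gbinom (ce a)) (- k%:Z - 1) (e a) (eword t) => ev.
have := S_recl ev; rewrite -/(star (- k%:Z - 1) (ce a) (e a) (eword t)).
rewrite gb0 scale1r addr0 => h.
rewrite -[(e a) _(_) _](addrK (\S_ j (gbinom (ce a) j.+1 *: ((e a) _(- k%:Z - 1 + j.+1%:Z) (eword t))))).
rewrite -h; apply: rpredB.
  apply: mem_lspan; exists ((k, a) :: t) => //=.
  by rewrite wdeg_cons /=; apply: leq_ltn_trans sm; rewrite leq_add2l -ltnS.
apply: S_mem => j; apply: rpredZ.
have [jk|kj] := ltnP j k.
  rewrite (@npE _ _ _ _ (- (k - j.+1)%N%:Z - 1)); last by lia.
  by apply: IHk; rewrite ltn_subrL /=; case: (k) jk.
have hF : (e a) _(- k%:Z - 1 + j.+1%:Z) (eword t) \in F (deg a + wdeg t).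
  have := npF0 (k := - k%:Z - 1 + j.+1%:Z) (Fil_gen VA e deg a) (eword_Fil t).
  by rewrite addSn addnS /=; apply; lia.
have am : (deg a + wdeg t < m)%N by apply: leq_ltn_trans sm; rewrite leq_add2l -ltnS.
apply: lspan_mono (IHm _ am _ hF) => _ [u ut <-]; exists u => //.
exact: ltn_trans am.
Qed.

Lemma two_neq0 : (2%:R : K) != 0. Proof. by rewrite pnatr_eq0. Qed.

Definition Jadm : set V := eword @` [set s | adm s /\ has bad s].

Lemma eword_bad_sorted s : has bad s ->
  eword s \in lspan (Jadm `|` [set x | x \in J (wdeg s).+1]).
Proof.
move=> bs; apply: (sorting_mem (od := fun i : nat * I => p i.2) two_neq0 (@index_lt_trans _ I)
  (@index_lt_total _ I)) => [A i j B pe|t pe adt].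
  apply: mem_lspan; right => /=; rewrite -(wdeg_perm pe).
  by apply: eword_swapJ; rewrite (perm_has _ pe).
by apply: mem_lspan; left; exists t => //; split=> //; rewrite (perm_has _ pe).
Qed.

(** By [Jt_J1] an element of J is a combination of words starting with a bad
    letter, up to lower degree; sorting such a word keeps the bad letter. *)
Theorem Jt_adm n x : x \in J n -> x \in lspan Jadm.
Proof.
elim: n x => [|n IH] x; first by move=> /Jt0 ->; apply: rpred0.
move=> /Jt_J1; move: x; apply: lspan_sub => x [|/IH//].
move=> [a [k [b [m [bF mn kt ->]]]]].
have := eword_span bF; move: b {bF}; apply: (lspan_lin (star_r VA k (ce a) (e a))).
move=> _ [s sm <-].
have k1 : k = - (absz k).-1%:Z - 1 by have := thr_le (ce a - De a); lia.
have -> : star k (ce a) (e a) (eword s) = eword (((absz k).-1, a) :: s).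
  by rewrite [in LHS]k1.
have bs : has bad (((absz k).-1, a) :: s) by rewrite /= badP /= -k1 kt.
apply: lspan_sub (eword_bad_sorted bs) => y [|/= yJ]; first exact: mem_lspan.
apply: IH; apply: Jt_mono yJ; rewrite wdeg_cons /=.
by move: sm mn => /=; lia.
Qed.

Lemma mword_swapF A i j B :
  mword (A ++ i :: j :: B) - sgn (p i.2) (p j.2) *: mword (A ++ j :: i :: B)
    \in F (wdeg (A ++ i :: j :: B)).
Proof.
elim: A => [|a A IH].
  rewrite /= !mword_cons (np_comm _ _ _ (hep i.2) (hep j.2)) addrC addKr.
  apply: S_mem => l; apply: rpredZ.
  have xF := npF0 (Fil_gen VA e deg i.2) (Fil_gen VA e deg j.2) (isT : 0 <= l%:Z).
  apply: Fil_mono (npF _ xF (mword_Fil VA e (ltnSn (wdeg B)))).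
  by rewrite !wdeg_cons; lia.
rewrite !cat_cons !mword_cons -(linZ (npr _ _ _)) -(linB (npr _ _ _)) wdeg_cons.
by apply: Fil_cons => //; lia.
Qed.

Lemma Fil_adm m v : v \in F m -> v \in lspan (mword @` [set s | adm s /\ (wdeg s < m)%N]).
Proof.
elim/ltn_ind: m v => m IHm; apply: lspan_sub => _ [s sm <-].
apply: (sorting_mem (od := fun i : nat * I => p i.2) two_neq0 (@index_lt_trans _ I)
  (@index_lt_total _ I)) => [A i j B pe|t pe adt].
  have sm' : (wdeg (A ++ i :: j :: B) < m)%N by rewrite (wdeg_perm pe).
  apply: lspan_mono (IHm _ sm' _ (mword_swapF A i j B)) => _ [u [au ut] <-].
  by exists u => //; split=> //; apply: ltn_trans sm'.
by apply: mem_lspan; exists t => //; split=> //; rewrite /= (wdeg_perm pe).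
Qed.

(** Sorting a word of the given basis only adds words of lower degree. *)
Lemma mword_adm s : mword s \in
  lspan (mword @` [set t | adm t /\ (perm_eq t s \/ (wdeg t < wdeg s)%N)]).
Proof.
apply: (sorting_mem (od := fun i : nat * I => p i.2) two_neq0 (@index_lt_trans _ I)
  (@index_lt_total _ I)) => [A i j B pe|t pe adt].
  have := Fil_adm (mword_swapF A i j B); apply: lspan_mono => _ [u [au ut] <-].
  by exists u => //; split=> //; right; rewrite -(wdeg_perm pe).
by apply: mem_lspan; exists t => //; split=> //; left.
Qed.

(** The number of derivatives in a word; with the degree it gives the order with
    respect to which the two families of words are triangular. *)
Definition kap s : nat := sumn [seq i.1 | i <- s].
Definition low (n k : nat) : set V :=
  mword @` [set t | (wdeg t < n)%N || (wdeg t == n) && (kap t < k)%N].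

Lemma low_cons a (k j n l : nat) v : v \in lspan (low n l) ->
  (e a) _(- k%:Z - 1 + j%:Z) v \in lspan (low (deg a + n) (k + l)).
Proof.
move: v; apply: (lspan_lin (npr _ _ _)) => _ [t tl <-].
have tn : (wdeg t <= n)%N by case/orP: tl => [/ltnW//|/andP[/eqP ->]].
have [jk|kj] := leqP j k.
  apply: mem_lspan; exists ((k - j, a) :: t)%N; last first.
    by rewrite mword_cons /=; apply: npE; lia.
  rewrite /= wdeg_cons /kap /= -/(kap t) ltn_add2l eqn_add2l.
  by case/orP: tl => [->//|/andP[-> tk]]; apply/orP; right; rewrite /=; lia.
have := npF0 (k := - k%:Z - 1 + j%:Z) (Fil_gen VA e deg a) (mword_Fil VA e (ltnSn (wdeg t))).
rewrite addSn addnS /= => /(_ ltac:(lia)); apply: lspan_mono => _ [u ut <-].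
by exists u => //=; apply/orP; left; apply: leq_trans ut _; rewrite leq_add2l.
Qed.

(** Each letter x -> e_alpha *_{-k-1} x is x -> e_alpha_(-k-1)x plus products with
    larger indices, which contain fewer derivatives or, if the index is
    nonnegative, have lower degree. *)
Lemma eword_low s : eword s - mword s \in lspan (low (wdeg s) (kap s)).
Proof.
elim: s => [|[k a] s IH]; first by rewrite subrr rpred0.
rewrite mword_cons /= wdeg_cons /kap /= -/(kap s).
rewrite -[eword s](subrK (mword s)) (linD (estar_linear _)) -addrA; apply: rpredD.
  apply: S_mem => j; apply: rpredZ; exact: low_cons.
rewrite /estar /starn S_recl /=; last exact: evz_gb.
rewrite gb0 scale1r addr0 addrC addrA addNr add0r.
apply: S_mem => j; apply: rpredZ.
have [jk|kj] := leqP j.+1 k.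
  apply: mem_lspan; exists ((k - j.+1, a) :: s)%N; last first.
    by rewrite mword_cons /=; apply: npE; lia.
  by rewrite /= wdeg_cons eqxx /kap /= -/(kap s); apply/orP; right; lia.
have := npF0 (k := - k%:Z - 1 + j.+1%:Z) (Fil_gen VA e deg a) (mword_Fil VA e (ltnSn (wdeg s))).
rewrite addSn addnS /= => /(_ ltac:(lia)); apply: lspan_mono => _ [u ut <-].
by exists u => //=; apply/orP; left.
Qed.

Definition rank s : (nat *l nat)%type := (wdeg s, kap s).

(** The words in the products *_n are triangular with respect to the given basis,
    for the lexicographic order of degree and number of derivatives. *)
Lemma eword_free (S : seq (seq (nat * I))) (c : seq (nat * I) -> K) : uniq S ->
  (forall s, s \in S -> adm s) -> \sum_(s <- S) c s *: eword s = 0 ->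
  forall s, s \in S -> c s = 0.
Proof.
apply: (triangular_free (r := rank) hfree) => s _.
have := eword_low s; apply: lspan_sub => _ [t tl <-].
apply: lspan_mono (mword_adm t) => _ [u [au ut] <-]; exists u => //; split=> //.
rewrite /rank Order.ProdLexiOrder.ltEprodlexi /=.
have kp : perm_eq u t -> kap u = kap t by move=> pu; apply/perm_sumn/perm_map.
case: ut => [pu|ut]; last first.
  have us : (wdeg u < wdeg s)%N.
    by apply: leq_trans ut _; case/orP: tl => [/ltnW//|/andP[/eqP ->]].
  by rewrite /Order.le /Order.lt /=; move: us; lia.
rewrite (wdeg_perm pu) (kp pu) /Order.le /Order.lt /=.
case/orP: tl => [tl|/andP[/eqP -> ->]]; last by rewrite !leqnn.
by rewrite (ltnW tl) /= leqNgt tl.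
Qed.

Theorem eword_free_mod_J n (S : seq (seq (nat * I))) (c : seq (nat * I) -> K) : uniq S ->
  (forall s, s \in S -> adm s /\ ~~ has bad s) ->
  \sum_(s <- S) c s *: eword s \in J n -> forall s, s \in S -> c s = 0.
Proof.
move=> uS SP /Jt_adm SJ.
apply: (free_disjoint eword_free (Q := [set s | adm s /\ has bad s])) SJ => //.
  by move=> s [].
by move=> s /SP[ads /negP bs]; split=> // -[].
Qed.

End PBW.

(** * Direct sums over parities and discrete groups of degrees *)

Section DirectSums.
Context {K : fieldType} {W : lmodType K}.

Lemma subspace_span (A : set W) v : is_subspace A -> v \in lspan A -> A v.
Proof. by move=> [A0 AL]; move: v; apply: lspan_ind => // c u v Au Av; apply: AL. Qed.

Lemma span_subspace (A : set W) : is_subspace [set v | v \in lspan A].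
Proof. by split=> [|c u v uA vA] /=; [exact: rpred0|rewrite rpredD// rpredZ]. Qed.

Section Boolean.
Context (F : bool -> set W) (hF : is_direct_sum [set: bool] F).

Lemma dsum_eq0 v0 v1 : F false v0 -> F true v1 -> v0 + v1 = 0 -> v0 = 0 /\ v1 = 0.
Proof.
move=> F0 F1 v01; have [_ _ dF] := hF.
have := dF [:: false; true] (fun q => if q then v1 else v0) isT.
rewrite !big_cons big_nil addr0 => dF'.
have fk : forall k, k \in [:: false; true] -> [set: bool] k /\ F k (if k then v1 else v0).
  by case.
by split; [apply: (dF' fk v01 false)|apply: (dF' fk v01 true)].
Qed.

Lemma dsum_inj v0 v1 u0 u1 : F false v0 -> F true v1 -> F false u0 -> F true u1 ->
  v0 + v1 = u0 + u1 -> v0 = u0 /\ v1 = u1.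
Proof.
have [sF _ _] := hF => F0 F1 G0 G1 /eqP; rewrite -subr_eq0 => /eqP h.
have FB q u v : F q u -> F q v -> F q (u - v).
  by move=> Fu Fv; rewrite addrC -scaleN1r; apply: (sF q I).2.
have [|] := dsum_eq0 (FB _ _ _ F0 G0) (FB _ _ _ F1 G1).
  by rewrite -h; lmod K.
by move=> /eqP + /eqP; rewrite !subr_eq0 => /eqP -> /eqP ->.
Qed.

(** Grouping the terms of a combination of homogeneous vectors by parity gives
    one element in each summand, and the decomposition is unique. *)
Lemma dsum_split {T : Type} (P : set T) (f : T -> W) (lab : T -> bool) v0 v1 :
  (forall t, P t -> F (lab t) (f t)) -> F false v0 -> F true v1 ->
  v0 + v1 \in lspan (f @` P) ->
  v0 \in lspan (f @` [set t | P t /\ lab t = false]) /\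
  v1 \in lspan (f @` [set t | P t /\ lab t = true]).
Proof.
move=> Fl F0 F1 vs; pose B r := [set v | v \in lspan (f @` [set t | P t /\ lab t = r])].
have [sF _ _] := hF.
have BF r u : B r u -> F r u.
  move=> Bu; apply: (subspace_span (sF r I)); move: u Bu.
  by apply: lspan_mono => _ [t [Pt <-] <-]; apply: Fl.
have [u0 [u1 [B0 B1 vE]]] : exists u0 u1, [/\ B false u0, B true u1 & v0 + v1 = u0 + u1].
  move: (v0 + v1) vs; apply: lspan_ind.
    by exists 0, 0; rewrite addr0; split=> //; apply: rpred0.
  move=> c _ v [t Pt <-] [u0 [u1 [B0 B1 ->]]]; case lt : (lab t).
    exists u0, (c *: f t + u1); split=> //; last by rewrite addrCA.
    by apply: (span_subspace _).2 => //; apply: mem_lspan; exists t.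
  exists (c *: f t + u0), u1; split=> //; last by rewrite addrA.
  by apply: (span_subspace _).2 => //; apply: mem_lspan; exists t.
by have [-> ->] := dsum_inj F0 F1 (BF _ _ B0) (BF _ _ B1) vE.
Qed.

(** This is [dsum_split] with the component of the other parity equal to 0. *)
Lemma dsum_label {T : Type} (P : set T) (f : T -> W) (lab : T -> bool) q v :
  (forall t, P t -> F (lab t) (f t)) -> F q v -> v \in lspan (f @` P) ->
  v \in lspan (f @` [set t | P t /\ lab t = q]).
Proof.
move=> Fl Fv vs; have [sF _ _] := hF.
have F0 r : F r 0 by case: (sF r I).
case: q Fv => Fv.
  by have [] := dsum_split Fl (F0 false) Fv; rewrite ?add0r.
by have [] := dsum_split Fl Fv (F0 true); rewrite ?addr0.
Qed.

Lemma bool_proj : exists pr : bool -> W -> W,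
  [/\ forall q, linear (pr q), forall q v, F q (pr q v),
      forall v, v = pr false v + pr true v
    & forall q v, F q v -> pr q v = v /\ pr (~~ q) v = 0].
Proof.
have [sF tF _] := hF.
have F0 r : F r 0 by case: (sF r I).
have ex v : exists u : W * W, [/\ F false u.1, F true u.2 & v = u.1 + u.2].
  move: v (tF v); apply: lspan_ind; first by exists (0, 0); rewrite addr0.
  move=> c u v [q _ Fu] [[u0 u1] [/= B0 B1 ->]]; case: q Fu => Fu.
    by exists (u0, c *: u + u1); split=> //=; [apply: (sF _ I).2|rewrite addrCA].
  by exists (c *: u + u0, u1); split=> //=; [apply: (sF _ I).2|rewrite addrA].
have [f fE] := choice ex.
exists (fun q v => if q then (f v).2 else (f v).1); split.
- have lin c u v : (f (c *: u + v)).1 = c *: (f u).1 + (f v).1 /\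
                   (f (c *: u + v)).2 = c *: (f u).2 + (f v).2.
    have [a1 a2 a3] := fE (c *: u + v); have [b1 b2 b3] := fE u; have [c1 c2 c3] := fE v.
    apply: dsum_inj => //; try by apply: (sF _ I).2.
    by rewrite -a3 {1}b3 {1}c3; rewrite scalerDr; lmod K.
  by case=> c u v; case: (lin c u v).
- by move=> q v; have [] := fE v; case: q.
- by move=> v; have [] := fE v.
move=> q v Fv; have [a1 a2 a3] := fE v; case: q Fv => Fv /=.
  by have [|<- <-] := dsum_inj (F0 false) Fv a1 a2; rewrite ?add0r.
by have [|<- <-] := dsum_inj Fv (F0 true) a1 a2; rewrite ?addr0.
Qed.

End Boolean.

Lemma bool_direct_sum (F : bool -> set W) : (forall q, is_subspace (F q)) ->
  (forall v, v \in lspan (\bigcup_(q in [set: bool]) F q)) ->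
  (forall v0 v1, F false v0 -> F true v1 -> v0 + v1 = 0 -> v0 = 0) ->
  is_direct_sum [set: bool] F.
Proof.
move=> sF tF dF; split=> // s f us sP fs k ks.
have F0 r : F r 0 by case: (sF r).
pose h q := if q \in s then f q else 0.
have Fh q : F q (h q) by rewrite /h; case: ifP => // /sP[].
have sumh : h false + h true = 0.
  rewrite -fs; have -> : \sum_(k <- s) f k = \sum_(k <- [:: false; true] | k \in s) f k.
    rewrite -[RHS]big_filter; apply: perm_big; apply: uniq_perm => //.
      by rewrite filter_uniq.
    by move=> q; rewrite mem_filter; case: (q) => //=; rewrite !inE ?orbT ?andbT.
  by rewrite !big_cons big_nil /h; do !case: ifP => _; rewrite ?addr0 ?add0r.
have h0 := dF _ _ (Fh false) (Fh true) sumh.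
move: sumh; rewrite h0 add0r => h1.
by case: k ks h0 h1 => ks; rewrite /h ks.
Qed.

Section BasisMaps.
Context {T : choiceType} (P : set T) (f : T -> W) (hf : is_basis P f).

(** The projection to the summand of label l is defined on the basis. *)
Lemma basis_direct_sum {L : choiceType} (Q : set L) (lab : T -> L) :
  (forall t, P t -> Q (lab t)) ->
  is_direct_sum Q (fun l => [set v | v \in lspan (f @` [set t | P t /\ lab t = l])]).
Proof.
move=> PQ; split=> [l _|v|s F us sF s0 l ls]; first exact: span_subspace.
  apply: lspan_mono (hf.1 v) => _ [t Pt <-]; exists (lab t); first exact: PQ.
  by apply: mem_lspan; exists t.
have [M [lM ME]] := basis_ext hf (fun t => if lab t == l then f t else 0).
have MF k v : v \in lspan (f @` [set t | P t /\ lab t = k]) ->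
    M v = if k == l then v else 0.
  move: v; apply: lspan_ind; first by rewrite (lin0 lM); case: ifP.
  move=> c _ v [t [Pt <-] <-] IH; rewrite lM ME// IH.
  by case: ifP; rewrite // scaler0 addr0.
have := congr1 M s0; rewrite (lin_sum lM) (lin0 lM) (bigD1_seq l)//= big_seq_cond big1.
  by rewrite addr0 (MF l) ?eqxx//; apply: (sF l ls).2.
by move=> k /andP[/sF[_ /MF ->] /negbTE ->].
Qed.

End BasisMaps.
End DirectSums.

Section Degrees.
Context {R : realType} (G : set R) (hG : is_discrete_subgroup G).

(** If G has a positive element then it has a smallest one, because elements of G
    at distance less than eps are equal, and this one generates G by division
    with remainder.  Otherwise G = 0 and eta is arbitrary. *)
Lemma discrete_cyclic : exists eta : R, [/\ 0 < eta,
  forall x, G x -> exists k : int, x = k%:~R * eta & (exists z, Gpos G z) -> G eta].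
Proof.
have [G0 GB Gd] := hG.
have [eps eps0 Ge] : exists2 eps : R, 0 < eps & forall y, G y -> `|y| < eps -> y = 0.
  have /nbhs_ballP[eps /= eps0 he] := Gd 0 G0; exists eps => // y Gy ye; apply: he => //.
  by rewrite /ball /= sub0r normrN.
have Gmul (k : int) y : G y -> G (k%:~R * y).
  move=> Gy; have GN z : G z -> G (- z) by move=> Gz; rewrite -sub0r; apply: GB.
  have GD u v : G u -> G v -> G (u + v) by move=> Gu Gv; rewrite -[v]opprK; apply/GB/GN.
  have Gn (n : nat) : G (n%:R * y).
    by elim: n => [|n IH]; rewrite ?mul0r// -natr1 mulrDl mul1r; apply: GD.
  case: k => n; first exact: Gn.
  by rewrite NegzE mulrNz mulNr; apply/GN/Gn.
have [[z0 Gz0]|noG] := pselect (exists z, Gpos G z); last first.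
  exists 1; split=> // x Gx; exists 0; rewrite mul0r.
  apply/eqP/negPn/negP => x0; apply: noG; have [xp|xn] := ltP 0 x; first by exists x.
  exists (0 - x); split; first exact: GB.
  by rewrite sub0r oppr_gt0 lt_neqAle x0.
have [m [Gm mmin]] : exists m, Gpos G m /\ forall y, Gpos G y -> m <= y.
  have [n zn] : exists n : nat, z0 < n%:R * eps.
    exists (Num.truncn (z0 / eps)).+1; rewrite -ltr_pdivrMr//.
    by have /andP[] := truncn_itv (ltW (divr_gt0 Gz0.2 eps0)).
  elim: n z0 Gz0 zn => [z [_ z0]|n IH z Gz zn]; first by rewrite mul0r ltNge ltW.
  have [[y [Gy yz]]|no] := pselect (exists y, Gpos G y /\ y < z); last first.
    exists z; split=> // y Gy; rewrite leNgt; apply/negP => yz; apply: no; by exists y.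
  apply: (IH y) => //; rewrite ltNge; apply/negP => h.
  have : z - y = 0.
    apply: Ge; first by apply: GB; [case: Gz|case: Gy].
    by rewrite gtr0_norm ?subr_gt0//; move: zn; rewrite -natr1 mulrDl mul1r; lra.
  by move=> /eqP; rewrite subr_eq0 => /eqP zy; rewrite zy ltxx in yz.
have m0 : 0 < m by case: Gm.
exists m; split=> //; last by case: Gm.
move=> x Gx; exists (Num.floor (x / m)); apply/eqP; rewrite -subr_eq0.
have /andP[f1 f2] := floor_itv (x / m).
rewrite ler_pdivlMr// in f1; rewrite ltr_pdivrMr// intrD mulrDl mul1r in f2.
apply/negPn/negP => ne0.
have : m <= x - (Num.floor (x / m))%:~R * m.
  apply: mmin; split; first by apply: GB => //; apply: Gmul; case: Gm.
  by rewrite lt_neqAle eq_sym ne0 subr_ge0.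
by apply/negP; rewrite -ltNge; lra.
Qed.

Context (eta : R) (eta0 : 0 < eta) (Geta : forall x, G x -> exists k : int, x = k%:~R * eta).
Context (Ge : G eta).

Lemma Gmuln (k : nat) : G (k%:R * eta).
Proof.
have [G0 GB Gd] := hG.
elim: k => [|k IH]; rewrite ?mul0r// -natr1 mulrDl mul1r -[eta in _ + eta]opprK.
by apply: (GB) => //; rewrite -sub0r; apply: (GB).
Qed.

(** The multiples of eta are the elements of G, so (k + 1) eta is preceded by
    k eta. *)
Lemma Gprev_nat (k : nat) : Gprev G (k.+1%:R * eta) = k%:R * eta.
Proof.
apply: xget_unique => /=.
  split; first by split; [exact: Gmuln|rewrite mulr_ge0 ?ler0n// ltW].
    by rewrite ltr_pM2r// ltr_nat.
  move=> x [/Geta[l ->] _]; rewrite ltr_pM2r// ler_pM2r//.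
  by rewrite [in X in X -> _](ltr_int R l k.+1) (ler_int R l k); lia.
move=> y [[Gy y0] yk ymax].
apply/eqP; rewrite eq_le ymax ?andbT//; last first.
- by rewrite ltr_pM2r// ltr_nat.
- by split; [exact: Gmuln|rewrite mulr_ge0 ?ler0n// ltW].
move: yk; have [l ->] := Geta Gy; rewrite ltr_pM2r// ler_pM2r//.
by rewrite [in X in X -> _](ltr_int R l k.+1) (ler_int R l k); lia.
Qed.

End Degrees.

Section Pregraded.
Context {R : realType} {V : lmodType R[i]} (VA : vertexSuperalgebra V).
Context (G : set R) {I : Type} (e : I -> V) (zeta : I -> R) (deg : I -> nat) (eta : R).
Context (eta0 : 0 < eta) (zetaE : forall i, zeta i = (deg i)%:R * eta).

Lemma vfil_Fil z (m : nat) v : z < m%:R * eta -> v \in vfil VA G e zeta z ->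
  v \in Fil VA e deg m.
Proof.
move=> zm; move: v; apply: lspan_sub => _ [s [sP sz ->]].
have {zm sz} : \sum_(t <- s) t.2 < m%:R * eta by apply: le_lt_trans zm.
elim: s m sP => [|[[k v] y] s IH] m sP; rewrite ?big_nil ?big_cons /= => sm.
  apply: (mword_Fil VA e (s := [::])).
  by rewrite lt0n; apply: contraTneq sm => ->; rewrite mul0r ltxx.
have [_ /=] := sP (k, v, y) (mem_head _ _).
have {}sP t : t \in s -> Gpos G t.2 /\ t.1.2 \in gen_deg e zeta t.2.
  by move=> ts; apply: sP; rewrite inE ts orbT.
have npr' : linear (fun v => nprod VA (-1) (iter k (der VA) v)
    (normal_product VA [seq iter t.1.1 (der VA) t.1.2 | t <- s])).
  exact: lin_comp (npl VA _ _) (iter_der_linear VA k).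
move: v; apply: (lspan_lin npr') => _ [i zi <-].
rewrite iter_der_np; apply: rpredZ.
have di : (deg i <= m)%N.
  rewrite -(ler_nat R) -(ler_pM2r eta0) -zetaE zi; apply: ltW; apply: le_lt_trans sm.
  rewrite lerDl big_seq sumr_ge0// => t /sP[[_ /ltW//]].
rewrite -(subnKC di); apply: Fil_cons; first lia.
by apply: IH => //; rewrite natrB// mulrBl -zetaE zi; move: sm => /=; lra.
Qed.

End Pregraded.

(** * The Zhu algebra *)

Section ZhuAlgebra.
Context {R : realType} {V : lmodType R[i]} (VA : vertexSuperalgebra V).
Context (H g : V -> V) (hH : is_hamiltonian VA H) (hg : is_automorphism VA g).
Local Notation "a _( n ) b" := (nprod VA n a b)
  (at level 35, n at level 200, b at level 35).
Local Notation K := (R[i]).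
Local Notation star := (starn VA).
Local Notation hn := (hom_norm H g).
Context {d : Order.disp_t} {I : orderType d} (e : I -> V) (p : I -> bool) (deg : I -> nat).
Context (ce De : I -> R).
Context (hep : forall i, vpar VA (p i) (e i)).
Context (heD : forall i, hn (ce i) (De i) (e i)).
Context (hdeg : forall i, (0 < deg i)%N).
Context (hpre : forall i j (n : nat), (e i) _(n%:Z) (e j) \in Fil VA e deg (deg i + deg j)).
Context (hfree : freely_generated VA p e).
Local Notation F := (Fil VA e deg).
Local Notation mword := (mword VA e).
Local Notation wdeg := (wdeg deg).
Local Notation J := (Jt VA H g e deg).
Local Notation hfil := (hfil VA H g e deg).
Local Notation U := (VgH H g).
Local Notation untw := (untwisted H g).
Local Notation Jg := (JgH VA H g).

(** The words span V and are eigenvectors of g and H. *)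
Lemma bihom_words c D a : bihom H g c D a ->
  a \in lspan (mword @` [set s | bihom H g c D (mword s)]).
Proof.
move=> [ga Ha]; have [lH _ _] := hH; have [lg _ _ _ _] := hg.
have aw : a \in lspan (range mword).
  have [n] := Fil_all deg hfree a.
  by apply: lspan_mono => _ [s _ <-]; exists s.
have gw w : range mword w -> exists m, g w = m *: w.
  by move=> [s _ <-]; have [c' [D' [[h _] _]]] := mword_hom hH hg heD s; exists (expi c').
have Hw w : (range mword w /\ g w = expi c *: w) -> exists m, H w = m *: w.
  move=> [[s _ <-] _]; have [c' [D' [[_ h] _]]] := mword_hom hH hg heD s.
  by exists ((D'%:C)%C).
have := eig_span lH Hw (eig_span lg gw aw ga) Ha.
by apply: lspan_mono => _ [[[s _ <-] h1] h2]; exists s.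
Qed.

Lemma hn_words c D a : hn c D a -> a \in lspan (mword @` [set s | hn c D (mword s)]).
Proof.
move=> [/bihom_words h nrm]; move: h; apply: lspan_mono => _ [s hs <-].
by exists s.
Qed.

Lemma hfil_word s c D : hn c D (mword s) -> hfil (wpar p s) c D (wdeg s).+1 (mword s).
Proof. by move=> hs; split=> //; [exact: mword_par|apply: mword_Fil]. Qed.

Definition Jh : {pred V} := lspan [set x | exists n, x \in J n].
HB.instance Definition _ := GRing.SubmodClosed.on Jh.

Lemma JhP x : x \in Jh -> exists n, x \in J n.
Proof.
move: x; apply: lspan_ind => [|c u v [m um] [n vn]]; first by exists 0%N; apply: rpred0.
exists (maxn m n); rewrite rpredD ?rpredZ//.
  exact: Jt_mono (leq_maxl m n) um.
exact: Jt_mono (leq_maxr m n) vn.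
Qed.

Lemma mem_Jh n x : x \in J n -> x \in Jh.
Proof. by move=> xn; apply: mem_lspan; exists n. Qed.

Lemma star_Jh q c D m a b (k : int) : hfil q c D m a -> k <= thr (c - D) ->
  star k c a b \in Jh.
Proof.
move=> ha kt; have [n bn] := Fil_all deg hfree b.
apply: (mem_Jh (n := m + n)); exact: (mem_Jt ha bn).
Qed.

(** The operator g o theta_H^-1, whose eigenvalue exp (2 pi i epsilon_a) measures
    the twist. *)
Lemma twist_op : exists T : V -> V, linear T /\
  forall c D a, bihom H g c D a -> T a = expi (c - D) *: a.
Proof.
have [lH dH _] := hH; have [lg _ _ _ _] := hg.
have [dec h] := spectral_calculus lH dH.
have lphi (c : K) : linear (fun v : V => expi (- complex.Re c) *: v).
  by move=> z u v; rewrite scalerDr !scalerA mulrC.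
have [lT TE] := h V _ lphi.
exists (fun a => g (\sum_(x <- dec a) expi (- complex.Re x.1) *: x.2)).
split; first exact: lin_comp lg lT.
by move=> c D a [ga Ha]; rewrite (TE _ _ Ha) (linZ lg) ga scalerA mulrC -expiD.
Qed.

Lemma VgH_words v : v \in U -> v \in lspan (mword @` [set s | untw (mword s)]).
Proof.
move: v; apply: lspan_sub => v [D /bihom_words]; apply: lspan_mono => _ [s hs <-].
by exists s => //; exists D.
Qed.

Lemma untw_hn a : untw a -> exists D, hn D D a.
Proof. by move=> [D ha]; exists D; split=> //; rewrite subrr lexx ltrN10. Qed.

Lemma untw_VgH a : untw a -> a \in U. Proof. exact: mem_lspan. Qed.

(** The sum of two numbers in ]-1, 0] is an integer only if it is -1 or if both
    are 0. *)
Lemma thr_int (x y : R) (m : int) : -1 < x <= 0 -> -1 < y <= 0 -> x + y = m%:~R ->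
  (if x + y <= -1 then -1 else -2) <= thr x /\ (x + y <= - 1 -> x + y = -1) /\
  (-1 < x + y -> x = 0 /\ y = 0).
Proof.
move=> hx hy xy.
have m01 : m = 0 \/ m = -1.
  have : (-2)%:~R < m%:~R :> R by rewrite -xy rmorphN /=; lra.
  have : m%:~R <= 0%:~R :> R by rewrite -xy /=; lra.
  by rewrite ltr_int ler_int; lia.
have := thr_le x; case: m01 => mE; rewrite mE ?rmorphN /= in xy.
  have -> : x = 0 by lra.
  have -> : y = 0 by lra.
  have n1 : (0 <= -1 :> R) = false by rewrite leNgt ltrN10.
  by rewrite addr0 /thr eqxx n1 ltrN10.
have -> : x + y <= -1 by rewrite xy.
rewrite /thr; case: eqP => [x0|_] _; first by lra.
by split=> //; split; lra.
Qed.

Lemma JgH_Jh x : x \in Jg -> x \in Jh.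
Proof.
move: x; apply: lspan_sub => x [ca [Da [cb [Db [a [b [ha hb [m hm] ->]]]]]]].
have [kt _] := thr_int ha.2 hb.2 hm.
set k := (X in star X) in kt *.
have aw := hn_words ha.
move: a aw {ha}; apply: (lspan_lin (star_l VA k ca b)) => _ [s hs <-].
exact: star_Jh (hfil_word hs) kt.
Qed.

(** By [star_der] the products with smaller indices come from derivatives of a. *)
Lemma star_JgH ca Da cb Db a b (m k : int) : hn ca Da a -> hn cb Db b ->
  (ca - Da) + (cb - Db) = m%:~R ->
  k <= (if (ca - Da) + (cb - Db) <= -1 then -1 else -2) -> star k ca a b \in Jg.
Proof.
move=> ha hb hm; set k0 := (X in _ <= X).
have [n] : exists n : nat, k = k0 - n%:Z \/ k0 < k by exists (absz (k0 - k)); lia.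
move=> [->|h1 h2]; last by lia.
move=> _; elim: n ca Da a ha hm @k0 => [|n IH] ca Da a ha hm k0.
  by rewrite subr0; apply: mem_lspan; exists ca, Da, cb, Db, a, b; split=> //; exists m.
have k00 : (k0 - n%:Z)%:~R != 0 :> K by rewrite intr_eq0 /k0; case: ifP; lia.
have h1 := IH _ _ _ ha hm.
have ha' := hn_der hH hg ha.
have epsE : ca + 1 - (Da + 1) = ca - Da by ring.
have h2 := IH _ _ _ ha'; rewrite epsE in h2; have {}h2 := h2 hm.
rewrite -/k0 in h1 h2.
have -> : k0 - n.+1%:Z = k0 - n%:Z - 1 by lia.
have zE := star_der VA (k0 - n%:Z) ca a b.
pose y := star (k0 - n%:Z) ca a b; pose z := star (k0 - n%:Z) (ca + 1) (der VA a) b.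
rewrite -/y -/z in zE; set w := star (k0 - n%:Z - 1) ca a b in zE *.
have {h1} yJ : y \in Jg by []; have {h2} zJ : z \in Jg by [].
have -> : w = - (k0 - n%:Z)%:~R^-1 *:
    (z + real_complex R ((k0 - n%:Z)%:~R + ca + 1) *: y).
  by rewrite zE subrK scalerA mulrNN mulVf// scale1r.
by rewrite rpredZ// rpredD// rpredZ.
Qed.

(** The operator g o theta_H^-1 multiplies a *_n b by
    exp (2 pi i (epsilon_a + epsilon_b)) and fixes V_{g,H}.  Hence an element of J
    in V_{g,H} only needs products with epsilon_a + epsilon_b an integer, and
    these are in J_{g,H}. *)
Lemma Jh_JgH x : x \in Jh -> x \in U -> x \in Jg.
Proof.
have [T [lT TE]] := twist_op => /JhP[n xJ] xU.
pose A := [set x | exists k ca Da cb Db a b, [/\ hn ca Da a, hn cb Db b,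
   k <= thr (ca - Da) & x = star k ca a b]].
have xA : x \in lspan A.
  move: xJ {xU}; move: x; apply: lspan_sub => _ [q [c [D [m1 [m2 [a [b [k [[_ ha _] bF _ kt ->]]]]]]]]].
  move: b bF; apply: (lspan_lin (star_r VA k c a)) => _ [s _ <-].
  have [c' [D' hs]] := mword_hom hH hg heD s.
  by apply: mem_lspan; exists k, c, D, c', D', a, (mword s).
have Teig k ca Da cb Db a b : hn ca Da a -> hn cb Db b ->
    T (star k ca a b) = expi ((ca - Da) + (cb - Db)) *: star k ca a b.
  move=> [ha _] [hb _]; rewrite (S_lin lT); last exact: evz_gb.
  rewrite -SZ; last exact: evz_gb.
  apply: S_eq => j; rewrite (linZ lT) (TE _ _ _ (hom_nprod hH hg _ ha hb)).
  rewrite !scalerA mulrC; congr (_ * _ *: _).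
  set i := (k + j%:Z); have -> : ca + cb - (Da + Db - i%:~R - 1) =
      (ca - Da + (cb - Db)) + (i + 1)%:~R by rewrite (intrD _ i 1); ring.
  by rewrite expiD expi_int mulr1.
have Tx : T x = 1 *: x.
  have := xU; move: x {xU xJ xA}; apply: lspan_ind; first by rewrite (lin0 lT) scaler0.
  move=> z u v [D hu] IH; rewrite lT IH (TE _ _ _ hu) subrr expi0; lmod (R[i]).
have TA w : A w -> exists m, T w = m *: w.
  by move=> [k [ca [Da [cb [Db [a [b [ha hb _ ->]]]]]]]]; exists (expi (ca - Da + (cb - Db))); apply: Teig.
have := eig_span lT TA xA Tx; apply: lspan_sub => w [[k [ca [Da [cb [Db [a [b [ha hb kt wE]]]]]]]] Tw].
have [->|w0] := eqVneq w 0; first exact: rpred0.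
have e1 : expi (ca - Da + (cb - Db)) = 1.
  have /eqP : (expi (ca - Da + (cb - Db)) - 1) *: w = 0.
    by rewrite scalerBl -Tw wE (Teig _ _ _ _ _ _ _ ha hb) subrr.
  by rewrite scaler_eq0 (negbTE w0) orbF subr_eq0 => /eqP.
have na := ha.2; have nb := hb.2.
have [m hm] : exists m : int, ca - Da + (cb - Db) = m%:~R.
  have [h|h] := leP (ca - Da + (cb - Db)) (-1); last first.
    by exists 0; apply: expi_eq1 => //; apply/andP; split=> //; lra.
  exists (-1); apply/eqP; rewrite rmorphN -subr_eq0 opprK; apply/eqP; apply: expi_eq1.
    by apply/andP; split; lra.
  by rewrite expiD e1 mul1r (expi_int 1).
rewrite wE; apply: (star_JgH ha hb hm).
have [_ [hl hr]] := thr_int na nb hm.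
case: ifP => h; first by apply: (le_trans kt); case/andP: (thr_le (ca - Da)).
have [|h1 h2] := hr _; first by rewrite ltNge h.
by move: kt; rewrite h1 /thr eqxx.
Qed.

(** On V_{g,H} one has gamma_a = Delta_a, so a * b only depends on the eigenvalue
    of H on a, and it extends to all a by diagonalizing H. *)
Lemma star_total : exists st : V -> V -> V,
  [/\ forall b, linear (st ^~ b), forall a, linear (st a)
    & forall D a b, H a = (D%:C)%C *: a -> st a b = star (-1) D a b].
Proof.
have [lH dH _] := hH; have [dec h] := spectral_calculus lH dH.
have lphi b c : linear (fun a => star (-1) (complex.Re c) a b) by exact: star_l.
exists (fun a b => \sum_(x <- dec a) star (-1) (complex.Re x.1) x.2 b); split.
- by move=> b; have [] := h V _ (lphi b).
- move=> a c u v; rewrite scaler_sumr -big_split; apply: eq_bigr => x _.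
  exact: star_r.
by move=> D a b Ha; have [_ hE] := h V _ (lphi b); rewrite (hE _ _ Ha).
Qed.

Section Product.
Context (st : V -> V -> V) (stl : forall b, linear (st ^~ b)) (str : forall a, linear (st a)).
Context (stE : forall D a b, H a = (D%:C)%C *: a -> st a b = star (-1) D a b).

Lemma st_hn c D a b : hn c D a -> st a b = star (-1) D a b.
Proof. by move=> [[_ /stE] ->]. Qed.

Lemma st_VgH a b : a \in U -> b \in U -> st a b \in U.
Proof.
move=> aU bU; move: a aU; apply: (lspan_lin (stl b)) => a [D ha].
by rewrite (stE _ ha.2); apply: (starn_VgH hH hg) => //; apply: untw_VgH; exists D.
Qed.

Lemma st_Jh_l a x : a \in U -> x \in Jh -> st a x \in Jh.
Proof.
move=> /VgH_words aw /JhP[n xJ]; move: a aw; apply: (lspan_lin (stl x)) => _ [s us <-].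
have [D hs] := untw_hn us.
rewrite (st_hn _ hs); apply: (mem_Jh (n := ((wdeg s).+1 + n).-1)).
exact: Jt_ideal_l (hfil_word hs) xJ.
Qed.

(** Apply the twisted identity to (a *_k b) * c.  The products with left factor a
    have index at most k, and so have those with left factor b once they are
    written with the exponent gamma_b. *)
Lemma st_Jg_r x b : x \in Jg -> st x b \in Jh.
Proof.
move: x; apply: (lspan_lin (stl b)) => x [ca [Da [cb [Db [a' [b' [ha hb [m hm] ->]]]]]]].
set k : int := if _ then _ else _.
have [kt [s1 s0]] := thr_int ha.2 hb.2 hm.
have hb2 := hb.2; have ha2 := ha.2.
have aw := hn_words ha; have bw := hn_words hb.
move: a' aw {ha}; apply: (lspan_lin (lin_comp (stl b) (star_l VA k ca b'))) => _ [s hs <-].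
move: b' bw {hb}; apply: (lspan_lin (lin_comp (stl b) (star_r VA k ca _))) => _ [t ht <-].
have ha := hfil_word hs; have hb := hfil_word ht.
have k1 : k <= -1 by rewrite /k; case: ifP.
have -> : st (star k ca (mword s) (mword t)) b =
   \S_ i (gbinom ca i *: star (-1) (ca + cb + (chi (ca - Da) (cb - Db))%:R - (k + i%:Z)%:~R - 1)
      ((mword s) _(k + i%:Z) (mword t)) b).
  rewrite /starn (S_lin (stl b)); last exact: evz_gb.
  apply: S_eq => i; rewrite (linZ (stl b)); congr (_ *: _).
  rewrite (st_hn _ (hn_np hH hg _ hs ht)); apply: starE; rewrite /chi.
  by have [h|h] := leP (ca - Da + (cb - Db)) (-1); rewrite ?mulr1n ?mulr0n; [have := s1 h|have := s0 h]; lra.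
rewrite (star_assoc_hom _ _ k1 ha hb); apply: rpredB.
  apply: S_mem => j; apply: rpredZ; apply: (star_Jh _ ha); apply: le_trans kt.
  by rewrite lerBlDr lerDl.
apply: rpredZ; apply: S_mem => j; apply: rpredZ.
apply: star_nat_mem => u us; apply: (star_Jh _ hb).
move: us; rewrite /chi /k; have [h|h] := leP (ca - Da + (cb - Db)) (-1).
  have -> : thr (cb - Db) = -1 by rewrite /thr; case: eqP => // ?; exfalso; have := s1 h; lra.
  by lia.
by have [_ ->] := s0 h; rewrite /thr eqxx /=; lia.
Qed.

(** In the twisted identity for (a * b) * x all terms but a * (b * x) have a left
    factor with index at most -2. *)
Lemma st_assoc a b x : a \in U -> b \in U -> st (st a b) x - st a (st b x) \in Jh.
Proof.
move=> aU bU.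
have lf b' : linear (fun a' => st (st a' b') x - st a' (st b' x)).
  by move=> c u v; rewrite (stl b') (stl x) (stl (st b' x)); lmod (R[i]).
have lf' a' : linear (fun b' => st (st a' b') x - st a' (st b' x)).
  by move=> c u v; rewrite (str a') !(stl x) (str a'); lmod (R[i]).
have aw := VgH_words aU; have bw := VgH_words bU.
move: a aw {aU}; apply: (lspan_lin (lf b)) => _ [s us <-].
move: b bw {bU}; apply: (lspan_lin (lf' _)) => _ [t ut <-].
have [D hs] := untw_hn us; have [D' ht] := untw_hn ut.
have ha := hfil_word hs; have hb := hfil_word ht.
have ch0 : chi (D - D) (D' - D') = 0%N by rewrite !subrr chi0l// ltrN10.
have := star_assoc_hom (-1) x (lexx _) ha hb.
rewrite ch0 /= addn0 !addr0 => h.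
have -> : st (st (mword s) (mword t)) x =
   \S_ i (gbinom D i *: star (-1) (D + D' - (-1 + i%:Z)%:~R - 1)
      ((mword s) _(-1 + i%:Z) (mword t)) x).
  rewrite (st_hn _ hs) /starn (S_lin (stl x)); last exact: evz_gb.
  apply: S_eq => i; rewrite (linZ (stl x)); congr (_ *: _).
  by rewrite (st_hn _ (hn_np hH hg _ hs ht)).
rewrite h addrAC; apply: rpredB.
  rewrite S_recl; last first.
    have [N hN] := star_large VA (mword t) x; exists (absz N).+1 => j Nj.
    by rewrite hN ?(lin0 (star_r _ _ _ _)) ?scaler0//; lia.
  rewrite gb0 expr0 mulr1 scale1r (_ : -1 - 0%:Z = -1)//.
  rewrite (st_hn _ hs) (st_hn _ ht) addrAC subrr add0r.
  apply: S_mem => j; apply: rpredZ; apply: (star_Jh _ ha).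
  by rewrite subrr /thr eqxx; lia.
apply: rpredZ; apply: S_mem => j; apply: rpredZ; apply: (star_Jh _ hb).
by rewrite subrr /thr eqxx; lia.
Qed.

(** Modulo J only the products y *_{-1} vac = y with y = a_(i)b remain, and their
    coefficients add up to the binomial coefficient of D - 1, by the Vandermonde
    identity for (-1) + D. *)
Lemma st_comm_word s t D D' : hn D D (mword s) -> hn D' D' (mword t) ->
  st (mword s) (mword t) - sgn (wpar p s) (wpar p t) *: st (mword t) (mword s)
   - \S_ j (gbinom (D - 1) j *: ((mword s) _(j%:Z) (mword t))) \in Jh.
Proof.
move=> hs ht; have ha := hfil_word hs; have hb := hfil_word ht.
have ch0 : chi (D - D) (D' - D') = 0%N by rewrite !subrr chi0l// ltrN10.
have pa : vpar VA (wpar p s) (mword s) by case: ha.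
have pb : vpar VA (wpar p t) (mword t) by case: hb.
have := star_comm D D' (-1) (-1) (vac VA) pa pb.
rewrite !star_vacr -(st_hn _ hs) -(st_hn _ ht) => ->.
rewrite [X in X - _ - _]addrC addrK -SB; first last.
- have := evz_np VA 0 (mword s) (mword t); move=> h.
  by have [N hN] := evzZ (gbinom (D - 1)) h; exists N => j /hN; rewrite add0r.
- have [N hN] := evz_np VA 0 (mword s) (mword t); exists N => i /hN; rewrite add0r => h.
  by apply: big1 => j _; rewrite h (lin0 (star_l _ _ _ _)) scaler0.
apply: S_mem => i.
set y := (mword s) _(i%:Z) (mword t).
have -> : gbinom (D - 1) i = \sum_(j < i.+1) (gbinom (-1)%:~R (i - j) * gbinom D j).
  by rewrite addrC -[-1](rmorphN1 (intmul 1)) addrC gb_vander; apply: eq_bigr => j _; rewrite mulrC.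
rewrite scaler_suml -sumrB; apply: rpred_sum => -[j /= ji] _.
rewrite -scalerBr; apply: rpredZ.
have hy := hfil_np0 hH hg hep hpre i ha hb; rewrite ch0 addr0 -/y in hy.
have -> : D + D' - j%:R = (D + D' - i%:R - 1) + (i - j).+1%:R.
  by rewrite -natr1 natrB//; ring.
rewrite star_shift.
have -> : y = star (-1) (D + D' - i%:R - 1) y (vac VA) by rewrite star_vacr.
rewrite star_vacr (@S_trunc _ _ (i - j).+2); last first.
  by move=> u hu; rewrite gb_nat bin_small// scale0r.
rewrite big_ord_recr /= gb_nat binn scale1r.
have -> : -1 + -1 - i%:Z + j%:Z + (i - j).+1%:Z = -1 by lia.
rewrite star_vacr addrK; apply: rpred_sum => -[u /= hu] _; apply: rpredZ.
by apply: (star_Jh _ hy); rewrite subrr /thr eqxx; lia.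
Qed.


End Product.


Local Notation tau := (tau VA H g).
Local Notation Z := (zhu VA H g).

Lemma val_insubU a : a \in U -> val (insubd (0 : lsub untw) a) = a.
Proof. by move=> aU; rewrite val_insubd aU. Qed.

Lemma valU_linear : linear (val : lsub untw -> V).
Proof. exact: linearP. Qed.

Lemma tau_eq a b : a \in U -> b \in U -> (tau a = tau b) <-> (a - b \in Jg).
Proof.
move=> aU bU; rewrite /Defs.tau; split=> [/lproj_eq|] h.
  have : val (insubd (0 : lsub untw) a - insubd (0 : lsub untw) b) \in Jg.
    by move: h; apply: (lspan_lin valU_linear).
  by rewrite (linB valU_linear) !val_insubU.
have vJ : val (insubd (0 : lsub untw) a - insubd (0 : lsub untw) b) \in Jg.
  by rewrite (linB valU_linear) !val_insubU.
by apply/lproj_eq/mem_lspan.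
Qed.

Lemma tau_lin c a b : a \in U -> b \in U -> tau (c *: a + b) = c *: tau a + tau b.
Proof.
move=> aU bU; rewrite /Defs.tau -lproj_linear; congr lproj.
apply: val_inj; rewrite valU_linear !val_insubU//.
by rewrite rpredD// rpredZ.
Qed.

Lemma tau0 : tau 0 = 0.
Proof.
have U0 : 0 \in U by exact: rpred0.
by have := tau_lin (-1) U0 U0; rewrite scaler0 addr0 scaleN1r addNr.
Qed.

Lemma tauZ c a : a \in U -> tau (c *: a) = c *: tau a.
Proof. by move=> aU; have := tau_lin c aU (rpred0 _); rewrite addr0 tau0 addr0. Qed.

Lemma tauD a b : a \in U -> b \in U -> tau (a + b) = tau a + tau b.
Proof. by move=> aU bU; have := tau_lin 1 aU bU; rewrite !scale1r. Qed.

Lemma tau_Jh a : a \in U -> a \in Jh -> tau a = 0.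
Proof.
by move=> aU aJ; rewrite -tau0; apply/tau_eq => //; rewrite ?rpred0// subr0; apply: Jh_JgH.
Qed.

Lemma tau_surj (x : Z) : exists2 a, a \in U & x = tau a.
Proof.
exists (val (repr x)); first exact: valP.
by rewrite /Defs.tau valKd lprojK.
Qed.

Lemma tau_span (A : set V) (N : submodClosed Z) a : (forall v, A v -> v \in U) ->
  (forall v, A v -> tau v \in N) -> a \in lspan A -> tau a \in N.
Proof.
move=> AU AN aA.
have [] // : a \in U /\ tau a \in N.
move: a aA; apply: lspan_ind; first by rewrite tau0 !rpred0.
move=> c u v Au [vU vN]; have uU := AU _ Au; split; first by rewrite rpredD// rpredZ.
by rewrite tau_lin// rpredD// rpredZ// AN.
Qed.

Lemma vac_VgH : vac VA \in U.
Proof. by apply: mem_lspan; exists 0; have [] := hn_vac hH hg. Qed.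

Section ZhuProduct.
Context (st : V -> V -> V) (stl : forall b, linear (st ^~ b)) (str : forall a, linear (st a)).
Context (stE : forall D a b, H a = (D%:C)%C *: a -> st a b = star (-1) D a b).

Definition zmul (x y : Z) : Z := tau (st (val (repr x)) (val (repr y))).

Lemma zmul_tau a b : a \in U -> b \in U -> zmul (tau a) (tau b) = tau (st a b).
Proof.
move=> aU bU; rewrite /zmul; set a' := val _; set b' := val _.
have a'U : a' \in U by apply: valP.
have b'U : b' \in U by apply: valP.
have a'E : tau a' = tau a by rewrite /Defs.tau valKd lprojK.
have b'E : tau b' = tau b by rewrite /Defs.tau valKd lprojK.
have aJ := proj1 (tau_eq a'U aU) a'E; have bJ := proj1 (tau_eq b'U bU) b'E.
apply/tau_eq; rewrite ?(st_VgH stl stE)//.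
apply: Jh_JgH; last by rewrite rpredB// (st_VgH stl stE).
have -> : st a' b' - st a b = st (a' - a) b' + st a (b' - b).
  by rewrite (linB (stl _)) (linB (str _)); lmod (R[i]).
apply: rpredD; first exact: (st_Jg_r stl stE).
by apply: (st_Jh_l stl stE) => //; exact: JgH_Jh.
Qed.

Lemma zmul_bilinear : bilinear_map zmul.
Proof.
split=> [y c u v|x c u v].
  have [a aU ->] := tau_surj u; have [b bU ->] := tau_surj v; have [b' b'U ->] := tau_surj y.
  rewrite -tau_lin// !zmul_tau//; last by rewrite rpredD// rpredZ.
  by rewrite (stl b') tau_lin// (st_VgH stl stE).
have [a aU ->] := tau_surj u; have [b bU ->] := tau_surj v; have [b' b'U ->] := tau_surj x.
rewrite -tau_lin// !zmul_tau//; last by rewrite rpredD// rpredZ.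
by rewrite (str b') tau_lin// (st_VgH stl stE).
Qed.

Lemma zmul_product : is_zhu_product zmul.
Proof.
split=> [|D a b ha bU]; first exact: zmul_bilinear.
by rewrite zmul_tau// -?(stE _ ha.2)//; apply: untw_VgH; exists D.
Qed.

Lemma vpar_sub q a : a \in lspan (vpar VA q) -> vpar VA q a.
Proof. by apply: subspace_span; case: (vpar_direct VA) => + _ _; apply. Qed.

Lemma VgH_words_par q a : a \in U -> vpar VA q a ->
  a \in lspan (mword @` [set s | untw (mword s) /\ wpar p s = q]).
Proof.
move=> /VgH_words ha qa; apply: (dsum_label (vpar_direct VA) _ qa ha) => s _.
exact: mword_par.
Qed.

Lemma st_par q r a b : a \in U -> vpar VA q a -> vpar VA r b -> vpar VA (q (+) r) (st a b).
Proof.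
move=> aU /(VgH_words_par aU) aw rb; apply: vpar_sub.
move: a aw {aU}; apply: (lspan_lin (stl b)) => _ [s [us <-] <-].
have [D hs] := untw_hn us; rewrite (st_hn stE _ hs); apply: S_mem => j; apply: rpredZ.
by apply: mem_lspan; apply: vpar_nprod => //; apply: mword_par.
Qed.

(** J is spanned by elements homogeneous in parity. *)
Lemma zhu_par_direct : is_direct_sum [set: bool] (zhu_par VA H g).
Proof.
have vs q := let: And3 h _ _ := vpar_direct VA in h q Logic.I.
apply: bool_direct_sum.
- move=> q; split.
    by exists 0; [split; [exact: rpred0|case: (vs q)]|exact: tau0].
  move=> c _ _ [a [aU qa] <-] [b [bU qb] <-].
  exists (c *: a + b); last exact: tau_lin.
  by split; [rewrite rpredD// rpredZ|apply: (vs q).2].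
- move=> x; have [a aU ->] := tau_surj x.
  apply: (tau_span _ _ (VgH_words aU)) => _ [s us <-]; first exact: untw_VgH.
  apply: mem_lspan; exists (wpar p s) => //; exists (mword s) => //.
  by split; [exact: untw_VgH|exact: mword_par].
move=> _ _ [a [aU qa] <-] [b [bU qb] <-]; rewrite -tauD// => h.
apply: tau_Jh => //.
have : a + b \in Jh.
  by apply: JgH_Jh; rewrite -[a + b]subr0; apply/tau_eq; rewrite ?tau0 ?rpredD ?rpred0.
move=> /JhP[n] abJ.
pose f (t : bool * R * R * seq (nat * I) * V * int) : V :=
  let: (q, c, D, s, v, k) := t in star k c (mword s) v.
pose P (t : bool * R * R * seq (nat * I) * V * int) :=
  let: (q, c, D, s, v, k) := t in [/\ hn c D (mword s), vpar VA q v & k <= thr (c - D)].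
pose lab (t : bool * R * R * seq (nat * I) * V * int) :=
  let: (q, c, D, s, v, k) := t in wpar p s (+) q.
have spl : a + b \in lspan (f @` P).
  move: (a + b) abJ; apply: lspan_sub => _ [q [c [D [m1 [m2 [a' [b' [k [[_ ha _] bF _ kt ->]]]]]]]]].
  have aw := hn_words ha; move: a' aw {ha}; apply: (lspan_lin (star_l VA k c b')) => _ [s hs <-].
  move: b' bF; apply: (lspan_lin (star_r VA k c _)) => _ [t _ <-].
  apply: mem_lspan; exists (wpar p t, c, D, s, mword t, k) => //.
  by split=> //; exact: mword_par.
have Fl t : P t -> vpar VA (lab t) (f t).
  case: t => [[[[[q c] D] s] v] k] [hs qv kt]; apply: vpar_sub; apply: S_mem => j.
  apply: rpredZ; apply: mem_lspan; apply: vpar_nprod => //; exact: mword_par.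
have [+ _] := dsum_split (vpar_direct VA) Fl qa qb spl.
apply: lspan_sub => _ [[[[[[q c] D] s] v] k] [[hs qv kt] _] <-].
exact: (star_Jh _ (hfil_word hs)).
Qed.

(** The product is well defined and associative by [st_Jh_l], [st_Jg_r] and
    [st_assoc], as elements of J that lie in V_{g,H} are killed by tau. *)
Theorem zhu_superalgebra : is_superalgebra (zhu_par VA H g) (tau (vac VA)) zmul.
Proof.
have stU := st_VgH stl stE.
split.
- exact: zhu_par_direct.
- exact: zmul_bilinear.
- move=> x y z; have [a aU ->] := tau_surj x; have [b bU ->] := tau_surj y.
  have [c cU ->] := tau_surj z; rewrite !zmul_tau ?stU//.
  apply/esym/tau_eq; rewrite ?stU//; apply: Jh_JgH; last by rewrite rpredB ?stU.
  exact: (st_assoc stl str stE).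
- move=> x; have [a aU ->] := tau_surj x; rewrite zmul_tau ?vac_VgH//.
  by rewrite (st_hn stE _ (hn_vac hH hg)) star_vacl.
- move=> x; have [a aU ->] := tau_surj x; rewrite zmul_tau ?vac_VgH//; congr (tau _).
  move: a aU; apply: lspan_ind; first exact: (lin0 (stl _)).
  by move=> c u v [D hu] IH; rewrite (stl _) IH (stE _ hu.2) star_vacr.
- by exists (vac VA) => //; split; [exact: vac_VgH|exact: vpar_vac].
move=> q r _ _ [a [aU qa] <-] [b [bU rb] <-]; rewrite zmul_tau//.
by exists (st a b) => //; split; [exact: stU|exact: st_par].
Qed.

End ZhuProduct.
End ZhuAlgebra.

(** * Generators of the Zhu algebra *)

Lemma lspanU (K : fieldType) (W : lmodType K) (A B : set W) v : v \in lspan (A `|` B) ->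
  exists u w, [/\ u \in lspan A, w \in lspan B & v = u + w].
Proof.
move: v; apply: lspan_ind; first by exists 0, 0; rewrite addr0 !rpred0.
move=> c x v [Ax|Bx] [u [w [uA wB ->]]].
  by exists (c *: x + u), w; split; rewrite ?addrA// rpredD// rpredZ// mem_lspan.
by exists u, (c *: x + w); split; rewrite 1?addrCA// rpredD// rpredZ// mem_lspan.
Qed.

Section Generators.
Context {R : realType} {V : lmodType R[i]} (VA : vertexSuperalgebra V).
Context (H g : V -> V) (hH : is_hamiltonian VA H) (hg : is_automorphism VA g).
Local Notation "a _( n ) b" := (nprod VA n a b)
  (at level 35, n at level 200, b at level 35).
Local Notation K := (R[i]).
Local Notation star := (starn VA).
Local Notation hn := (hom_norm H g).
Context {d : Order.disp_t} {I : orderType d} (e : I -> V) (p : I -> bool) (deg : I -> nat).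
Context (ce De : I -> R).
Context (hep : forall i, vpar VA (p i) (e i)).
Context (heD : forall i, hn (ce i) (De i) (e i)).
Context (hdeg : forall i, (0 < deg i)%N).
Context (hpre : forall i j (n : nat), (e i) _(n%:Z) (e j) \in Fil VA e deg (deg i + deg j)).
Context (hfree : freely_generated VA p e).
Local Notation F := (Fil VA e deg).
Local Notation mword := (mword VA e).
Local Notation eword := (eword VA e ce).
Local Notation wdeg := (wdeg deg).
Local Notation J := (Jt VA H g e deg).
Local Notation Jh := (Jh VA H g e deg).
Local Notation hfil := (hfil VA H g e deg).
Local Notation U := (VgH H g).
Local Notation untw := (untwisted H g).
Local Notation adm := (@admissible d I p).
Local Notation tau := (tau VA H g).
Local Notation Z := (zhu VA H g).
Context (st : V -> V -> V) (stl : forall b, linear (st ^~ b)) (str : forall a, linear (st a)).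
Context (stE : forall D a b, H a = (D%:C)%C *: a -> st a b = star (-1) D a b).
Local Notation mul := (zmul (VA := VA) (H := H) (g := g) st).
Let stU a b := st_VgH hH hg stl stE (a := a) (b := b).
Let mul_tau a b := zmul_tau hH hg hep heD hpre hfree stl str stE (a := a) (b := b).

Lemma mword1 i : mword [:: (0%N, i)] = e i.
Proof. by rewrite mword_cons /= (@npE _ _ _ _ (-1)) ?nprod_vac. Qed.

Lemma gen_neq0 i : e i != 0.
Proof. by rewrite -mword1; apply: (basis_neq0 hfree). Qed.

Lemma untw_gen i : untw (e i) -> ce i = De i.
Proof.
move=> /untw_hn[D hD]; have [-> ->//] := hn_uniq (gen_neq0 i) (heD i) hD.
Qed.

Lemma untw_genE i : (ce i == De i) <-> untw (e i).
Proof.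
split=> [/eqP cD|/untw_gen ->//]; exists (De i).
by have [h _] := heD i; rewrite cD in h.
Qed.

Lemma gen_VgH i : untw (e i) -> e i \in U. Proof. exact: mem_lspan. Qed.

Lemma vgH_VgH a : a \in vgH H g e -> a \in U.
Proof. by move: a; apply: lspan_sub => _ [i ui <-]; apply: gen_VgH. Qed.

(** The derivative of a differs from - Delta_a a by a *_{-2} vac, which is in J. *)
Lemma tau_der D a : hn D D a -> tau (der VA a) = - (D%:C)%C *: tau a.
Proof.
move=> ha; have aU : a \in U by apply: mem_lspan; exists D; case: ha.
have daU : der VA a \in U by apply: mem_lspan; exists (D + 1); case: (hn_der hH hg ha).
apply/eqP; rewrite -subr_eq0 scaleNr opprK -tauZ// -tauD ?rpredZ//; apply/eqP.
apply: (tau_Jh hH hg heD (deg := deg)); first by rewrite rpredD// rpredZ.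
have -> : der VA a + (D%:C)%C *: a = star (-2) D a (vac VA).
  have := star_der VA (-1) D a (vac VA).
  rewrite star_vacr rmorphN1 opprK scale1r => h.
  rewrite {1}h star_vacr; have -> : (-1)%:~R + D + 1 = D by rewrite rmorphN1; ring.
  by rewrite subrK.
have aw := hn_words hH hg deg heD hfree ha.
move: a aw {aU daU ha}; apply: (lspan_lin (star_l VA (-2) D (vac VA))) => _ [s hs <-].
by apply: (star_Jh hfree _ (hfil_word deg hep hs)); rewrite subrr /thr eqxx.
Qed.

Lemma tau_RgH a : a \in RgH VA H g e -> exists2 b, b \in vgH H g e & tau a = tau b.
Proof.
move=> aR; pose N := [set x | exists2 b, b \in vgH H g e & x = tau b].
have sN : is_subspace N.
  split=> [|c _ _ [a' ha ->] [b hb ->]]; first by exists 0; rewrite ?tau0 ?rpred0.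
  by exists (c *: a' + b); rewrite ?rpredD ?rpredZ// tau_lin ?vgH_VgH.
have gen k i : untw (e i) -> hn (De i + k%:R) (De i + k%:R) (iter k (der VA) (e i)) /\
    exists c : K, tau (iter k (der VA) (e i)) = c *: tau (e i).
  move=> ui; elim: k => [|k [hk [c IH]]].
    by rewrite addr0; split; [rewrite -{1}(untw_gen ui)|exists 1; rewrite scale1r].
  split; first by rewrite -natr1 addrA; apply: hn_der.
  by rewrite iterS (tau_der hk) IH; eexists; rewrite scalerA.
suff /(subspace_span sN) [b] : tau a \in lspan N by exists b.
apply: (tau_span (A := [set x | exists k i, untw (e i) /\ x = iter k (der VA) (e i)])).
- by move=> _ [k [i [/(gen k)[h _] ->]]]; apply: mem_lspan; eexists; case: h => h _; exact: h.
- move=> _ [k [i [ui ->]]]; have [_ [c ->]] := gen k i ui; apply: mem_lspan.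
  exists (c *: e i); last by rewrite tauZ ?gen_VgH.
  by apply/rpredZ/mem_lspan; exists i.
move: a aR; apply: lspan_sub => _ [k [b bv ->]].
move: b bv; apply: (lspan_lin (iter_der_linear VA k)) => _ [i ui <-].
by apply: mem_lspan; exists k, i.
Qed.

Definition gword (s : seq I) : seq (nat * I) := [seq (0%N, i) | i <- s].
Definition goodw : set (seq I) := [set s : seq I | (forall i, i \in s -> untw (e i)) /\
  sorted (fun i j => (i < j)%O || (i == j) && ~~ p i) s].
Definition zmon (s : seq I) : Z := foldr mul (tau (vac VA)) [seq tau (e i) | i <- s].

Lemma eword_VgH s : (forall i, i \in s -> untw (e i)) -> eword (gword s) \in U.
Proof.
elim: s => [|i s IH] us; first exact: vac_VgH.
have ui : untw (e i) by apply: us; rewrite inE eqxx.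
apply: (starn_VgH hH hg); first exact: gen_VgH.
by apply: IH => j js; apply: us; rewrite inE js orbT.
Qed.

Lemma zmonE s : (forall i, i \in s -> untw (e i)) -> zmon s = tau (eword (gword s)).
Proof.
elim: s => [//|i s IH] us.
have ui : untw (e i) by apply: us; rewrite inE eqxx.
have us' j : j \in s -> untw (e j) by move=> js; apply: us; rewrite inE js orbT.
rewrite /zmon /= -/(zmon s) IH// mul_tau ?eword_VgH ?gen_VgH//; congr (tau _).
by rewrite (st_hn stE _ (heD i)) /estar /= (untw_gen ui).
Qed.

Lemma gword_adm s : sorted (fun i j => (i < j)%O || (i == j) && ~~ p i) s -> adm (gword s).
Proof.
rewrite /admissible /gword /= sorted_map; apply: sub_sorted => i j.
by rewrite /= /index_lt /= ltnn andbF orbF.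
Qed.

Lemma gword_good s : ~~ has (bad ce De) s -> s = gword [seq i.2 | i <- s].
Proof.
move=> /hasPn bs; rewrite /gword -map_comp -[LHS]map_id; apply/eq_in_map => -[k i] /bs.
by move=> /goodP[/= -> _].
Qed.

(** Sorting, as in [Fil_adm], for the words in the products *_n. *)
Lemma Fil_eadm m v : v \in F m -> v \in lspan (eword @` [set s | adm s /\ (wdeg s < m)%N]).
Proof.
elim/ltn_ind: m v => m IHm v /(eword_span ce hep hdeg hpre); move: v; apply: lspan_sub => _ [s sm <-].
apply: (sorting_mem (od := fun i : nat * I => p i.2) two_neq0 (@index_lt_trans _ I)
  (@index_lt_total _ I)) => [A i j B pe|t pe adt].
  have sm' : (wdeg (A ++ i :: j :: B) < m)%N by rewrite (wdeg_perm _ pe).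
  have := IHm _ sm' _ (eword_swapF hH hg hep heD hpre A i j B).
  apply: lspan_mono => _ [u [au ut] <-].
  by exists u => //; split=> //; apply: ltn_trans sm'.
by apply: mem_lspan; exists t => //; split=> //; rewrite /= (wdeg_perm _ pe).
Qed.

(** Words with a bad letter are killed by tau, and the others are monomials. *)
Lemma zhu_filtration m v : v \in F m -> v \in U ->
  tau v \in lspan (zmon @` [set s | goodw s /\ (sumn [seq deg i | i <- s] < m)%N]).
Proof.
move=> /Fil_eadm vm vU.
pose A := eword @` [set s | [/\ adm s, (wdeg s < m)%N & ~~ has (bad ce De) s]].
pose B := eword @` [set s | has (bad ce De) s].
have [u [w [uA wB vE]]] : exists u w, [/\ u \in lspan A, w \in lspan B & v = u + w].
  apply: lspanU; move: vm; apply: lspan_mono => _ [s [as' sm] <-].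
  by have [bs|gs] := boolP (has (bad ce De) s); [right|left]; exists s.
have AU s : ~~ has (bad ce De) s -> forall i, i \in [seq i.2 | i <- s] -> untw (e i).
  by move=> /hasPn bs _ /mapP[i /bs/goodP[_ /eqP ci] ->]; apply/untw_genE.
have uU : u \in U.
  move: u uA {vE}; apply: lspan_sub => _ [s [_ _ gs] <-].
  by rewrite (gword_good gs); apply/eword_VgH/AU.
have wU : w \in U by rewrite -[w](addKr u) -vE rpredD// rpredN.
have wJ : w \in Jh.
  move: w wB {vE wU}; apply: lspan_sub => _ [s bs <-]; apply: mem_Jh.
  exact: eword_bad bs.
rewrite vE tauD// (tau_Jh hH hg heD wU wJ) addr0.
apply: tau_span uA => _ [s [as' sm gs] <-].
  by rewrite (gword_good gs); apply/eword_VgH/AU.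
apply: mem_lspan; exists [seq i.2 | i <- s]; last first.
  by rewrite zmonE -?(gword_good gs)//; apply: AU.
split; last by rewrite /= -map_comp.
split; first exact: AU.
move: as'; rewrite /admissible /= {1}(gword_good gs) /gword sorted_map.
by apply: sub_sorted => i j; rewrite /= /index_lt /= ltnn andbF orbF.
Qed.

(** A relation between the ordered monomials lifts to a combination of admissible
    words without bad letters that lies in J, which is spanned by the admissible
    words with a bad letter. *)
Lemma zmon_basis : is_basis goodw zmon.
Proof.
split=> [x|s c us sP s0 k ks].
  have [a aU ->] := tau_surj x; have [n aF] := Fil_all deg hfree a.
  by apply: lspan_mono (zhu_filtration aF aU) => _ [s [gs _] <-]; exists s.
have sU t : t \in s -> eword (gword t) \in U by move=> /sP[ut _]; apply: eword_VgH.
pose v := \sum_(t <- s) c t *: eword (gword t).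
have vU : v \in U by rewrite /v big_seq; apply: rpred_sum => t ts; rewrite rpredZ ?sU.
have tv : tau v = \sum_(t <- s) c t *: zmon t.
  rewrite /v; elim: s {us s0 ks v vU} sP sU => [|t s IH] sP sU; first by rewrite !big_nil tau0.
  have sP' u : u \in s -> goodw u by move=> h; apply: sP; rewrite inE h orbT.
  have sU' u : u \in s -> eword (gword u) \in U by move=> h; apply: sU; rewrite inE h orbT.
  rewrite !big_cons (tau_lin _ _ (sU _ (mem_head _ _))); last first.
    by rewrite big_seq; apply: rpred_sum => u h; rewrite rpredZ ?sU'.
  by rewrite IH// zmonE// => i it; case: (sP t (mem_head _ _)) => + _; apply.
have : v \in JgH VA H g.
  by rewrite -[v]subr0; apply/tau_eq; rewrite ?rpred0// tv s0 tau0.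
move=> /(JgH_Jh hH hg deg hep heD hfree)/JhP[n vJ].
have gi : injective gword by apply: inj_map => i j [].
pose c' t := c [seq i.2 | i <- (t : seq (nat * I))].
have c'E t : c' (gword t) = c t by rewrite /c' /gword -map_comp map_id.
have := @eword_free_mod_J _ _ _ _ _ hH hg _ _ _ _ _ _ _ hep heD hdeg hpre hfree n
  [seq gword t | t <- s] c'.
rewrite map_inj_uniq// big_map => /(_ us) h.
rewrite -c'E; apply: h; last by rewrite map_f.
  move=> _ /mapP[t ts ->]; have [ut st'] := sP t ts; split; first exact: gword_adm.
  apply/hasPn => _ /mapP[i it ->]; rewrite /bad /= subr_eq0 negbK.
  by apply/untw_genE/ut.
by rewrite (eq_bigr (fun t => c t *: eword (gword t))) => [//|t _]; rewrite c'E.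
Qed.

(** Both sides are bilinear, so that one may take words for a and b; the words in
    a can be chosen to have eigenvalue D. *)
Lemma zhu_commutator D q r a b : a \in U -> b \in U -> vpar VA q a -> vpar VA r b ->
  H a = (D%:C)%C *: a ->
  mul (tau a) (tau b) - sgn q r *: mul (tau b) (tau a) =
  \S_ j (gbinom (D - 1) j *: tau (a _(j%:Z) b)).
Proof.
move=> aU bU qa rb Ha.
have [lH _ _] := hH.
pose f a b := st a b - sgn q r *: st b a - \S_ j (gbinom (D - 1) j *: (a _(j%:Z) b)).
have ev a' b' : evz (fun j => gbinom (D - 1) j *: (a' _(j%:Z) b')).
  by have [N hN] := evz_np VA 0 a' b'; exists N => j /hN; rewrite add0r => ->; rewrite scaler0.
have fl b' : linear (f ^~ b').
  have Sl : linear (fun a' => \S_ j (gbinom (D - 1) j *: (a' _(j%:Z) b'))).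
    apply: S_linear => // j z u v; rewrite npl; lmod (R[i]).
  by move=> z u v; rewrite /f (stl b') (str b') Sl; lmod (R[i]).
have fr a' : linear (f a').
  have Sl : linear (fun b' => \S_ j (gbinom (D - 1) j *: (a' _(j%:Z) b'))).
    apply: S_linear => // j z u v; rewrite npr; lmod (R[i]).
  by move=> z u v; rewrite /f (stl a') (str a') Sl; lmod (R[i]).
have fJ : f a b \in Jh.
  have aw := VgH_words_par hH hg deg hep heD hfree aU qa.
  have bw := VgH_words_par hH hg deg hep heD hfree bU rb.
  have eig w : (mword @` [set s | untw (mword s) /\ wpar p s = q]) w -> exists m, H w = m *: w.
    by move=> [s [[D' [_ h]] _] <-]; exists ((D'%:C)%C).
  have := eig_span lH eig aw Ha.
  move: a {aw aU qa Ha}; apply: (lspan_lin (fl b)) => _ [[s [us ps] <-] Hs].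
  have [D' hs] := untw_hn us.
  have [s0|s0] := eqVneq (mword s) 0; first by rewrite s0 (lin0 (fl b)) rpred0.
  have DD : D' = D.
    have /eqP : ((D'%:C)%C - (D%:C)%C) *: mword s = 0 by rewrite scalerBl -Hs hs.1.2 subrr.
    by rewrite scaler_eq0 (negbTE s0) orbF subr_eq0 => /eqP [].
  rewrite {}DD in hs.
  move: b bw {bU rb}; apply: (lspan_lin (fr (mword s))) => _ [t [ut pt] <-].
  have [D'' ht] := untw_hn ut.
  by have := st_comm_word hH hg hep hpre hfree stE hs ht; rewrite ps pt.
have SU : \S_ j (gbinom (D - 1) j *: (a _(j%:Z) b)) \in U.
  by apply: S_mem => j; rewrite rpredZ// (VgH_nprod hH hg).
have fU : f a b \in U by rewrite !rpredB ?rpredZ ?stU.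
have := tau_Jh hH hg heD fU fJ.
have -> : tau (f a b) = mul (tau a) (tau b) - sgn q r *: mul (tau b) (tau a) -
    tau (\S_ j (gbinom (D - 1) j *: (a _(j%:Z) b))).
  rewrite /f -[- \S_ j _]scaleN1r -[- (_ *: st b a)]scaleNr.
  rewrite tauD ?tauD ?rpredD ?rpredZ ?stU// !tauZ ?stU//.
  by rewrite !mul_tau// scaleNr scaleN1r.
move/eqP; rewrite subr_eq0 => /eqP ->.
have [N hN] := evz_np VA 0 a b.
have hN' j : (N <= j)%N -> a _(j%:Z) b = 0 by move=> /hN; rewrite add0r.
rewrite (@S_trunc _ _ N); last by move=> j /hN' ->; rewrite scaler0.
rewrite (@S_trunc _ _ N); last by move=> j /hN' ->; rewrite tau0 scaler0.
have abU j : a _(j%:Z) b \in U by exact: (VgH_nprod hH hg).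
elim: (N) => [|n IH]; first by rewrite !big_ord0 tau0.
by rewrite !big_ord_recr /= tauD ?IH ?tauZ// ?rpredZ// rpred_sum// => j _; rewrite rpredZ.
Qed.

End Generators.

(** * The tensor algebra *)

Lemma dual_free (K : fieldType) (W : lmodType K) (T : choiceType) (f : T -> W) (co : T -> W -> K^o) :
  (forall t, linear (co t)) -> (forall t s, co t (f s) = (s == t)%:R) ->
  forall (s : seq T) (c : T -> K), uniq s -> \sum_(t <- s) c t *: f t = 0 ->
  forall t, t \in s -> c t = 0.
Proof.
move=> lco coE s c us s0 t ts; have := congr1 (co t) s0.
rewrite (lin0 (lco t)) (lin_sum (lco t)) (bigD1_seq t)//= (linZ (lco t)) coE eqxx.
rewrite big1 => [|u ut]; last by rewrite (linZ (lco t)) coE (negbTE ut) scaler0.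
by rewrite addr0 => <-; rewrite /GRing.scale /= mulr1.
Qed.

Section TensorWords.
Context {K : fieldType} {W : lmodType K}.
Local Notation T := (tens W).

Definition fword (s : seq W) : freealg W := \prod_(w <- s) fvar w.

Lemma fwordE s : fword s = mkmalgU (FMonom s) 1.
Proof.
elim: s => [|w s IH].
  rewrite /fword big_nil; congr (mkmalgU _ _); apply: val_inj; exact: fm1.
rewrite /fword big_cons -/(fword s) IH /fvar.
rewrite malgM_def fgmulUU mulr1; congr (mkmalgU _ _); apply: val_inj.
by rewrite /= fmM fmU.
Qed.

Definition fcoef (m : seq W) : freealg W -> K^o := mcoeff (FMonom m).

Lemma fcoef_linear m : linear (fcoef m).
Proof.
move=> c u v; apply: etrans (mcoeffD _ _ _) _; congr (_ + _); exact: mcoeffZ.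
Qed.

Lemma fcoefE m s : fcoef m (fword s) = (s == m)%:R.
Proof. by rewrite fwordE /fcoef mcoeffU -val_eqE. Qed.

(** The coefficients of the monomials are the dual functionals. *)
Lemma fword_basis : is_basis [set: seq W] fword.
Proof.
split=> [x|s c us _ s0 t ts].
  rewrite [x]monalgE; apply: rpred_sum => k _.
  have -> : mkmalgU k (mcoeff k x) = mcoeff k x *: fword (val k).
    rewrite fwordE; apply/malgP => k'.
    by rewrite mcoeffZ !mcoeffU; case: k => k; rewrite mulr_natr.
  by rewrite rpredZ// mem_lspan//; exists (val k).
exact: (dual_free fcoef_linear fcoefE) us s0 _ ts.
Qed.

Definition tword (s : seq W) : T := \prod_(w <- s) tin w.

Lemma aproj_fword s : aproj (@multilinear_rel K W) (fword s) = tword s.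
Proof. by rewrite /fword rmorph_prod. Qed.

Lemma tword_span (t : T) : t \in lspan (range tword).
Proof.
rewrite -[t]aprojK; have := (fword_basis).1 (repr (t : lquot (ideal_gen (@multilinear_rel K W)))).
apply: (lspan_lin (f := aproj (@multilinear_rel K W))) => [|_ [s _ <-]]; first exact: linearP.
by rewrite aproj_fword; apply: mem_lspan; exists s.
Qed.

(** The universal property of the tensor algebra is proved for left modules
    rather than for algebras, as both morphisms and derivations follow from this
    form.  The action of words of the free algebra is forced, and it respects the
    relations of multilinearity since [act] is linear in its first argument. *)
Lemma tens_action {X : lmodType K} (act : W -> X -> X) : bilinear_map act ->
  exists rho : T -> X -> X, [/\ bilinear_map rho, forall v, rho 1 v = v
    & forall w t v, rho (tin w * t) v = act w (rho t v)].
Proof.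
move=> [actl actr].
have ex v : exists L : freealg W -> X, linear L /\ forall s, L (fword s) = foldr act v s.
  have [L [lL LE]] := basis_ext fword_basis (fun s => foldr act v s).
  by exists L; split=> // s; apply: LE.
have [L LP] := choice ex.
have lL v := (LP v).1; have LE v := (LP v).2.
have fx (X' : lmodType K) (f h : freealg W -> X') : linear f -> linear h ->
    (forall s, f (fword s) = h (fword s)) -> f =1 h.
  move=> lf lh fh t; move: t (fword_basis.1 t); apply: lspan_ind.
    by rewrite (lin0 lf) (lin0 lh).
  by move=> c _ v [s _ <-] IH; rewrite lf lh IH fh.
have Lr t : linear (L ^~ t).
  move=> c u v; pose f t := L (c *: u + v) t; pose h t := c *: L u t + L v t.
  suff : f =1 h by apply.
  apply: (fx) => [|z x y|s]; rewrite /f /h; first exact: lL.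
    by rewrite !(lL _ z); lmod K.
  rewrite !LE; elim: s => //= w s ->; exact: actr.
have LM x y v : L v (x * y) = L (L v y) x.
  pose f x := L v (x * y); pose h x := L (L v y) x.
  suff : f =1 h by apply.
  apply: (fx) => [z a b|z a b|s]; rewrite /f /h; first by rewrite mulrDl -scalerAl (lL _ z).
    exact: lL.
  rewrite LE; pose f2 y := L v (fword s * y); pose h2 y := foldr act (L v y) s.
  suff : f2 =1 h2 by apply.
  apply: (fx) => [z a b|z a b|t]; rewrite /f2 /h2; first by rewrite mulrDr -scalerAr (lL _ z).
    by rewrite (lL _ z); elim: (s) => //= w s' ->; exact: actr.
  by rewrite -[fword s * _]big_cat [LHS](LE v (s ++ t)) LE foldr_cat.
have L1 v : L v 1 = v by have := LE v [::]; rewrite /fword big_nil.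
have Lv v w : L v (fvar w) = act w v by have := LE v [:: w]; rewrite /fword big_seq1.
have Lideal v x : x \in lspan (ideal_gen (@multilinear_rel K W)) -> L v x = 0.
  move: x; apply: lspan_ind; first exact: (lin0 (lL v)).
  move=> c _ x [a [r [b [[c' [w [w' ->]]] ->]]]] IH.
  rewrite (lL v c) IH addr0 !LM; set u := L v b.
  rewrite (linB (lL u)) (linB (lL u)) (linZ (lL u)) !Lv (actl u).
  rewrite [_ + act w' u]addrC addrK subrr.
  by rewrite (lin0 (Lr a)) scaler0.
pose rho (t : T) v := L v (repr (t : lquot (ideal_gen (@multilinear_rel K W)))).
have rhoE x v : rho (aproj (@multilinear_rel K W) x) v = L v x.
  apply/eqP; rewrite -subr_eq0 /rho -(linB (lL v)); apply/eqP; apply: Lideal.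
  by apply/aproj_eq; rewrite aprojK.
have tE (t : T) : exists x, t = aproj (@multilinear_rel K W) x by exists (repr (t : lquot _)); rewrite aprojK.
exists rho; split.
- split=> [v c t u|t c u v]; last exact: Lr.
  have [x ->] := tE t; have [y ->] := tE u.
  by rewrite -linearZ -raddfD !rhoE (lL v c).
- by move=> v; rewrite -[1](rmorph1 (aproj (@multilinear_rel K W))) rhoE L1.
- by move=> w t v; have [x ->] := tE t; rewrite /tin -rmorphM !rhoE LM Lv.
Qed.

End TensorWords.

Section Universal.
Context {K : fieldType} {W : lmodType K} {T : algType K} (ti : W -> T) (lti : linear ti).

Definition tw (s : seq W) : T := \prod_(w <- s) ti w.

(** The two facts about the tensor algebra that are used: it is spanned by words,
    and it acts on X as soon as W does.  Stating them for an abstract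
    algebra [T] keeps conversion from unfolding the quotient that defines the
    tensor algebra. *)
Definition tensor_like := (forall t : T, t \in lspan (range tw)) /\
  forall (X : lmodType K) (act : W -> X -> X), bilinear_map act ->
  exists rho : T -> X -> X, [/\ bilinear_map rho, forall v, rho 1 v = v
    & forall w t v, rho (ti w * t) v = act w (rho t v)].

Context (hT : tensor_like).

Lemma tw_nil : tw [::] = 1. Proof. exact: big_nil. Qed.
Lemma tw_cons w s : tw (w :: s) = ti w * tw s. Proof. exact: big_cons. Qed.
Lemma tw_cat s t : tw (s ++ t) = tw s * tw t. Proof. exact: big_cat. Qed.

Lemma tens_ext {X : lmodType K} (f h : T -> X) : linear f -> linear h ->
  (forall s, f (tw s) = h (tw s)) -> f =1 h.
Proof.
move=> lf lh fh t; move: t (hT.1 t); apply: lspan_ind.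
  by rewrite (lin0 lf) (lin0 lh).
by move=> c _ v [s _ <-] IH; rewrite lf lh IH fh.
Qed.

(** A derivation D amounts to the action of W on pairs that makes (t, D t) the
    image of (1, 0) under t. *)
Lemma tens_derivation (f l : W -> T) (theta : T -> T) : linear f -> linear l -> linear theta ->
  exists D : T -> T, [/\ linear D, D 1 = 0
    & forall w t, D (ti w * t) = f w * theta t + l w * D t].
Proof.
move=> lf ll lt.
pose act (w : W) (x : T * T) := (ti w * x.1, f w * theta x.1 + l w * x.2).
have [|rho [[rl rr] r1 rM]] := hT.2 (T * T)%type act.
  split=> [[x y] c u v|w c [x y] [x' y']]; rewrite /act /=.
    rewrite lti lf ll !mulrDl -!scalerAl.
    by apply: injective_projections => //=; rewrite scalerDr addrACA.
  rewrite lt !mulrDr -!scalerAr.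
  by apply: injective_projections => //=; rewrite scalerDr addrACA.
have r1E t : (rho t (1, 0)).1 = t.
  have l1 : linear (fun t => (rho t (1, 0)).1) by move=> c u v; rewrite rl.
  have l2 : linear (fun t : T => t) by [].
  apply: (tens_ext l1 l2) => s; elim: s => [|w s IH]; first by rewrite tw_nil r1.
  by rewrite tw_cons rM /= IH.
exists (fun t => (rho t (1, 0)).2); split.
- by move=> c u v; rewrite rl.
- by rewrite r1.
by move=> w t; rewrite rM /= r1E.
Qed.

(** Let w act on A as left multiplication by f w; the morphism sends t to the
    image of [one] under t. *)
Lemma tens_morphism {A : lmodType K} (mul : A -> A -> A) (one : A) (f : W -> A) :
  bilinear_map mul -> associative mul -> left_id one mul -> right_id one mul -> linear f ->
  exists phi : T -> A, [/\ linear phi, phi 1 = one, forall w, phi (ti w) = f w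
    & forall x y, phi (x * y) = mul (phi x) (phi y)].
Proof.
move=> [ml mr] mA m1 m1r lf.
have [|rho [[rl rr] r1 rM]] := hT.2 A (fun w a => mul (f w) a).
  by split=> [x c u v|w c u v]; [rewrite lf ml|rewrite mr].
have rE t a : rho t a = mul (rho t one) a.
  have l2 : linear (fun t => mul (rho t one) a) by move=> c u v; rewrite rl ml.
  apply: (tens_ext (rl a) l2) => s; elim: s => [|w s IH].
    by rewrite tw_nil !r1 m1.
  by rewrite tw_cons !rM IH mA.
exists (fun t => rho t one); split=> //.
- by move=> w; rewrite -[ti w]mulr1 rM r1 m1r.
move=> x y; rewrite -rE; have l1 : linear (fun x => rho (x * y) one).
  by move=> c u v; rewrite mulrDl -scalerAl rl.
apply: (tens_ext l1 (rl _)) => s; elim: s => [|w s IH].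
  by rewrite tw_nil mul1r r1.
by rewrite tw_cons -mulrA !rM IH.
Qed.

End Universal.

Lemma tens_tensor_like (K : fieldType) (W : lmodType K) :
  tensor_like (T := tens W) (@tin K W).
Proof. by split=> [t|X act ha]; [exact: tword_span|exact: tens_action]. Qed.

(** * The bracket on the generators of a quasi-commutative superalgebra *)

Section QuasiCommutative.
Context {K : fieldType} (two_neq0 : (2%:R : K) != 0).
Context {Z : lmodType K} (zpar : bool -> set Z) (one : Z) (mul : Z -> Z -> Z).
Context (hZ : is_superalgebra zpar one mul).
Context {W : lmodType K} (iota : W -> Z) (li : linear iota) (ii : injective iota).
Context {d : Order.disp_t} {I : orderType d} (P : set I) (x : I -> W) (p : I -> bool)
  (deg : I -> nat).
Context (hdeg : forall i, (0 < deg i)%N).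
Context (hx : forall w, w \in lspan (x @` P)).
Context (hxp : forall i, P i -> zpar (p i) (iota (x i))).

Definition ordw : set (seq I) := [set s : seq I | (forall i, i \in s -> P i) /\
  sorted (fun i j => (i < j)%O || (i == j) && ~~ p i) s].
Definition zmn (s : seq I) : Z := foldr mul one [seq iota (x i) | i <- s].
Definition ideg (s : seq I) : nat := sumn [seq deg i | i <- s].

Context (hbas : is_basis ordw zmn).
Context (hcomm : forall i j, P i -> P j ->
  mul (iota (x i)) (iota (x j)) - sgn (p i) (p j) *: mul (iota (x j)) (iota (x i))
    \in lspan (zmn @` [set s | ordw s /\ (ideg s < deg i + deg j)%N])).
Context {T : algType K} (ti : W -> T) (lti : linear ti) (hT : tensor_like ti).

Let scAl (c : K) (t u : T) : (c *: t) * u = c *: (t * u).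
Proof. exact/esym/scalerAl. Qed.
Let scAr (c : K) (t u : T) : t * (c *: u) = c *: (t * u).
Proof. exact/esym/scalerAr. Qed.
Let tmA (t u v : T) : t * (u * v) = t * u * v. Proof. exact: mulrA. Qed.
Let tmDl (t u v : T) : (t + u) * v = t * v + u * v. Proof. exact: mulrDl. Qed.
Let tmDr (t u v : T) : t * (u + v) = t * u + t * v. Proof. exact: mulrDr. Qed.
Let tmBl (t u v : T) : (t - u) * v = t * v - u * v. Proof. exact: mulrBl. Qed.
Let tmBr (t u v : T) : t * (u - v) = t * u - t * v. Proof. exact: mulrBr. Qed.
Let mull y : linear (mul ^~ y). Proof. exact: (superalg_bilinear hZ).1. Qed.
Let mulr y : linear (mul y). Proof. exact: (superalg_bilinear hZ).2. Qed.
Let mulA := superalgA hZ.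

Lemma sgnC q r : sgn q r = sgn r q :> K. Proof. by rewrite /sgn andbC. Qed.
Lemma sgn_addbr q r s : sgn q (r (+) s) = sgn q r * sgn q s :> K.
Proof.
by case: q; case: r; case: s; rewrite /sgn /= ?expr0 ?expr1 ?mulrNN ?mulr1 ?mul1r.
Qed.
Lemma sgn_sq q r : sgn q r * sgn q r = 1 :> K.
Proof. by rewrite /sgn -exprD addnn -mul2n exprM sqrrN expr1n expr1n. Qed.

(** ** Generators and their parity *)

Lemma zmn1 i : zmn [:: i] = iota (x i). Proof. exact: (superalg1r hZ). Qed.

Lemma x_basis : is_basis P x.
Proof.
split=> [w|s c us sP s0 i is']; first exact: hx.
pose c' (t : seq I) := if t is i :: _ then c i else 0.
have := hbas.2 [seq [:: i] | i <- s] c'; rewrite map_inj_uniq => [/(_ us) h|? ? []//].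
apply: (h _ _ [:: i]); last by apply: map_f.
  move=> _ /mapP[j js ->]; split=> // k; rewrite inE => /eqP ->; exact: sP.
rewrite big_map -[RHS](lin0 li) -s0 (lin_sum li); apply: eq_bigr => j _.
by rewrite zmn1 (linZ li).
Qed.

Definition par q : set W := [set w | zpar q (iota w)].

Lemma x_par i : P i -> par (p i) (x i). Proof. exact: hxp. Qed.

Lemma zpar_sub q : is_subspace (zpar q).
Proof. by case: (superalg_direct hZ) => + _ _; apply. Qed.

Lemma par_sub q : is_subspace (par q).
Proof.
have [z0 zL] := zpar_sub q; split; rewrite /par /=; first by rewrite (lin0 li).
by move=> c u v hu hv; rewrite li; apply: zL.
Qed.

Lemma par_direct : is_direct_sum [set: bool] par.
Proof.
apply: bool_direct_sum; first exact: par_sub.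
  move=> w; apply: lspan_mono (hx w) => _ [i Pi <-]; exists (p i) => //; exact: x_par.
move=> u v pu pv uv0; apply: ii; rewrite (lin0 li).
by apply: (dsum_eq0 (superalg_direct hZ) pu pv _).1; rewrite -(linD li) uv0 (lin0 li).
Qed.

Lemma par_span q w : par q w -> w \in lspan (x @` [set i | P i /\ p i = q]).
Proof. by move=> hw; apply: (dsum_label par_direct _ hw (hx w)); exact: x_par. Qed.

(** The projections to the parity components. *)
Definition prW (q : bool) : W -> W :=
  sval (cid (basis_ext x_basis (fun i => if p i == q then x i else 0))).
Lemma prW_lin q : linear (prW q).
Proof. exact: (svalP (cid (basis_ext x_basis (fun i => if p i == q then x i else 0)))).1. Qed.
Lemma prWx q i : P i -> prW q (x i) = if p i == q then x i else 0.
Proof. exact: (svalP (cid (basis_ext x_basis (fun i => if p i == q then x i else 0)))).2. Qed.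

(** The automorphism w -> (-1)^(b p(w)) w, which carries the signs of the Leibniz
    rules; likewise [sigZ] and [sigT]. *)
Definition sigW (b : bool) : W -> W :=
  sval (cid (basis_ext x_basis (fun i => sgn b (p i) *: x i))).
Lemma sigW_lin b : linear (sigW b).
Proof. exact: (svalP (cid (basis_ext x_basis (fun i => sgn b (p i) *: x i)))).1. Qed.
Lemma sigWx b i : P i -> sigW b (x i) = sgn b (p i) *: x i.
Proof. exact: (svalP (cid (basis_ext x_basis (fun i => sgn b (p i) *: x i)))).2. Qed.

Lemma x_ext (X : lmodType K) (f h : W -> X) : linear f -> linear h ->
  (forall i, P i -> f (x i) = h (x i)) -> f =1 h.
Proof.
move=> lf lh fh w; move: w (hx w); apply: lspan_ind; first by rewrite (lin0 lf) (lin0 lh).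
by move=> c _ v [i Pi <-] IH; rewrite lf lh IH fh.
Qed.

Lemma x_ext_par (X : lmodType K) q (f h : W -> X) : linear f -> linear h ->
  (forall i, P i -> p i = q -> f (x i) = h (x i)) -> forall w, par q w -> f w = h w.
Proof.
move=> lf lh fh w /par_span; move: w; apply: lspan_ind; first by rewrite (lin0 lf) (lin0 lh).
by move=> c _ v [i [Pi pq] <-] IH; rewrite lf lh IH fh.
Qed.

Lemma prW_par q w : par q w -> prW q w = w.
Proof.
apply: x_ext_par => [|//|i Pi pq]; first exact: prW_lin.
by rewrite prWx// pq eqxx.
Qed.

Lemma prW_npar q w : par q w -> prW (~~ q) w = 0.
Proof.
apply: (@x_ext_par _ _ _ (fun=> 0)) => [|c u v|i Pi pq]; first exact: prW_lin.
  by rewrite scaler0 addr0.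
by rewrite prWx// pq; case: (q).
Qed.

Lemma prW_sum w : prW false w + prW true w = w.
Proof.
apply: (x_ext (f := fun w => prW false w + prW true w)) => [c u v|//|i Pi].
  by rewrite !prW_lin; lmod K.
by rewrite !prWx//; case: (p i); rewrite /= ?addr0 ?add0r.
Qed.

Lemma sigW_par b q w : par q w -> sigW b w = sgn b q *: w.
Proof.
apply: x_ext_par => [|c u v|i Pi pq]; first exact: sigW_lin.
  by lmod K.
by rewrite sigWx// pq.
Qed.

(** ** The parity automorphism of the superalgebra *)

Definition prZ : bool -> Z -> Z := sval (cid (bool_proj (superalg_direct hZ))).
Lemma prZP : [/\ forall q, linear (prZ q), forall q v, zpar q (prZ q v),
  forall v, v = prZ false v + prZ true v
  & forall q v, zpar q v -> prZ q v = v /\ prZ (~~ q) v = 0].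
Proof. exact: (svalP (cid (bool_proj (superalg_direct hZ)))). Qed.

Definition sigZ (b : bool) (z : Z) : Z := prZ false z + sgn b true *: prZ true z.

Lemma sigZ_lin b : linear (sigZ b).
Proof. by have [lp _ _ _] := prZP => c u v; rewrite /sigZ !lp; lmod K. Qed.

Lemma sigZ_par b q z : zpar q z -> sigZ b z = sgn b q *: z.
Proof.
have [_ _ _ h] := prZP => /h; rewrite /sigZ; case: q => -[/= -> ->].
  by rewrite add0r.
by rewrite scaler0 addr0 /sgn andbF scale1r.
Qed.

Lemma sigZ1 b : sigZ b one = one.
Proof. by rewrite (sigZ_par b (superalg_par1 hZ)) /sgn andbF scale1r. Qed.

Lemma z_ext (X : lmodType K) (f h : Z -> X) : linear f -> linear h ->
  (forall q z, zpar q z -> f z = h z) -> f =1 h.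
Proof.
have [_ pz zE _] := prZP => lf lh fh z; rewrite [z]zE (linD lf) (linD lh).
by rewrite (fh _ _ (pz false z)) (fh _ _ (pz true z)).
Qed.

Lemma sigZ_mul b u v : sigZ b (mul u v) = mul (sigZ b u) (sigZ b v).
Proof.
apply: (z_ext (f := fun u => sigZ b (mul u v)) (h := fun u => mul (sigZ b u) (sigZ b v))) => [c y z|c y z|q {}u pu].
- by rewrite mull sigZ_lin.
- by rewrite sigZ_lin mull.
apply: (z_ext (f := fun v => sigZ b (mul u v)) (h := fun v => mul (sigZ b u) (sigZ b v))) => [c y z|c y z|r {}v pv].
- by rewrite mulr sigZ_lin.
- by rewrite sigZ_lin mulr.
rewrite (sigZ_par b (superalg_parM hZ pu pv)) (sigZ_par b pu) (sigZ_par b pv).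
by rewrite (linZ (mull _)) (linZ (mulr _)) scalerA sgn_addbr.
Qed.

Lemma iota_sig b w : iota (sigW b w) = sigZ b (iota w).
Proof.
apply: (x_ext (f := fun w => iota (sigW b w)) (h := fun w => sigZ b (iota w))) => [c u v|c u v|i Pi].
- by rewrite sigW_lin li.
- by rewrite li sigZ_lin.
by rewrite sigWx// (linZ li) (sigZ_par b (hxp Pi)).
Qed.

(** ** The section of the projection and the bracket *)

Definition tx (s : seq I) : T := tw ti [seq x i | i <- s].
Lemma tx_cons i s : tx (i :: s) = ti (x i) * tx s. Proof. exact: tw_cons. Qed.
Lemma tx_cat s t : tx (s ++ t) = tx s * tx t. Proof. by rewrite /tx map_cat tw_cat. Qed.
Lemma tx_nil : tx [::] = 1. Proof. exact: tw_nil. Qed.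

(** The section of T(W) -> Z that writes an element in ordered monomials. *)
Definition sec : Z -> T := sval (cid (basis_ext hbas tx)).
Lemma sec_lin : linear sec. Proof. exact: (svalP (cid (basis_ext hbas tx))).1. Qed.
Lemma sec_zmn s : ordw s -> sec (zmn s) = tx s.
Proof. exact: (svalP (cid (basis_ext hbas tx))).2. Qed.

Let mor := tens_morphism hT (superalg_bilinear hZ) mulA (superalg1l hZ) (superalg1r hZ) li.
Definition evZ : T -> Z := sval (cid mor).
Lemma evZP : [/\ linear evZ, evZ 1 = one, forall w, evZ (ti w) = iota w
  & forall t u, evZ (t * u) = mul (evZ t) (evZ u)].
Proof. exact: (svalP (cid mor)). Qed.
Lemma evZ_lin : linear evZ. Proof. by case: evZP. Qed.
Lemma evZ1 : evZ 1 = one. Proof. by case: evZP. Qed.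
Lemma evZ_ti w : evZ (ti w) = iota w. Proof. by case: evZP. Qed.
Lemma evZM t u : evZ (t * u) = mul (evZ t) (evZ u). Proof. by case: evZP. Qed.

Lemma evZ_tx s : evZ (tx s) = zmn s.
Proof.
elim: s => [|i s IH]; first by rewrite tx_nil evZ1.
by rewrite tx_cons evZM evZ_ti IH.
Qed.

Lemma evZ_sec z : evZ (sec z) = z.
Proof.
move: z (hbas.1 z); apply: lspan_ind; first by rewrite (lin0 sec_lin) (lin0 evZ_lin).
by move=> c _ z [s os <-] IH; rewrite sec_lin evZ_lin IH sec_zmn// evZ_tx.
Qed.

(** The supercommutator of [a] and [y] for [a] of parity [b]: the twist [sigZ b y]
    carries the sign, so that [y] need not be homogeneous. *)
Definition cz (b : bool) (a y : Z) : Z := mul a y - mul (sigZ b y) a.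

Lemma czl b y : linear (cz b ^~ y).
Proof. by move=> c u v; rewrite /cz mull mulr; lmod K. Qed.
Lemma czr b a : linear (cz b a).
Proof. by move=> c u v; rewrite /cz mulr sigZ_lin mull; lmod K. Qed.

Lemma cz_par b q a y : zpar q y -> cz b a y = mul a y - sgn b q *: mul y a.
Proof. by move=> py; rewrite /cz (sigZ_par b py) (linZ (mull _)). Qed.

(** The supercommutator written in ordered monomials. *)
Definition br (w v : W) : T :=
  sec (cz false (iota (prW false w)) (iota v)) + sec (cz true (iota (prW true w)) (iota v)).

Lemma br_l v : linear (br ^~ v).
Proof. by move=> c u w; rewrite /br !prW_lin !li !czl !sec_lin; lmod K. Qed.
Lemma br_r w : linear (br w).
Proof. by move=> c u v; rewrite /br !li !czr !sec_lin; lmod K. Qed.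

Lemma br_par b w v : par b w -> br w v = sec (cz b (iota w) (iota v)).
Proof.
move=> hw; have := prW_npar hw; have := prW_par hw; rewrite /br; case: (b) => /= -> ->;
  by rewrite (lin0 li) (lin0 (czl _ _)) (lin0 sec_lin) ?addr0 ?add0r.
Qed.

Lemma evZ_br b w v : par b w -> evZ (br w v) = cz b (iota w) (iota v).
Proof. by move=> hw; rewrite (br_par v hw) evZ_sec. Qed.

Lemma evZ_br_r b w v : par b v ->
  evZ (br w v) = mul (iota w) (iota v) - mul (iota v) (sigZ b (iota w)).
Proof.
move=> hv; apply: (x_ext (f := fun w => evZ (br w v))
  (h := fun w => mul (iota w) (iota v) - mul (iota v) (sigZ b (iota w)))) => [c u w'|c u w'|i Pi].
- by rewrite br_l evZ_lin.
- by rewrite li sigZ_lin mull mulr; lmod K.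
rewrite (evZ_br v (x_par Pi)) (cz_par _ _ hv) (sigZ_par b (hxp Pi)) (linZ (mulr _)).
by rewrite sgnC.
Qed.

(** ** Filtrations *)

(** As for [Fil], the bound on the degree is strict. *)
Definition Tf (n : nat) : {pred T} :=
  lspan (tx @` [set s : seq I | (forall i, i \in s -> P i) /\ (ideg s < n)%N]).
HB.instance Definition _ n := GRing.SubmodClosed.on (Tf n).
Definition Zf (n : nat) : {pred Z} := lspan (zmn @` [set s | ordw s /\ (ideg s < n)%N]).
HB.instance Definition _ n := GRing.SubmodClosed.on (Zf n).
Definition Wd (n : nat) : {pred W} := lspan (x @` [set i | P i /\ deg i = n]).
HB.instance Definition _ n := GRing.SubmodClosed.on (Wd n).

Lemma ideg_cat s t : ideg (s ++ t) = (ideg s + ideg t)%N.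
Proof. by rewrite /ideg map_cat sumn_cat. Qed.
Lemma ideg_cons i s : ideg (i :: s) = (deg i + ideg s)%N. Proof. by []. Qed.
Lemma ideg_perm s t : perm_eq s t -> ideg s = ideg t.
Proof. by move=> st; apply: perm_sumn; apply: perm_map. Qed.

Lemma Tf_mono m n t : (m <= n)%N -> t \in Tf m -> t \in Tf n.
Proof.
move=> mn; apply: lspan_mono => _ [s [sP sm] <-]; exists s => //; split=> //.
exact: leq_trans mn.
Qed.

Lemma Tf_mul m n t u : t \in Tf m -> u \in Tf n -> t * u \in Tf (m + n).-1.
Proof.
have lml (v : T) : linear (fun t => t * v) by move=> c a b; rewrite tmDl scAl.
have lmr (v : T) : linear (fun t => v * t) by move=> c a b; rewrite tmDr scAr.
move=> ht hu; move: t ht; apply: (lspan_lin (lml u)) => _ [s [sP sm] <-].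
move: u hu; apply: (lspan_lin (lmr _)) => _ [s' [sP' sn] <-].
rewrite -tx_cat; apply: mem_lspan; exists (s ++ s') => //; split.
  by move=> i; rewrite mem_cat => /orP[/sP|/sP'].
by rewrite ideg_cat; move: sm sn; lia.
Qed.

Lemma tx_Tf s : (forall i, i \in s -> P i) -> tx s \in Tf (ideg s).+1.
Proof. by move=> sP; apply: mem_lspan; exists s. Qed.

Lemma ti_Tf i : P i -> ti (x i) \in Tf (deg i).+1.
Proof.
move=> Pi; have := @tx_Tf [:: i]; rewrite tx_cons tx_nil mulr1 ideg_cons addn0.
by apply=> j; rewrite inE => /eqP ->.
Qed.

Lemma Tf_all t : exists n, t \in Tf n.
Proof.
have addTf a b : (exists n, a \in Tf n) -> (exists n, b \in Tf n) -> exists n, a + b \in Tf n.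
  move=> [m am] [n bn]; exists (maxn m n); apply: rpredD.
    exact: Tf_mono (leq_maxl _ _) am.
  exact: Tf_mono (leq_maxr _ _) bn.
have tiw w : exists n, ti w \in Tf n.
  move: w (hx w); apply: lspan_ind; first by exists 0%N; rewrite (lin0 lti) rpred0.
  move=> c _ v [i Pi <-] IH; rewrite lti; apply: addTf => //.
  by exists (deg i).+1; rewrite rpredZ// ti_Tf.
move: t (hT.1 t); apply: lspan_ind; first by exists 0%N; apply: rpred0.
move=> c _ v [s _ <-] IH; apply: addTf => //.
suff [n sn] : exists n, tw ti s \in Tf n by exists n; apply: rpredZ.
elim: s => [|w s [n IHs]].
  by exists 1%N; apply: mem_lspan; exists [::]; rewrite // tx_nil tw_nil.
by rewrite tw_cons; have [m wm] := tiw w; exists (m + n).-1; apply: Tf_mul.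
Qed.

Lemma sec_Zf n z : z \in Zf n -> sec z \in Tf n.
Proof.
move: z; apply: (lspan_lin sec_lin) => _ [s [os sn] <-]; rewrite sec_zmn//.
by apply: mem_lspan; exists s => //; split=> //; case: os.
Qed.

Lemma br_x i j : P i -> P j -> br (x i) (x j) \in Tf (deg i + deg j).
Proof.
move=> Pi Pj; rewrite (br_par _ (x_par Pi)) (cz_par _ _ (hxp Pj)).
by apply: sec_Zf; apply: hcomm.
Qed.

Lemma br_Wd m n w v : w \in Wd m -> v \in Wd n -> br w v \in Tf (m + n).
Proof.
move=> wm vn; move: w wm; apply: (lspan_lin (br_l v)) => _ [i [Pi <-] <-].
move: v vn; apply: (lspan_lin (br_r _)) => _ [j [Pj <-] <-]; exact: br_x.
Qed.

(** ** The parity automorphism and the derivations of the tensor algebra *)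

Let T_bil : bilinear_map (fun t u : T => t * u).
Proof. by split=> v c t u; rewrite ?tmDl ?tmDr ?scAl ?scAr. Qed.
Let lsig b : linear (fun w => ti (sigW b w)).
Proof. by move=> c u v; rewrite sigW_lin lti. Qed.
Let Tsig b := tens_morphism hT T_bil (@GRing.mulrA T) (@mul1r T) (@mulr1 T) (lsig b).
Definition sigT b : T -> T := sval (cid (Tsig b)).
Lemma sigTP b : [/\ linear (sigT b), sigT b 1 = 1, forall w, sigT b (ti w) = ti (sigW b w)
  & forall t u, sigT b (t * u) = sigT b t * sigT b u].
Proof. exact: (svalP (cid (Tsig b))). Qed.
Lemma sigT_lin b : linear (sigT b). Proof. by case: (sigTP b). Qed.
Lemma sigT1 b : sigT b 1 = 1. Proof. by case: (sigTP b). Qed.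
Lemma sigT_ti b w : sigT b (ti w) = ti (sigW b w). Proof. by case: (sigTP b). Qed.
Lemma sigTM b t u : sigT b (t * u) = sigT b t * sigT b u. Proof. by case: (sigTP b). Qed.

Definition ipar (s : seq I) : bool := foldr (fun i b => p i (+) b) false s.

Lemma sigT_tx b s : (forall i, i \in s -> P i) -> sigT b (tx s) = sgn b (ipar s) *: tx s.
Proof.
elim: s => [|i s IH] sP; first by rewrite tx_nil sigT1 /sgn andbF scale1r.
have Pi : P i by apply: sP; rewrite inE eqxx.
rewrite tx_cons sigTM sigT_ti sigWx// IH; last by move=> j js; apply: sP; rewrite inE js orbT.
by rewrite (linZ lti) scAl scAr scalerA /= sgn_addbr.
Qed.

Lemma sigT_Tf b n t : t \in Tf n -> sigT b t \in Tf n.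
Proof.
move: t; apply: (lspan_lin (sigT_lin b)) => _ [s [sP sn] <-].
by rewrite sigT_tx// rpredZ//; apply: mem_lspan; exists s.
Qed.

Lemma evZ_sigT b t : evZ (sigT b t) = sigZ b (evZ t).
Proof.
apply: (tens_ext hT (f := fun t => evZ (sigT b t)) (h := fun t => sigZ b (evZ t))) => [c u v|c u v|s].
- by rewrite sigT_lin evZ_lin.
- by rewrite evZ_lin sigZ_lin.
elim: s => [|w s IH]; first by rewrite tw_nil sigT1 evZ1 sigZ1.
by rewrite tw_cons sigTM !evZM IH sigT_ti !evZ_ti sigZ_mul iota_sig.
Qed.

Let id_lin : linear (fun t : T => t). Proof. by []. Qed.

(** The extension of br a to T(W) by the left Leibniz rule, for a of parity b. *)
Definition DL (b : bool) (a : W) : T -> T :=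
  sval (cid (tens_derivation lti hT (br_r a) (lsig b) id_lin)).
Lemma DLP b a : [/\ linear (DL b a), DL b a 1 = 0
  & forall w t, DL b a (ti w * t) = br a w * t + ti (sigW b w) * DL b a t].
Proof. exact: (svalP (cid (tens_derivation lti hT (br_r a) (lsig b) id_lin))). Qed.

Lemma DL_linl b t : linear (DL b ^~ t).
Proof.
move=> c a a'; have [l1 _ _] := DLP b (c *: a + a'); have [l2 _ _] := DLP b a.
have [l3 _ _] := DLP b a'.
apply: (tens_ext hT (h := fun t => c *: DL b a t + DL b a' t) l1) => [z u v|s].
  by rewrite l2 l3; lmod K.
elim: s => [|w s IH].
  rewrite tw_nil; have [_ -> _] := DLP b (c *: a + a'); have [_ -> _] := DLP b a; have [_ -> _] := DLP b a'.
  by rewrite scaler0 addr0.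
have [_ _ e1] := DLP b (c *: a + a'); have [_ _ e2] := DLP b a; have [_ _ e3] := DLP b a'.
rewrite tw_cons e1 e2 e3 IH br_l tmDl tmDr !scAl !scAr; lmod K.
Qed.

Lemma DL_mul b a t u : DL b a (t * u) = DL b a t * u + sigT b t * DL b a u.
Proof.
have [l1 D1 e1] := DLP b a.
apply: (tens_ext hT (f := fun t => DL b a (t * u))
  (h := fun t => DL b a t * u + sigT b t * DL b a u)) => [c y z|c y z|s].
- by rewrite tmDl scAl l1.
- by rewrite l1 sigT_lin !tmDl !scAl; lmod K.
elim: s => [|w s IH]; first by rewrite tw_nil D1 sigT1 mul0r !mul1r add0r.
by rewrite tw_cons -tmA !e1 IH sigTM sigT_ti tmDr [X in _ = X + _]tmDl !tmA addrA.
Qed.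

Definition brl (a : W) (t : T) : T := DL false (prW false a) t + DL true (prW true a) t.

Lemma brl_bilinear : bilinear_map brl.
Proof.
split=> [t c a a'|a c t u]; rewrite /brl; first by rewrite !prW_lin !DL_linl; lmod K.
have [l1 _ _] := DLP false (prW false a); have [l2 _ _] := DLP true (prW true a).
by rewrite l1 l2; lmod K.
Qed.

Lemma brl_par b a t : par b a -> brl a t = DL b a t.
Proof.
move=> ha; have := prW_npar ha; have := prW_par ha; rewrite /brl; case: (b) => /= -> ->;
  by rewrite (lin0 (DL_linl _ _)) ?addr0 ?add0r.
Qed.

Lemma brl_ti a w : brl a (ti w) = br a w.
Proof.
rewrite -[ti w]mulr1 /brl; have [_ D1 ->] := DLP false (prW false a).
have [_ D2 ->] := DLP true (prW true a); rewrite D1 D2 !mulr0 !addr0 !mulr1.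
by rewrite -[X in _ = br X w]prW_sum (linD (br_l w)).
Qed.

(** The extension of br _ c to T(W) by the right Leibniz rule, for c of
    parity b. *)
Definition DR (b : bool) (c : W) : T -> T :=
  sval (cid (tens_derivation lti hT (br_l c) lti (sigT_lin b))).
Lemma DRP b c : [/\ linear (DR b c), DR b c 1 = 0
  & forall w t, DR b c (ti w * t) = br w c * sigT b t + ti w * DR b c t].
Proof. exact: (svalP (cid (tens_derivation lti hT (br_l c) lti (sigT_lin b)))). Qed.

Lemma DR_linl b t : linear (DR b ^~ t).
Proof.
move=> c a a'; have [l1 D1 e1] := DRP b (c *: a + a'); have [l2 D2 e2] := DRP b a.
have [l3 D3 e3] := DRP b a'.
apply: (tens_ext hT (h := fun t => c *: DR b a t + DR b a' t) l1) => [z u v|s].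
  by rewrite l2 l3; lmod K.
elim: s => [|w s IH]; first by rewrite tw_nil D1 D2 D3 scaler0 addr0.
rewrite tw_cons e1 e2 e3 IH br_r tmDl tmDr !scAl !scAr; lmod K.
Qed.

Lemma DR_mul b c t u : DR b c (t * u) = t * DR b c u + DR b c t * sigT b u.
Proof.
have [l1 D1 e1] := DRP b c.
apply: (tens_ext hT (f := fun t => DR b c (t * u))
  (h := fun t => t * DR b c u + DR b c t * sigT b u)) => [z y y'|z y y'|s].
- by rewrite tmDl scAl l1.
- by rewrite l1 !tmDl !scAl; lmod K.
elim: s => [|w s IH]; first by rewrite tw_nil D1 mul0r !mul1r addr0.
rewrite tw_cons -tmA !e1 IH sigTM tmDr [X in _ = _ + X]tmDl !tmA; lmod K.
Qed.

Definition brr (t : T) (c : W) : T := DR false (prW false c) t + DR true (prW true c) t.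

Lemma brr_bilinear : bilinear_map brr.
Proof.
split=> [c z t u|t z c c']; rewrite /brr; last by rewrite !prW_lin !DR_linl; lmod K.
have [l1 _ _] := DRP false (prW false c); have [l2 _ _] := DRP true (prW true c).
by rewrite l1 l2; lmod K.
Qed.

Lemma brr_par b t c : par b c -> brr t c = DR b c t.
Proof.
move=> ha; have := prW_npar ha; have := prW_par ha; rewrite /brr; case: (b) => /= -> ->;
  by rewrite (lin0 (DR_linl _ _)) ?addr0 ?add0r.
Qed.

Lemma brr_ti w c : brr (ti w) c = br w c.
Proof.
rewrite -[ti w]mulr1 /brr; have [_ D1 ->] := DRP false (prW false c).
have [_ D2 ->] := DRP true (prW true c); rewrite D1 D2 !sigT1 !mulr0 !addr0 !mulr1.
by rewrite -[X in _ = br w X]prW_sum (linD (br_r w)).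
Qed.

(** Both sides are derivations that agree on W. *)
Lemma evZ_DL b a t : par b a -> evZ (DL b a t) = cz b (iota a) (evZ t).
Proof.
move=> ha; have [l1 D1 e1] := DLP b a.
apply: (tens_ext hT (f := fun t => evZ (DL b a t)) (h := fun t => cz b (iota a) (evZ t))) => [c y z|c y z|s].
- by rewrite l1 evZ_lin.
- by rewrite evZ_lin czr.
elim: s => [|w s IH].
  by rewrite tw_nil D1 (lin0 evZ_lin) evZ1 /cz sigZ1 (superalg1l hZ) (superalg1r hZ) subrr.
rewrite tw_cons e1 (linD evZ_lin) !evZM IH evZ_ti iota_sig evZ_ti (evZ_br _ ha) /cz sigZ_mul.
rewrite (linB (mull _)) (linB (mulr _)) !mulA; lmod K.
Qed.

Lemma evZ_DR b c t : par b c ->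
  evZ (DR b c t) = mul (evZ t) (iota c) - mul (iota c) (sigZ b (evZ t)).
Proof.
move=> hc; have [l1 D1 e1] := DRP b c.
apply: (tens_ext hT (f := fun t => evZ (DR b c t))
  (h := fun t => mul (evZ t) (iota c) - mul (iota c) (sigZ b (evZ t)))) => [z y y'|z y y'|s].
- by rewrite l1 evZ_lin.
- by rewrite evZ_lin sigZ_lin mull mulr; lmod K.
elim: s => [|w s IH].
  by rewrite tw_nil D1 (lin0 evZ_lin) evZ1 sigZ1 (superalg1l hZ) (superalg1r hZ) subrr.
rewrite tw_cons e1 (linD evZ_lin) !evZM IH evZ_ti evZ_sigT (evZ_br_r _ hc) sigZ_mul.
rewrite (linB (mull _)) (linB (mulr _)) !mulA; lmod K.
Qed.

Lemma DL_Tf b l n a t : a \in Wd l -> t \in Tf n -> DL b a t \in Tf (l + n).-1.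
Proof.
move=> al; have [l1 D1 e1] := DLP b a.
move: t; apply: (lspan_lin l1) => _ [s [sP sn] <-].
apply: (Tf_mono (m := l + ideg s)); first by move: sn; lia.
elim: s sP {sn} => [|i s IH] sP; first by rewrite tx_nil D1 rpred0.
have Pi : P i by apply: sP; rewrite inE eqxx.
have sP' j : j \in s -> P j by move=> js; apply: sP; rewrite inE js orbT.
rewrite tx_cons e1 sigWx// (linZ lti) scAl ideg_cons; apply: rpredD.
  have xi : x i \in Wd (deg i) by apply: mem_lspan; exists i.
  by apply: Tf_mono (Tf_mul (br_Wd al xi) (tx_Tf sP')); lia.
by apply: rpredZ; apply: Tf_mono (Tf_mul (ti_Tf Pi) (IH sP')); lia.
Qed.

Lemma DR_Tf b l n c t : c \in Wd l -> t \in Tf n -> DR b c t \in Tf (l + n).-1.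
Proof.
move=> cl; have [l1 D1 e1] := DRP b c.
move: t; apply: (lspan_lin l1) => _ [s [sP sn] <-].
apply: (Tf_mono (m := l + ideg s)); first by move: sn; lia.
elim: s sP {sn} => [|i s IH] sP; first by rewrite tx_nil D1 rpred0.
have Pi : P i by apply: sP; rewrite inE eqxx.
have sP' j : j \in s -> P j by move=> js; apply: sP; rewrite inE js orbT.
rewrite tx_cons e1 ideg_cons; apply: rpredD.
  have xi : x i \in Wd (deg i) by apply: mem_lspan; exists i.
  by apply: Tf_mono (Tf_mul (br_Wd xi cl) (sigT_Tf b (tx_Tf sP'))); lia.
by apply: Tf_mono (Tf_mul (ti_Tf Pi) (IH sP')); lia.
Qed.

(** ** Rewriting to ordered monomials *)

(** The relations between basis elements, multiplied by words.  Such a relation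
    has the degree of the word that contains both letters. *)
Definition Mrel (n : nat) : {pred T} := lspan [set t | exists A i j B,
  [/\ forall k, k \in A ++ i :: j :: B -> P k, (ideg (A ++ i :: j :: B) < n)%N
    & t = tx A * (ti (x i) * ti (x j) - sgn (p i) (p j) *: (ti (x j) * ti (x i))
                  - br (x i) (x j)) * tx B]].
HB.instance Definition _ n := GRing.SubmodClosed.on (Mrel n).

Lemma Mrel_mono m n t : (m <= n)%N -> t \in Mrel m -> t \in Mrel n.
Proof.
move=> mn; apply: lspan_mono => _ [A [i [j [B [AP Am ->]]]]]; exists A, i, j, B; split=> //.
exact: leq_trans mn.
Qed.

Lemma evZ_rel q r a b A B : par q a -> par r b ->
  evZ (A * (ti a * ti b - sgn q r *: (ti b * ti a) - br a b) * B) = 0.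
Proof.
move=> pa pb; rewrite !evZM (linB evZ_lin) (linB evZ_lin) (linZ evZ_lin) !evZM !evZ_ti.
rewrite (evZ_br _ pa) (cz_par _ _ pb) subrr (lin0 (mulr _)); exact: (lin0 (mull _)).
Qed.

Lemma evZ_Mrel n t : t \in Mrel n -> evZ t = 0.
Proof.
move: t; apply: lspan_ind; first exact: (lin0 evZ_lin).
move=> c _ v [A [i [j [B [AP _ ->]]]]] IH; rewrite evZ_lin IH addr0 evZ_rel ?scaler0//;
  by apply: x_par; apply: AP; rewrite mem_cat !inE eqxx ?orbT.
Qed.

(** Swapping neighbours adds a multiple of a relation and a term with a bracket,
    and the latter has lower degree. *)
Lemma Tf_normal n t : t \in Tf n ->
  t \in lspan (tx @` [set s | ordw s /\ (ideg s < n)%N] `|` [set t | t \in Mrel n]).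
Proof.
elim/ltn_ind: n t => n IH; apply: lspan_sub => _ [s0 [sP sn] <-].
apply: (sorting_mem (od := p) two_neq0 lt_trans).
- by move=> i j; case: ltgtP.
- move=> A i j B pe.
  have AP k : k \in A ++ i :: j :: B -> P k by rewrite (perm_mem pe); exact: sP.
  have dA : ideg (A ++ i :: j :: B) = ideg s0 := ideg_perm pe.
  have -> : tx (A ++ i :: j :: B) - (-1) ^+ (p i && p j) *: tx (A ++ j :: i :: B) =
      tx A * (ti (x i) * ti (x j) - sgn (p i) (p j) *: (ti (x j) * ti (x i)) - br (x i) (x j)) * tx B
      + tx A * br (x i) (x j) * tx B.
    rewrite !tx_cat !tx_cons !tmBr !tmBl scAr scAl !tmA /sgn; lmod K.
  apply: rpredD.
    by apply: mem_lspan; right; apply: mem_lspan; exists A, i, j, B; rewrite dA.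
  have Pi : P i by apply: AP; rewrite mem_cat !inE eqxx ?orbT.
  have Pj : P j by apply: AP; rewrite mem_cat !inE eqxx ?orbT.
  have PA k : k \in A -> P k by move=> kA; apply: AP; rewrite mem_cat kA.
  have PB k : k \in B -> P k by move=> kB; apply: AP; rewrite mem_cat !inE kB ?orbT.
  have : tx A * br (x i) (x j) * tx B \in Tf (ideg s0).
    apply: Tf_mono (Tf_mul (Tf_mul (tx_Tf PA) (br_x Pi Pj)) (tx_Tf PB)).
    rewrite -dA ideg_cat !ideg_cons; have := hdeg i; lia.
  move=> /(IH _ sn); apply: lspan_mono => t [[s [os ss] <-]|tM]; last first.
    by right; apply: Mrel_mono tM; apply: ltnW.
  by left; exists s => //; split=> //; apply: ltn_trans sn.
move=> t pe st; apply: mem_lspan; left; exists t => //; split; last by rewrite /= (ideg_perm pe).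
by split=> // i; rewrite (perm_mem pe); exact: sP.
Qed.

(** Rewrite t to ordered monomials; as these are independent in Z, what remains is
    zero. *)
Lemma Tf_ker n t : t \in Tf n -> evZ t = 0 -> t \in Mrel n.
Proof.
move=> /Tf_normal/lspanU[u [v [us vM ->]]].
have {vM} vM : v \in Mrel n by move: v vM; apply: lspan_sub.
rewrite (linD evZ_lin) (evZ_Mrel vM) addr0 => evu.
have -> : u = sec (evZ u).
  move: u us {evu}; apply: lspan_ind; first by rewrite (lin0 evZ_lin) (lin0 sec_lin).
  by move=> c _ w [s [os _] <-] IH; rewrite evZ_lin sec_lin -IH evZ_tx sec_zmn.
by rewrite evu (lin0 sec_lin) add0r.
Qed.

Lemma br_skew q r a b : par q a -> par r b -> br a b = - (sgn q r *: br b a).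
Proof.
move=> pa pb; rewrite (br_par b pa) (br_par a pb) (cz_par _ _ pb) (cz_par _ _ pa).
rewrite -(linZ sec_lin) -(linN sec_lin); congr sec.
by rewrite scalerBr scalerA [sgn r q]sgnC sgn_sq scale1r opprB.
Qed.

(** The Jacobi defect has degree less than the sum of the three degrees, and its
    image in Z vanishes by the Jacobi identity of the supercommutator. *)
Lemma br_jacobi l m n q r s a b c : a \in Wd l -> b \in Wd m -> c \in Wd n ->
  par q a -> par r b -> par s c ->
  brl a (br b c) - brr (br a b) c - sgn q r *: brl b (br a c) \in Mrel (l + m + n).
Proof.
move=> al bm cn pa pb pc; rewrite (brl_par _ pa) (brl_par _ pb) (brr_par _ pc).
apply: Tf_ker.
  rewrite !rpredB ?rpredZ//.
  - by apply: Tf_mono (DL_Tf _ al (br_Wd bm cn)); lia.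
  - by apply: Tf_mono (DR_Tf _ cn (br_Wd al bm)); lia.
  - by apply: Tf_mono (DL_Tf _ bm (br_Wd al cn)); lia.
rewrite (linB evZ_lin) (linB evZ_lin) (linZ evZ_lin) (evZ_DL _ pa) (evZ_DL _ pb) (evZ_DR _ pc).
rewrite (evZ_br _ pb) !(evZ_br _ pa) !(cz_par _ _ pb) !(cz_par _ _ pc).
rewrite /par /= in pa pb pc.
set A := iota a in pa *; set B := iota b in pb *; set C := iota c in pc *.
have pM := superalg_parM hZ.
rewrite !(linB (czr _ _)) !(linZ (czr _ _)).
rewrite !(cz_par _ _ (pM _ _ _ _ pb pc)) !(cz_par _ _ (pM _ _ _ _ pc pb)).
rewrite !(cz_par _ _ (pM _ _ _ _ pa pc)) !(cz_par _ _ (pM _ _ _ _ pc pa)).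
rewrite (linB (sigZ_lin s)) (linZ (sigZ_lin s)) (sigZ_par s (pM _ _ _ _ pa pb)).
rewrite (sigZ_par s (pM _ _ _ _ pb pa)) (linB (mull _)) (linZ (mull _)) (linB (mulr _)).
rewrite !(linZ (mulr _)) !mulA /sgn.
by case: q {pa} => /=; case: r {pb} => /=; case: s {pc} => /=;
  rewrite ?expr0 ?expr1; lmod K.
Qed.

(** ** Parities in the tensor algebra *)

Definition tparity (q : bool) : set T := [set t | t \in lspan
  [set t | exists s : seq (bool * W),
    [/\ forall u, u \in s -> par u.1 u.2,
        \big[addb/false]_(u <- s) u.1 = q & t = \prod_(u <- s) ti u.2]]].

Lemma tparity_word b q (s : seq (bool * W)) : (forall u, u \in s -> par u.1 u.2) ->
  \big[addb/false]_(u <- s) u.1 = q ->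
  sigT b (\prod_(u <- s) ti u.2) = sgn b q *: (\prod_(u <- s) ti u.2) /\
  zpar q (evZ (\prod_(u <- s) ti u.2)).
Proof.
elim: s q => [|[r w] s IH] q sP.
  rewrite !big_nil => <-; rewrite sigT1 evZ1 /sgn andbF scale1r; split=> //.
  exact: superalg_par1 hZ.
have wr : par r w by apply: (sP (r, w)); rewrite inE eqxx.
have sP' u : u \in s -> par u.1 u.2 by move=> us; apply: sP; rewrite inE us orbT.
rewrite !big_cons /= => <-; have [e1 e2] := IH _ sP' erefl; split.
  by rewrite sigTM e1 sigT_ti (sigW_par b wr) (linZ lti) scAl scAr scalerA sgn_addbr.
by rewrite evZM evZ_ti; apply: (superalg_parM hZ).
Qed.

Lemma sigT_tparity b q t : tparity q t -> sigT b t = sgn b q *: t.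
Proof.
move: t; apply: lspan_ind; first by rewrite (lin0 (sigT_lin b)) scaler0.
move=> c _ v [s [sP sq ->]] IH; have [e1 _] := tparity_word b sP sq.
by rewrite sigT_lin IH e1; lmod K.
Qed.

Lemma evZ_tparity q t : tparity q t -> zpar q (evZ t).
Proof.
have [z0 zL] := zpar_sub q; move: t; apply: lspan_ind; first by rewrite (lin0 evZ_lin).
move=> c _ v [s [sP sq ->]] IH; have [_ e2] := tparity_word false sP sq.
by rewrite evZ_lin; apply: zL.
Qed.

Lemma tx_tparity s : (forall i, i \in s -> P i) -> tparity (ipar s) (tx s).
Proof.
move=> sP; apply: mem_lspan; exists [seq (p i, x i) | i <- s]; split.
- by move=> _ /mapP[i /sP Pi ->]; exact: x_par.
- by rewrite big_map /=; elim: s {sP} => [|i s IH]; rewrite ?big_nil ?big_cons //= IH.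
by rewrite big_map /tx /tw big_map.
Qed.

Lemma zmn_par s : (forall i, i \in s -> P i) -> zpar (ipar s) (zmn s).
Proof. by move=> sP; rewrite -evZ_tx; apply/evZ_tparity/tx_tparity. Qed.

Lemma sec_tparity q z : zpar q z -> tparity q (sec z).
Proof.
move=> zq; have := dsum_label (superalg_direct hZ) (fun s (os : ordw s) => zmn_par os.1) zq (hbas.1 z).
move: z {zq}; apply: lspan_ind; first by rewrite (lin0 sec_lin); apply: rpred0.
move=> c _ v [s [os <-] <-] IH; rewrite sec_lin sec_zmn//.
by rewrite /tparity /= rpredD// rpredZ//; apply: tx_tparity; case: os.
Qed.

Lemma br_tparity q r a b : par q a -> par r b -> tparity (q (+) r) (br a b).
Proof.
move=> pa pb; rewrite (br_par b pa) (cz_par _ _ pb); apply: sec_tparity.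
have pM := superalg_parM hZ; rewrite addrC -scaleNr; apply: (zpar_sub _).2; last exact: pM.
by rewrite addbC; apply: pM.
Qed.

Lemma brl1 a : brl a 1 = 0.
Proof.
rewrite /brl; have [_ -> _] := DLP false (prW false a).
by have [_ -> _] := DLP true (prW true a); rewrite addr0.
Qed.

Lemma brr1 c : brr 1 c = 0.
Proof.
rewrite /brr; have [_ -> _] := DRP false (prW false c).
by have [_ -> _] := DRP true (prW true c); rewrite addr0.
Qed.

Lemma brl_mul q r a t u : par q a -> tparity r t ->
  brl a (t * u) = brl a t * u + sgn q r *: (t * brl a u).
Proof.
by move=> pa pt; rewrite !(brl_par _ pa) DL_mul (sigT_tparity q pt) scAl.
Qed.

Lemma brr_mul q r t u c : tparity q u -> par r c ->
  brr (t * u) c = t * brr u c + sgn q r *: (brr t c * u).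
Proof.
by move=> pu pc; rewrite !(brr_par _ pc) DR_mul (sigT_tparity r pu) scAr sgnC.
Qed.

Lemma br_sec w v : br w v = sec (evZ (br w v)).
Proof. by rewrite /br -(linD sec_lin) evZ_sec. Qed.

Lemma sec_ordered z : sec z \in lspan (tx @` ordw).
Proof.
move: z (hbas.1 z); apply: (lspan_lin sec_lin) => _ [s os <-].
by rewrite sec_zmn//; apply: mem_lspan; exists s.
Qed.

End QuasiCommutative.

(** * Enveloping algebras of non-linear Lie superalgebras *)

Section EnvelopingAlgebra.
Context {R : realType}.
Local Notation K := (R[i]).
Context {Z : lmodType K} (zpar : bool -> set Z) (one : Z) (mul : Z -> Z -> Z).
Context (hZ : is_superalgebra zpar one mul).
Context {W : lmodType K} (iota : W -> Z) (li : linear iota) (ii : injective iota).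
Context {d : Order.disp_t} {I : orderType d} (P : set I) (x : I -> W) (p : I -> bool)
  (deg : I -> nat).
Context (hdeg : forall i, (0 < deg i)%N).
Context (hx : forall w, w \in lspan (x @` P)).
Context (hxp : forall i, P i -> zpar (p i) (iota (x i))).
Context (hbas : is_basis (ordw P p) (zmn one mul iota x)).
Context (hcomm : forall i j, P i -> P j ->
  mul (iota (x i)) (iota (x j)) - sgn (p i) (p j) *: mul (iota (x j)) (iota (x i))
    \in lspan (zmn one mul iota x @` [set s | ordw P p s /\ (ideg deg s < deg i + deg j)%N])).
Context (G : set R) (hG : is_discrete_subgroup G) (eta : R) (eta0 : 0 < eta).
Context (Geta : forall y, G y -> exists k : int, y = k%:~R * eta).
Context (Ge : (exists z, Gpos G z) -> G eta).
Context (zeta : I -> R) (zetaE : forall i, P i -> zeta i = (deg i)%:R * eta).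
Context (hzeta : forall i, P i -> Gpos G (zeta i)).
Context (gr : R -> set W).
Context (grE : forall z w, gr z w <-> w \in lspan (x @` [set i | P i /\ zeta i = z])).

Local Notation T := (tens W).
Local Notation ti := (@tin K W).
Let lti : linear (ti : W -> (T : algType K)) := @tin_linear K W.
Let hT : tensor_like (T := T : algType K) ti := tens_tensor_like W.
Local Notation par := (par zpar iota).
Local Notation br := (br hZ li hx hbas (T := T : algType K) ti).
Local Notation brl := (brl hZ li hx hbas lti hT).
Local Notation brr := (brr hZ li hx hbas lti hT).
Local Notation evZ := (evZ hZ li hT).
Local Notation sec := (sec hbas (T := T : algType K) ti).
Local Notation Mrel := (Mrel hZ li deg hx hbas (T := T : algType K) ti).
Local Notation Tf := (Tf P x deg (T := T : algType K) ti).
Local Notation Wd := (Wd P x deg).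
Local Notation tx := (tx x (T := T : algType K) ti).
Local Notation ideg := (ideg deg).

Lemma gr_Wd z w : Gpos G z -> gr z w -> exists n : nat,
  [/\ (0 < n)%N, z = n%:R * eta & w \in Wd n].
Proof.
move=> [Gz z0] /grE ws; have [k zk] := Geta Gz.
have k0 : 0 < k by move: z0; rewrite zk pmulr_lgt0// ltr0z.
exists (absz k); split; [by move: k0; clear; lia| |].
  by rewrite zk pmulrn; congr (_ * _); congr (_ *~ _); move: k0; clear; lia.
apply: lspan_mono ws => _ [i [Pi zi] <-]; exists i => //; split=> //.
have : (deg i)%:R * eta = k%:~R * eta by rewrite -zetaE// zi zk.
move=> /(mulIf (lt0r_neq0 eta0)); rewrite pmulrn => /eqP; rewrite eqr_int => /eqP.
by clear; lia.
Qed.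

Lemma G_ideg s : (forall i, i \in s -> P i) -> Gge0 G ((ideg s)%:R * eta).
Proof.
move=> sP; split; last by rewrite mulr_ge0// ltW.
case: s sP => [_|i s sP]; first by rewrite mul0r; case: hG.
apply: Gmuln => //; apply: Ge; exists (zeta i); apply: hzeta; apply: sP.
by rewrite inE eqxx.
Qed.

Lemma tx_tfil s z : (forall i, i \in s -> P i) -> (ideg s)%:R * eta <= z ->
  tx s \in tfil G gr z.
Proof.
move=> sP sz; apply: mem_lspan; exists [seq (zeta i, x i) | i <- s]; split.
- move=> _ /mapP[i /sP Pi ->]; split; first exact: hzeta.
  by apply/grE; apply: mem_lspan; exists i.
- apply: le_trans sz; rewrite big_map /=; elim: s sP => [|i s IH] sP.
    by rewrite big_nil mul0r.
  rewrite big_cons ideg_cons natrD mulrDl -zetaE ?lerD2l; last by apply: sP; rewrite inE eqxx.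
  by apply: IH => j js; apply: sP; rewrite inE js orbT.
by rewrite /tx /tw !big_map.
Qed.

Lemma Tf_tfil n t z : t \in Tf n -> (n.-1)%:R * eta <= z -> t \in tfil G gr z.
Proof.
move=> tn nz; move: t tn; apply: lspan_sub => _ [s [sP sn] <-]; apply: tx_tfil => //.
by apply: le_trans nz; rewrite ler_pM2r// ler_nat; move: sn; lia.
Qed.

Lemma x_gr i : P i -> gr (zeta i) (x i).
Proof. by move=> Pi; apply/grE; apply: mem_lspan; exists i. Qed.

Lemma Mrel_mrel_fil n t z : t \in Mrel n -> (n.-1)%:R * eta <= z ->
  t \in mrel_fil G par gr br z.
Proof.
move=> tn nz; move: t tn; apply: lspan_sub => _ [A [i [j [B [AP An ->]]]]].
have Pi : P i by apply: AP; rewrite mem_cat !inE eqxx ?orbT.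
have Pj : P j by apply: AP; rewrite mem_cat !inE eqxx ?orbT.
have PA k : k \in A -> P k by move=> kA; apply: AP; rewrite mem_cat kA.
have PB k : k \in B -> P k by move=> kB; apply: AP; rewrite mem_cat !inE kB ?orbT.
apply: mem_lspan; exists (zeta i), (zeta j), ((ideg A)%:R * eta), ((ideg B)%:R * eta).
exists (p i), (p j), (x i), (x j), (tx A), (tx B); split.
- by split; [exact: hzeta|exact: hzeta|exact: G_ideg|exact: G_ideg].
- apply: le_trans nz; rewrite !zetaE// -!mulrDl -!natrD ler_pM2r// ler_nat.
  by move: An; rewrite ideg_cat !ideg_cons; lia.
- by split; [exact: x_gr|exact: hxp|exact: x_gr|exact: hxp].
- by split; apply: tx_tfil.
by [].
Qed.

Lemma evZ_mrel_fil z t : t \in mrel_fil G par gr br z -> evZ t = 0.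
Proof.
have lpi := evZ_lin hZ li hT.
move: t; apply: lspan_ind; first exact: (lin0 lpi).
move=> c _ v [z1 [z2 [z3 [z4 [q [r [a [b [A [B [_ _ [_ qa _ rb] _ ->]]]]]]]]]]] IH.
by rewrite lpi IH addr0 (evZ_rel hZ li ii hx hxp hbas hT A B qa rb) scaler0.
Qed.

(** The strict bound m + n on degrees is the bound (m + n - 1) eta, that is, the
    element of the group of degrees preceding (m + n) eta. *)
Lemma enveloping_nonlinear_lie : is_nonlinear_lie G par gr br.
Proof.
have grF : gr = fun z => [set v | v \in lspan (x @` [set i | P i /\ zeta i = z])].
  by apply/funext => z; apply/predeqP => w; exact: grE.
have hW := par_direct hZ li ii hx hxp.
split.
- split=> //.
    rewrite grF; apply: (basis_direct_sum (x_basis hZ li hx hbas) (Q := Gpos G)).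
    exact: hzeta.
  move=> z w _ /grE; apply: lspan_mono => _ [i [Pi zi] <-].
  by exists (p i) => //; split; [rewrite -zi; exact: x_gr|exact: hxp].
- by split=> [v|w]; [exact: br_l|exact: br_r].
- by move=> q r a b qa rb; apply: br_tparity.
- move=> z1 z2 a b G1 G2 h1 h2; have [m [m0 zm am]] := gr_Wd G1 h1.
  have [n [n0 zn bn]] := gr_Wd G2 h2.
  have ge : G eta by apply: Ge; exists z1.
  rewrite zm zn -mulrDl -natrD -(prednK (n := m + n)) ?addn_gt0 ?m0// Gprev_nat//.
  by apply: (Tf_tfil (n := m + n)) => //; apply: br_Wd.
- by move=> q r a b qa rb; apply: br_skew.
exists brl, brr; split.
  split; [exact: brl_bilinear|exact: brr_bilinear| | |].
  - by split=> a b; [apply: brl_ti|apply: brr_ti].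
  - by split=> [a|a q r B C qa rB]; [exact: brl1|apply: brl_mul].
  - by split=> [c|A q r B c qB rc]; [exact: brr1|apply: brr_mul].
move=> z1 z2 z3 q r s a b c G1 G2 G3 h1 h2 h3 qa rb sc.
have [l [l0 zl al]] := gr_Wd G1 h1; have [m [m0 zm bm]] := gr_Wd G2 h2.
have [n [n0 zn cn]] := gr_Wd G3 h3.
have ge : G eta by apply: Ge; exists z1.
rewrite zl zm zn -!mulrDl -!natrD -(prednK (n := l + m + n)) ?addn_gt0 ?l0// Gprev_nat//.
apply: (Mrel_mrel_fil (n := l + m + n)) => //.
exact: (br_jacobi two_neq0 hZ li ii hdeg hx hxp hbas hcomm lti hT al bm cn qa rb sc).
Qed.

Local Notation U := (uenv G par gr br).

Lemma evZ_ideal t : t \in lspan (ideal_gen (mrel G par gr br)) -> evZ t = 0.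
Proof.
have lpi := evZ_lin hZ li hT.
move: t; apply: lspan_ind; first exact: (lin0 lpi).
move=> c _ v [a [r [b [[z _ rz] ->]]]] IH; rewrite lpi IH addr0.
rewrite (evZM hZ li hT) (evZM hZ li hT) (evZ_mrel_fil rz).
have [ml mr] := superalg_bilinear hZ.
by rewrite (lin0 (mr _)) (lin0 (ml _)) scaler0.
Qed.

(** The map induced by T(W) -> Z on U(W). *)
Definition envphi (u : U) : Z := evZ (repr (u : lquot (ideal_gen (mrel G par gr br)))).

Lemma envphiE t : envphi (uproj t) = evZ t.
Proof.
have lpi := evZ_lin hZ li hT.
apply/eqP; rewrite -subr_eq0 /envphi -(linB lpi); apply/eqP; apply: evZ_ideal.
by apply/aproj_eq; rewrite aprojK.
Qed.

Lemma uprojK (u : U) : exists t, u = uproj t.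
Proof. by exists (repr (u : lquot (ideal_gen (mrel G par gr br)))); rewrite /uproj aprojK. Qed.

(** Every tensor has some degree n, so [Tf_ker] applies. *)
Lemma envphi_inj t : evZ t = 0 -> (uproj t : U) = 0.
Proof.
move=> t0; have [n tn] := Tf_all two_neq0 deg hx lti hT t.
have tM : t \in Mrel n by exact: (Tf_ker two_neq0 ii hdeg hx hxp hbas hcomm tn t0).
rewrite -[0](raddf0 (@aproj _ _ (mrel G par gr br))); apply/aproj_eq; rewrite subr0.
move: t {tn t0} tM; apply: lspan_sub => r [A [i [j [B [AP An rE]]]]].
apply: mem_lspan; exists 1, r, 1; split; last by rewrite mul1r mulr1.
exists ((ideg (A ++ i :: j :: B))%:R * eta); first exact: G_ideg.
apply: (Mrel_mrel_fil (n := (ideg (A ++ i :: j :: B)).+1)) => //.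
by apply: mem_lspan; exists A, i, j, B; split.
Qed.

(** The inverse of [envphi] is the section [sec] followed by T(W) -> U(W). *)
Theorem enveloping_iso :
  superalgebra_iso (upar (G := G) (par := par) (gr := gr) br) 1 *%R zpar one mul envphi.
Proof.
have lpi := evZ_lin hZ li hT.
have lphi : linear envphi.
  move=> c u v; have [t ->] := uprojK u; have [s ->] := uprojK v.
  by rewrite /uproj -linearZ -raddfD !envphiE lpi.
split=> //.
- pose inv z : U := uproj (sec z).
  have invl z : envphi (inv z) = z by exact: etrans (envphiE (sec z)) (evZ_sec hZ li hbas hT z).
  have invr u : inv (envphi u) = u.
    have [t ->] := uprojK u; rewrite (envphiE t).
    have h0 : (uproj (sec (evZ t) - t) : U) = 0.
      by apply: envphi_inj; rewrite (linB lpi) evZ_sec subrr.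
    apply/eqP; rewrite -subr_eq0; apply/eqP; rewrite -[RHS]h0.
    exact/esym/(raddfB (@aproj _ _ (mrel G par gr br))).
  exact: Bijective invr invl.
- have -> : (1 : U) = uproj 1 by rewrite /uproj rmorph1.
  by rewrite envphiE evZ1.
- move=> u v; have [t ->] := uprojK u; have [s ->] := uprojK v.
  by rewrite /uproj -rmorphM !envphiE evZM.
move=> q _ [t tq <-]; rewrite envphiE; exact: (evZ_tparity hZ li ii hx hxp hbas lti hT tq).
Qed.

Lemma envphi_uin w : envphi (uin w) = iota w.
Proof. by rewrite /uin envphiE evZ_ti. Qed.

End EnvelopingAlgebra.

(** * The Zhu algebra as an enveloping algebra *)

Lemma eq_basis (K : fieldType) (W : lmodType K) (T : choiceType) (P : set T) (f f' : T -> W) :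
  (forall t, P t -> f t = f' t) -> is_basis P f -> is_basis P f'.
Proof.
move=> ff [sp fr]; split=> [v|s c us sP s0].
  by apply: lspan_mono (sp v) => _ [t Pt <-]; exists t; rewrite ?ff.
apply: fr => //; rewrite -[RHS]s0 big_seq [RHS]big_seq; apply: eq_bigr => t ts.
by rewrite ff//; apply: sP.
Qed.

Section Normalization.
Context {R : realType} {V : lmodType R[i]} (VA : vertexSuperalgebra V) (H g : V -> V).
Context (hHreal : forall (v : V) (c : R[i]), v != 0 -> H v = c *: v -> c \is Num.real).
Context (hgmod : forall (v : V) (c : R[i]), v != 0 -> g v = c *: v -> `|c| = 1).

(** The eigenvalue of g has modulus 1, so it is exp (2 pi i c), and c can be
    shifted by an integer to satisfy the normalization of gamma. *)
Lemma eigen_hom_norm (v : V) : v != 0 -> (exists c : R[i], H v = c *: v) ->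
  (exists c : R[i], g v = c *: v) -> exists cD : R * R, hom_norm H g cD.1 cD.2 v.
Proof.
move=> v0 [c Hv] [z gv].
have [] := @hn_exists R V H g z (complex.Re c) v gv (hgmod v0 gv).
  by rewrite Hv; congr (_ *: _); rewrite RRe_real//; apply: hHreal v0 Hv.
by move=> c' h; exists (c', complex.Re c).
Qed.

Context (G : set R) (hG : is_discrete_subgroup G) (eta : R) (eta0 : 0 < eta).
Context (Geta : forall x, G x -> exists k : int, x = k%:~R * eta).
Context (Ge : (exists z, Gpos G z) -> G eta).
Context {I : Type} (e : I -> V) (zeta : I -> R) (hzeta : forall i, Gpos G (zeta i)).

Lemma integral_degrees : exists deg : I -> nat,
  forall i, (0 < deg i)%N /\ zeta i = (deg i)%:R * eta.
Proof.
suff : forall i, exists n : nat, (0 < n)%N /\ zeta i = n%:R * eta by move=> /choice [f h]; exists f.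
move=> i; have [Gz z0] := hzeta i; have [k zk] := Geta Gz.
have k0 : 0 < k by move: z0; rewrite zk pmulr_lgt0// ltr0z.
exists (absz k); split; first by move: k0; clear; lia.
by rewrite zk pmulrn; congr (_ * _); congr (_ *~ _); move: k0; clear; lia.
Qed.

Lemma pregraded_Fil (deg : I -> nat) : pregraded VA G e zeta ->
  (forall i, (0 < deg i)%N /\ zeta i = (deg i)%:R * eta) ->
  forall i j (n : nat), nprod VA n (e i) (e j) \in Fil VA e deg (deg i + deg j).
Proof.
move=> hpre hdeg i j n.
have ge : G eta by apply: Ge; exists (zeta i).
have eg k : e k \in gen_deg e zeta (zeta k) by apply: mem_lspan; exists k.
apply: (vfil_Fil eta0 (fun i => (hdeg i).2) _ (hpre _ _ _ _ (hzeta i) (hzeta j) (eg i) (eg j) n)).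
rewrite (hdeg i).2 (hdeg j).2 -mulrDl -natrD.
have m0 : (0 < deg i + deg j)%N by rewrite addn_gt0 (hdeg i).1.
rewrite -[X in Gprev G (X%:R * _)](prednK m0) Gprev_nat// ltr_pM2r// ltr_nat.
by rewrite prednK.
Qed.

End Normalization.

Section Main.
Context (R : realType) (V : lmodType R[i]) (VA : vertexSuperalgebra V).
Context (H g : V -> V) (hH : is_hamiltonian VA H) (hg : is_automorphism VA g).
Context (d : Order.disp_t) (I : orderType d) (e : I -> V) (p : I -> bool).
Context (hep : forall i, vpar VA (p i) (e i)).
Context (hfree : freely_generated VA p e).
Context (deg : I -> nat) (ce De : I -> R) (heD : forall i, hom_norm H g (ce i) (De i) (e i)).
Context (hdeg : forall i, (0 < deg i)%N).
Context (hpre : forall i j (n : nat), nprod VA n (e i) (e j) \in Fil VA e deg (deg i + deg j)).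
Context (st : V -> V -> V) (stl : forall b, linear (st ^~ b)) (str : forall a, linear (st a)).
Context (stE : forall D a b, H a = (D%:C)%C *: a -> st a b = starn VA (-1) D a b).
Local Notation tau := (tau VA H g).
Local Notation Z := (zhu VA H g).
Local Notation W := (zhuR VA H g e).
Local Notation mul := (zmul (VA := VA) (H := H) (g := g) st).
Local Notation K := (R[i]).

Definition gen_in : set I := [set i | untwisted H g (e i)].
(** For a twisted generator this is the default value 0. *)
Definition zgen (i : I) : W := insubd (0 : W) (tau (e i)).

Lemma gen_RgH i : gen_in i -> e i \in RgH VA H g e.
Proof. by move=> ui; apply: mem_lspan; exists 0%N; exists (e i) => //; apply: mem_lspan; exists i. Qed.

Lemma zgenE i : gen_in i -> val (zgen i) = tau (e i).
Proof.
move=> ui; rewrite /zgen val_insubd; case: ifP => // /negP[].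
by apply: mem_lspan; exists (e i) => //; apply: gen_RgH.
Qed.

Lemma valW_linear : linear (val : W -> Z). Proof. exact: linearP. Qed.

Lemma zgen_pull (Q : set I) (w : W) : Q `<=` gen_in ->
  val w \in lspan ([set tau (e i) | i in Q]) -> w \in lspan (zgen @` Q).
Proof.
move=> QP ws; suff [w' w's ww'] : exists2 w' : W, w' \in lspan (zgen @` Q) & val w' = val w.
  by rewrite -(val_inj ww').
move: (val w) ws; apply: lspan_ind; first by exists 0; [exact: rpred0|exact: (lin0 valW_linear)].
move=> c _ v [i Qi <-] [w' w's <-]; exists (c *: zgen i + w').
  by rewrite rpredD// rpredZ// mem_lspan//; exists i.
by rewrite valW_linear zgenE//; apply: QP.
Qed.

Lemma tau_gens (Q : set I) a : Q `<=` gen_in -> a \in lspan [set e i | i in Q] ->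
  tau a \in lspan [set tau (e i) | i in Q].
Proof.
move=> QP; apply: tau_span => _ [i Qi <-]; first by apply: gen_VgH; apply: QP.
by apply: mem_lspan; exists i.
Qed.

(** By [tau_der] derivatives of generators are multiples of generators in the
    Zhu algebra. *)
Lemma zgen_span w : w \in lspan (zgen @` gen_in).
Proof.
apply: zgen_pull => //; have := valP w; apply: lspan_sub => _ [a aR <-].
have [b bv ->] := tau_RgH hH hg deg hep heD hfree aR.
exact: tau_gens.
Qed.

Lemma zgen_lift (Q : set I) w : Q `<=` gen_in -> w \in lspan (zgen @` Q) ->
  exists2 a, a \in lspan [set e i | i in Q] & val w = tau a.
Proof.
move=> QP; move: w; apply: lspan_ind; first by exists 0; rewrite ?rpred0 ?tau0// (lin0 valW_linear).
move=> c _ v [i Qi <-] [a aQ ve]; exists (c *: e i + a).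
  by rewrite rpredD// rpredZ// mem_lspan//; exists i.
have aU : a \in VgH H g.
  by move: a aQ {ve}; apply: lspan_sub => _ [j /QP uj <-]; apply: gen_VgH.
by rewrite valW_linear zgenE ?tau_lin ?ve//; [apply: gen_VgH; apply: QP|apply: QP].
Qed.

Lemma zgen_par i : gen_in i -> zhu_par VA H g (p i) (val (zgen i)).
Proof. by move=> ui; rewrite zgenE//; exists (e i) => //; split=> //; apply: gen_VgH. Qed.

Lemma zgen_monomials s : (forall i, i \in s -> gen_in i) ->
  zmon VA H g e st s = zmn (tau (vac VA)) mul (val : W -> Z) zgen s.
Proof.
move=> us; rewrite /zmon /zmn; congr foldr; apply/eq_in_map => i /us ui.
by rewrite zgenE.
Qed.

Lemma zgen_basis : is_basis (ordw gen_in p) (zmn (tau (vac VA)) mul (val : W -> Z) zgen).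
Proof.
apply: eq_basis (zmon_basis hH hg hep heD hdeg hpre hfree stl str stE) => s [us _].
exact: zgen_monomials.
Qed.

Lemma zgen_comm i j : gen_in i -> gen_in j ->
  mul (val (zgen i)) (val (zgen j)) - sgn (p i) (p j) *: mul (val (zgen j)) (val (zgen i))
    \in lspan (zmn (tau (vac VA)) mul (val : W -> Z) zgen @`
          [set s | ordw gen_in p s /\ (ideg deg s < deg i + deg j)%N]).
Proof.
move=> ui uj; rewrite !zgenE//.
have iU := gen_VgH ui; have jU := gen_VgH uj.
rewrite (zhu_commutator hH hg hep heD hpre hfree stl str stE iU jU (hep i) (hep j) (heD i).1.2).
apply: S_mem => k; apply: rpredZ.
have := zhu_filtration hH hg hep heD hdeg hpre hfree stl str stE (hpre i j k) (VgH_nprod hH hg k iU jU).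
apply: lspan_mono => _ [s [[us ss] sd] <-]; exists s; first by split.
by rewrite -zgen_monomials.
Qed.

Context (G : set R) (zeta : I -> R).

Lemma zgen_grade z w : zhuR_gr VA H g e zeta z w <->
  w \in lspan (zgen @` [set i | gen_in i /\ zeta i = z]).
Proof.
have QP : [set i | gen_in i /\ zeta i = z] `<=` gen_in by move=> i [].
split=> [[a az wa]|/zgen_lift[//|a az wa]]; last by exists a.
by apply: zgen_pull => //; rewrite wa; apply: tau_gens.
Qed.

End Main.

Theorem theoremA (R : realType) (V : lmodType R[i]) (VA : vertexSuperalgebra V)
    (H g : V -> V)
    (hH : is_hamiltonian VA H)
    (hHreal : forall (v : V) (c : R[i]), v != 0 -> H v = c *: v -> c \is Num.real)
    (hg : is_automorphism VA g)
    (hgdiag : is_diagonalizable g)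
    (hgH : forall v, g (H v) = H (g v))
    (hgmod : forall (v : V) (c : R[i]), v != 0 -> g v = c *: v -> `|c| = 1)
    (d : Order.disp_t) (I : orderType d) (e : I -> V) (p : I -> bool)
    (hep : forall i, vpar VA (p i) (e i))
    (heH : forall i, exists c : R[i], H (e i) = c *: e i)
    (heg : forall i, exists c : R[i], g (e i) = c *: e i)
    (hfree : freely_generated VA p e)
    (G : set R) (hG : is_discrete_subgroup G)
    (zeta : I -> R) (hzeta : forall i, Gpos G (zeta i))
    (hpre : pregraded VA G e zeta) :
  exists mul : zhu VA H g -> zhu VA H g -> zhu VA H g,
    is_zhu_product mul /\
    is_superalgebra (zhu_par VA H g) (tau VA H g (vac VA)) mul /\
  exists br : zhuR VA H g e -> zhuR VA H g e -> tens (zhuR VA H g e),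
    is_nonlinear_lie G (zhuR_par VA H g e)
      (zhuR_gr VA H g e zeta) br /\
  exists phi : uenv G (zhuR_par VA H g e)
      (zhuR_gr VA H g e zeta) br -> zhu VA H g,
    superalgebra_iso (upar br) 1 *%R
      (zhu_par VA H g) (tau VA H g (vac VA)) mul phi /\
    (forall x : zhuR VA H g e, phi (uin x) = val x) /\
    (* tau(v_{g,H}) ~ v_{g,H}, and Zhu R = tau(v_{g,H}) generates Zhu V *)
    {in vgH H g e &, injective (tau VA H g)} /\
    (forall x : zhuR VA H g e, exists2 a, a \in vgH H g e & val x = tau VA H g a) /\
    (forall x : zhu VA H g, x \in lspan [set y | exists2 s : seq V,
       (forall a, a \in s -> a \in vgH H g e) &
       y = foldr mul (tau VA H g (vac VA)) [seq tau VA H g a | a <- s]]) /\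
    (* the defining relations *)
    (forall x y, br x y \in lspan (ordered_monomial VA H g p e)) /\
    (forall (D : R) (pa pb : bool) (a b : V),
       a \in vgH H g e -> b \in vgH H g e -> vpar VA pa a -> vpar VA pb b ->
       H a = (D%:C)%C *: a ->
       let rhs := \sum_(j \in [set: nat])
         gbinom (D - 1) j *: tau VA H g (nprod VA j a b) in
       mul (tau VA H g a) (tau VA H g b)
         - (-1) ^+ (pa && pb) *: mul (tau VA H g b) (tau VA H g a) = rhs /\
       forall x y : zhuR VA H g e, val x = tau VA H g a -> val y = tau VA H g b ->
         phi (uproj (br x y)) = rhs).
Proof.
have [eta [eta0 Geta Ge]] := discrete_cyclic hG.
have [deg degP] := integral_degrees eta0 Geta hzeta.
have hdeg i : (0 < deg i)%N by case: (degP i).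
have zetaE i : zeta i = (deg i)%:R * eta by case: (degP i).
have hpreF := pregraded_Fil hG eta0 Geta Ge hzeta hpre degP.
have [cD cDP] := choice (fun i => eigen_hom_norm hHreal hgmod (gen_neq0 hfree i) (heH i) (heg i)).
pose ce i := (cD i).1; pose De i := (cD i).2.
have heD i : hom_norm H g (ce i) (De i) (e i) := cDP i.
have [st [stl str stE]] := star_total hH.
have hZ := zhu_superalgebra hH hg hep heD hpreF hfree stl str stE.
exists (zmul (VA := VA) (H := H) (g := g) st); split.
  exact: (zmul_product hH hg hep heD hpreF hfree stl str stE).
split; first exact: hZ.
have li : linear (val : zhuR VA H g e -> zhu VA H g) by exact: valW_linear.
have hx w : w \in lspan (zgen VA H g e @` gen_in H g e).
  exact: (zgen_span hH hg hep hfree deg heD).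
have hxp i : gen_in H g e i -> zhu_par VA H g (p i) (val (zgen VA H g e i)).
  by apply: zgen_par.
have hbas := zgen_basis hH hg hep hfree heD hdeg hpreF stl str stE.
have hcomm i j := zgen_comm hH hg hep hfree heD hdeg hpreF stl str stE (i := i) (j := j).
have ii : injective (val : zhuR VA H g e -> zhu VA H g) by exact: val_inj.
have grE z w : zhuR_gr VA H g e zeta z w <->
    w \in lspan (zgen VA H g e @` [set i | gen_in H g e i /\ zeta i = z]).
  exact: zgen_grade.
pose br := br hZ li hx hbas (T := tens (zhuR VA H g e) : algType R[i]) (@tin _ (zhuR VA H g e)).
exists br; split.
  exact: (enveloping_nonlinear_lie hZ li ii hdeg hx hxp hbas hcomm hG eta0 Geta Ge
           (fun i _ => zetaE i) (fun i _ => hzeta i) grE).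
pose phi := envphi (hZ := hZ) (li := li) (hx := hx) (hbas := hbas) (G := G)
         (gr := zhuR_gr VA H g e zeta).
have phiE t := envphiE hZ li ii hx hxp hbas G (zhuR_gr VA H g e zeta) t.
(* L inverts tau on the span of the untwisted generators. *)
have [L [lL LE]] := basis_ext (x_basis hZ li hx hbas) e.
have LU w : L w \in VgH H g.
  by move: w (hx w); apply: (lspan_lin lL) => _ [i ui <-]; rewrite LE//; exact: gen_VgH.
have valL w : val w = tau VA H g (L w).
  move: w (hx w); apply: lspan_ind; first by rewrite (lin0 li) (lin0 lL) tau0.
  move=> c _ w [i ui <-] IH; rewrite li lL IH LE// tau_lin ?LU ?gen_VgH//.
  by rewrite zgenE.
have Lsurj a : a \in vgH H g e -> exists w, L w = a.
  move: a; apply: lspan_ind; first by exists 0; exact: (lin0 lL).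
  by move=> c _ v [i ui <-] [w <-]; exists (c *: zgen VA H g e i + w); rewrite lL LE.
exists phi; split.
  exact: (enveloping_iso hZ li ii hdeg hx hxp hbas hcomm hG eta0 Ge
           (fun i _ => zetaE i) (fun i _ => hzeta i) grE).
split; first exact: (envphi_uin hZ li ii hx hxp hbas).
split.
  move=> a b /Lsurj[w <-] /Lsurj[w' <-]; rewrite -!valL => /ii ww'.
  by rewrite ww'.
split.
  move=> w; have := hx w; exact: zgen_lift.
split.
  move=> z; apply: lspan_mono (hbas.1 z) => _ [s [us _] <-].
  exists [seq e i | i <- s].
    by move=> _ /mapP[i /us ui ->]; apply: mem_lspan; exists i.
  by rewrite -(zgen_monomials VA st us) /zmon -map_comp.
split.
  move=> x y; rewrite /br (br_sec hZ li hx hbas (tens_tensor_like _)).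
  apply: lspan_mono (sec_ordered hbas _ _) => _ [s [us ss] <-].
  exists s, [seq zgen VA H g e i | i <- s]; split=> //.
  by rewrite -map_comp; apply/eq_in_map => i /us ui /=; exact: zgenE.
move=> D pa pb a b av bv qa qb Ha rhs.
have aU := vgH_VgH av; have bU := vgH_VgH bv.
have comm : zmul st (tau VA H g a) (tau VA H g b)
         - (-1) ^+ (pa && pb) *: zmul st (tau VA H g b) (tau VA H g a) = rhs.
  exact: (zhu_commutator hH hg hep heD hpreF hfree stl str stE aU bU qa qb Ha).
split=> // x y xa yb; rewrite -comm; apply: etrans (phiE (br x y)) _; rewrite /br.
have px : par (zhu_par VA H g) (val : zhuR VA H g e -> zhu VA H g) pa x.
  by rewrite /par /= xa; exists a.
have py : zhu_par VA H g pb (val y) by rewrite yb; exists b.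
by rewrite (evZ_br hZ li ii hx hxp hbas _ _ px) (cz_par hZ _ _ py) xa yb.
Qed.
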